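(* Let $F\colon\mathcal{M}\to\mathcal{N}$ be an exact functor between exact categories (which support long exact sequences). The functor $$\Psi\colon\mathrm{co}(F)\to B[F],\qquad (P,\alpha,Q)\mapsto\left(\begin{pmatrix}P\\Q\end{pmatrix},\,FQ,\,\begin{pmatrix}\alpha\\1\end{pmatrix}\right),$$ induces a well-defined homomorphism $$\Phi\colon K_0^{\mathrm B}[F]\to K_0[F]$$ from Bass's relative $K_0$-group to Grayson's relative $K_0$-group. If $\mathcal{M}$ and $\mathcal{N}$ are split exact and $F$ is cofinal, then $\Phi$ is an isomorphism.
   Context: **Standing assumption.** All exact categories are assumed to support long exact sequences: the exact category $\mathcal{A}$ admits a fully faithful embedding into an abelian category, closed under extensions and preserving and reflecting short exact sequences, such that a bounded chain complex in $\mathcal{A}$ is acyclic in $\mathcal{A}$ (i.e. spliced together from short exact sequences of $\mathcal{A}$) if and only if it is exact in the abelian category. (E.g. every idempotent complete exact category has this property.) A quasi-isomorphism is a chain map whose mapping cone is acyclic. **Complexes.** $C\mathcal{A}$ is the exact category of bounded chain complexes in $\mathcal{A}$ supported in non-negative degrees. A binary complex in $\mathcal{A}$ is a graded object $N_\bullet$ with two degree $-1$ differentials $d,\tilde d$, $d^2=0=\tilde d^2$; $\top N=(N_\bullet,d)$, $\bot N=(N_\bullet,\tilde d)$. Morphisms are degree $0$ maps that are chain maps for both differentials. $B\mathcal{A}$ is the exact category of bounded binary complexes in $\mathcal{A}$ supported in non-negative degrees. **Grayson's relative $K_0$.** $B[F]$ is the exact category of triples $(M,N,u)$ with $M=(\top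 M,\bot M)$ a pair of objects of $C\mathcal{M}$, $N\in B\mathcal{N}$, and $u$ a pair of quasi-isomorphisms $F(\top M)\to\top N$ and $F(\bot M)\to\bot N$. A morphism $(M,N,u)\to(M',N',u')$ is a pair $(\phi,\psi)$, with $\phi\colon M\to M'$ a pair of chain maps and $\psi\colon N\to N'$ a morphism in $B\mathcal{N}$, compatible with $u,u'$; exactness is componentwise. $C[F]$ is defined likewise with triples $(M,N,u)$, $M\in C\mathcal{M}$, $N\in C\mathcal{N}$, $u\colon FM\to N$ a quasi-isomorphism. $pB[F]$ and $pC[F]$ are the subcategories with all objects and those morphisms $(\phi,\psi)$ with $\phi$ a quasi-isomorphism and $\psi$ an isomorphism. $K_0pB[F]$ is the quotient of $K_0B[F]$ by the relations $[X]=[X']$ whenever there is a morphism $X\to X'$ in $pB[F]$; similarly $K_0pC[F]$. $\Delta\colon C[F]\to B[F]$ duplicates each component. Then $K_0[F]:=\mathrm{coker}(\Delta\colon K_0pC[F]\to K_0pB[F])$. **Bass's relative $K_0$.** $\mathrm{co}(F)$ is the exact category of triples $(P,\alpha,Q)$ with $P,Q\in\mathcal{M}$ and $\alpha\colon FP\to FQ$ an isomorphism in $\mathcal{N}$; a morphism $(P,\alpha,Q)\to(P',\alpha',Q')$ is a pair $f\colon P\to P'$, $g\colon Q\to Q'$ in $\mathcal{M}$ with $Fg\circ\alpha=\alpha'\circ Ff$; exactness is componentwise. $K_0^{\mathrm B}[F]$ is the quotient of $K_0\,\mathrm{co}(F)$ by the subgroup generated by all $[P,\beta\alpha,R]-[P,\alpha,Q]-[Q,\beta,R]$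 with $P,Q,R\in\mathcal{M}$ and isomorphisms $\alpha\colon FP\to FQ$, $\beta\colon FQ\to FR$. **The functor $\Psi$.** In $\Psi(P,\alpha,Q)$, $P$ (top) and $Q$ (bottom) are complexes concentrated in degree $0$, $FQ$ is a binary complex concentrated in degree $0$, and the pair of quasi-isomorphisms is $\alpha\colon FP\to FQ$ (top) and $1\colon FQ\to FQ$ (bottom). $\Psi$ acts on morphisms in the obvious way. **Further terms.** An exact category is split exact if all its short exact sequences split. $F$ is cofinal if for every $N\in\mathcal{N}$ there are $N'\in\mathcal{N}$ and $M\in\mathcal{M}$ with $N\oplus N'\cong FM$. *)

(* Defs.v *)
From HB Require Import structures.
From mathcomp Require Import all_boot all_algebra.
From mathcomp Require Import boolp freeg.

Set Implicit Arguments.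
Unset Strict Implicit.
Unset Printing Implicit Defensive.

Import GRing.Theory.
Local Open Scope ring_scope.

Reserved Notation "g \oc f" (at level 40, left associativity).

Record category := Category {
  ob :> Type;
  hom : ob -> ob -> Type;
  idm : forall A, hom A A;
  mcomp : forall A B C, hom B C -> hom A B -> hom A C;
  comp1m : forall A B (f : hom A B), mcomp (idm B) f = f;
  compm1 : forall A B (f : hom A B), mcomp f (idm A) = f;
  compA : forall A B C D (h : hom C D) (g : hom B C) (f : hom A B),
    mcomp h (mcomp g f) = mcomp (mcomp h g) f
}.
Arguments hom {c} A B.
Arguments idm {c} A.
Arguments mcomp {c A B C} g f.
Notation "g \oc f" := (mcomp g f).

Definition isom (C : category) (A B : C) (f : hom A B) : Prop :=
  exists g : hom B A, g \oc f = idm A /\ f \oc g = idm B.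

Definition isomorphic (C : category) (A B : C) : Prop :=
  exists f : hom A B, isom f.

Record functor (C D : category) := Functor {
  fob :> C -> D;
  fmap : forall A B, hom A B -> hom (fob A) (fob B);
  fmap1 : forall A, fmap (idm A) = idm (fob A);
  fmapM : forall A B C (g : hom B C) (f : hom A B),
    fmap (g \oc f) = fmap g \oc fmap f
}.
Arguments fmap {C D} F {A B} f : rename.

Definition fully_faithful (C D : category) (F : functor C D) : Prop :=
  forall A B : C, bijective (@fmap C D F A B).

Definition zero_object (C : category) (Z : C) : Prop :=
  forall A : C, (exists f : hom A Z, forall g, g = f)
             /\ (exists f : hom Z A, forall g, g = f).

Record addCategory := AddCategory {
  acat :> category;
  hom_zmod : forall A B : acat, GRing.Zmodule (@hom acat A B);
  homZ := fun A B => GRing.Zmodule.Pack (hom_zmod A B);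
  compDl : forall (A B C : acat) (g g' : homZ B C) (f : homZ A B),
    (g + g' : homZ B C) \oc f = (g \oc f : homZ A C) + g' \oc f;
  compDr : forall (A B C : acat) (g : homZ B C) (f f' : homZ A B),
    g \oc (f + f' : homZ A B) = (g \oc f : homZ A C) + g \oc f';
  zob : acat;
  zobP : zero_object zob;
  bip : acat -> acat -> acat;
  in1 : forall A B, hom A (bip A B);
  in2 : forall A B, hom B (bip A B);
  pr1 : forall A B, hom (bip A B) A;
  pr2 : forall A B, hom (bip A B) B;
  pr1in1 : forall A B, pr1 A B \oc in1 A B = idm A;
  pr2in2 : forall A B, pr2 A B \oc in2 A B = idm B;
  pr1in2 : forall A B, pr1 A B \oc in2 A B = 0 :> homZ B A;
  pr2in1 : forall A B, pr2 A B \oc in1 A B = 0 :> homZ A B;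
  bipE : forall A B,
    (in1 A B \oc pr1 A B : homZ _ _) + in2 A B \oc pr2 A B = idm (bip A B)
}.
Arguments zob {a}.
Arguments bip {a} A B.
Arguments in1 {a} A B.
Arguments in2 {a} A B.
Arguments pr1 {a} A B.
Arguments pr2 {a} A B.

HB.instance Definition _ (C : addCategory) (A B : C) := hom_zmod A B.

Section AddTheory.
Variable C : addCategory.
Implicit Types A B D : C.

Lemma compmDl A B D (g g' : hom B D) (f : hom A B) :
  (g + g') \oc f = g \oc f + g' \oc f.
Proof. exact: compDl. Qed.

Lemma compmDr A B D (g : hom B D) (f f' : hom A B) :
  g \oc (f + f') = g \oc f + g \oc f'.
Proof. exact: compDr. Qed.

Lemma comp0m A B D (f : hom A B) : (0 : hom B D) \oc f = 0.
Proof. by apply: (addrI (0 \oc f)); rewrite -compmDl !addr0. Qed.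

Lemma compm0 A B D (g : hom B D) : g \oc (0 : hom A B) = 0.
Proof. by apply: (addrI (g \oc 0)); rewrite -compmDr !addr0. Qed.

Lemma compNm A B D (g : hom B D) (f : hom A B) : (- g) \oc f = - (g \oc f).
Proof. by apply: (addrI (g \oc f)); rewrite -compmDl !subrr comp0m. Qed.

Lemma compmN A B D (g : hom B D) (f : hom A B) : g \oc (- f) = - (g \oc f).
Proof. by apply: (addrI (g \oc f)); rewrite -compmDr !subrr compm0. Qed.

Lemma zero_object_in A B (f g : hom A B) : zero_object B -> f = g.
Proof. by move=> /(_ A) [[h hE] _]; rewrite (hE f) (hE g). Qed.

Lemma zero_object_out A B (f g : hom A B) : zero_object A -> f = g.
Proof. by move=> /(_ B) [_ [h hE]]; rewrite (hE f) (hE g). Qed.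

Lemma zero_objectP A : zero_object A <-> idm A = 0.
Proof.
split=> [|A0 B]; first exact: zero_object_in.
by split; exists 0 => f; [rewrite -[f]comp1m A0 comp0m
                         | rewrite -[f]compm1 A0 compm0].
Qed.

Lemma zero_object_bip A B :
  zero_object A -> zero_object B -> zero_object (bip A B).
Proof.
move=> A0 B0; apply/zero_objectP; rewrite -bipE.
rewrite (zero_object_out (in1 A B) 0 A0) (zero_object_out (in2 A B) 0 B0).
by rewrite !comp0m addr0.
Qed.

Lemma zero_object_isom A B (f : hom A B) :
  zero_object A -> zero_object B -> isom f.
Proof.
by move=> A0 B0; exists 0; split; [exact: zero_object_in|exact: zero_object_in].
Qed.

Definition bip_in A B D (a : hom D A) (b : hom D B) : hom D (bip A B) :=
  in1 A B \oc a + in2 A B \oc b.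

Definition bip_out A B D (a : hom A D) (b : hom B D) : hom (bip A B) D :=
  a \oc pr1 A B + b \oc pr2 A B.

Lemma bip_out_in A B D T (a : hom A D) (b : hom B D) (x : hom T A)
    (y : hom T B) : bip_out a b \oc bip_in x y = a \oc x + b \oc y.
Proof.
rewrite /bip_out /bip_in compmDl !compmDr -!(compA a) -!(compA b).
rewrite !(compA (pr1 A B)) !(compA (pr2 A B)).
by rewrite pr1in1 pr1in2 pr2in1 pr2in2 !comp1m !comp0m !compm0 addr0 add0r.
Qed.

Lemma bip_in_comp A B D T (a : hom D A) (b : hom D B) (h : hom T D) :
  bip_in a b \oc h = bip_in (a \oc h) (b \oc h).
Proof. by rewrite /bip_in compmDl !compA. Qed.

Lemma bip_in0 A B D : bip_in (0 : hom D A) (0 : hom D B) = 0.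
Proof. by rewrite /bip_in !compm0 addr0. Qed.

End AddTheory.

Section Limits.
Variable C : addCategory.
Implicit Types A B D : C.

Definition monic A B (f : hom A B) : Prop :=
  forall T (x y : hom T A), f \oc x = f \oc y -> x = y.

Definition epic A B (f : hom A B) : Prop :=
  forall T (x y : hom B T), x \oc f = y \oc f -> x = y.

Definition is_kernel A B D (k : hom A B) (g : hom B D) : Prop :=
  g \oc k = 0 /\
  forall T (x : hom T B), g \oc x = 0 -> exists! y : hom T A, k \oc y = x.

Definition is_cokernel A B D (f : hom A B) (c : hom B D) : Prop :=
  c \oc f = 0 /\
  forall T (x : hom B T), x \oc f = 0 -> exists! y : hom D T, y \oc c = x.

Definition kernel_cokernel_pair A B D (f : hom A B) (g : hom B D) : Prop :=
  is_kernel f g /\ is_cokernel f g.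

Definition is_pushout A B A' B' (i : hom A B) (f : hom A A')
    (i' : hom A' B') (f' : hom B B') : Prop :=
  f' \oc i = i' \oc f /\
  forall T (x : hom B T) (y : hom A' T), x \oc i = y \oc f ->
    exists! z : hom B' T, z \oc f' = x /\ z \oc i' = y.

Definition is_pullback B D B' D' (p : hom B D) (f : hom D' D)
    (p' : hom B' D') (f' : hom B' B) : Prop :=
  p \oc f' = f \oc p' /\
  forall T (x : hom T B) (y : hom T D'), p \oc x = f \oc y ->
    exists! z : hom T B', f' \oc z = x /\ p' \oc z = y.

Definition abelian : Prop :=
  [/\ forall A B (f : hom A B), exists K (k : hom K A), is_kernel k f,
      forall A B (f : hom A B), exists Q (c : hom B Q), is_cokernel f c,
      forall A B (f : hom A B), monic f ->
        exists D (g : hom B D), is_kernel f g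
    & forall A B (f : hom A B), epic f ->
        exists D (g : hom D A), is_cokernel g f].

(** The image of [f], given by its epi-mono factorization, is a kernel of
    [g]. *)
Definition exact_at A B D (f : hom A B) (g : hom B D) : Prop :=
  exists I (e : hom A I) (m : hom I B),
    [/\ epic e, monic m, f = m \oc e & is_kernel m g].

End Limits.

Record addFunctor (C D : addCategory) := AddFunctor {
  afun :> functor C D;
  fmapD : forall (A B : C) (f g : hom A B),
    fmap afun (f + g) = fmap afun f + fmap afun g
}.

Section AddFunctorTheory.
Variables (C D : addCategory) (F : addFunctor C D).

Lemma fmap0 (A B : C) : fmap F (0 : hom A B) = 0.
Proof. by apply: (addrI (fmap F 0)); rewrite -fmapD !addr0. Qed.

Lemma fmap_zero_object (A : C) : zero_object A -> zero_object (F A).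
Proof. by rewrite !zero_objectP => A0; rewrite -fmap1 A0 fmap0. Qed.

Lemma fmap_isom (A B : C) (f : hom A B) : isom f -> isom (fmap F f).
Proof.
by case=> g [gf fg]; exists (fmap F g); rewrite -!fmapM gf fg !fmap1.
Qed.

End AddFunctorTheory.

(** A category with a distinguished class of composable pairs; the Grothendieck
    group of an exact category depends only on this part of its structure. *)
Record sesCategory := SesCategory {
  scat :> category;
  ses : forall A B C : scat, hom A B -> hom B C -> Prop
}.
Arguments ses {s A B C} f g.

Section ExactAxioms.
Variables (E : addCategory).
Variable conf : forall A B C : E, hom A B -> hom B C -> Prop.
Implicit Types A B C : E.

Definition inflation A B (i : hom A B) : Prop :=
  exists C (p : hom B C), conf i p.

Definition deflation B C (p : hom B C) : Prop :=
  exists A (i : hom A B), conf i p.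

Record exact_structure : Prop := ExactStructure {
  conf_kercok : forall A B C (i : hom A B) (p : hom B C),
    conf i p -> kernel_cokernel_pair i p;
  conf_isom : forall A B C A' B' C' (i : hom A B) (p : hom B C)
      (i' : hom A' B') (p' : hom B' C')
      (a : hom A A') (b : hom B B') (c : hom C C'),
    isom a -> isom b -> isom c ->
    b \oc i = i' \oc a -> c \oc p = p' \oc b -> conf i p -> conf i' p';
  inflation1 : forall A, inflation (idm A);
  deflation1 : forall A, deflation (idm A);
  inflationM : forall A B C (j : hom B C) (i : hom A B),
    inflation i -> inflation j -> inflation (j \oc i);
  deflationM : forall A B C (q : hom B C) (p : hom A B),
    deflation p -> deflation q -> deflation (q \oc p);
  inflation_pushout : forall A B A' (i : hom A B) (f : hom A A'),
    inflation i -> exists B' (i' : hom A' B') (f' : hom B B'),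
      is_pushout i f i' f' /\ inflation i';
  deflation_pullback : forall B C C' (p : hom B C) (f : hom C' C),
    deflation p -> exists B' (p' : hom B' C') (f' : hom B' B),
      is_pullback p f p' f' /\ deflation p'
}.

End ExactAxioms.

Record exactCategory := ExactCategory {
  eadd :> addCategory;
  conflation : forall A B C : eadd, hom A B -> hom B C -> Prop;
  exactP : exact_structure conflation
}.
Arguments conflation {e A B C} i p.

Definition ses_of_exact (E : exactCategory) : sesCategory :=
  SesCategory (@conflation E).

Record exactFunctor (M N : exactCategory) := ExactFunctor {
  efun :> addFunctor M N;
  fmap_conflation : forall (A B C : M) (i : hom A B) (p : hom B C),
    conflation i p -> conflation (fmap efun i) (fmap efun p)
}.

Definition split_exact (E : exactCategory) : Prop :=
  forall (A B C : E) (i : hom A B) (p : hom B C), conflation i p ->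
    exists (r : hom B A) (s : hom C B),
      [/\ r \oc i = idm A, p \oc s = idm C & i \oc r + s \oc p = idm B].

Definition cofinal (M N : exactCategory) (F : exactFunctor M N) : Prop :=
  forall A : N, exists (A' : N) (P : M), isomorphic (bip A A') (F P).

(** [cd X n] is the differential from degree [n.+1] to degree [n]. *)
Record cplx (A : addCategory) := Cplx {
  cob :> nat -> A;
  cd : forall n, hom (cob n.+1) (cob n);
  cdd : forall n, cd n \oc cd n.+1 = 0;
  cbnd : exists b : nat, forall n, (b <= n)%N -> zero_object (cob n)
}.
Arguments cd {A} X n : rename.

Record chmap (A : addCategory) (X Y : cplx A) := ChMap {
  cmap :> forall n, hom (X n) (Y n);
  cmapP : forall n, cmap n \oc cd X n = cd Y n \oc cmap n.+1
}.

Section ComplexCategory.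
Variable A : addCategory.
Implicit Types X Y Z : cplx A.

Lemma chmap_eq X Y (f g : chmap X Y) : (forall n, f n = g n) -> f = g.
Proof.
case: f g => [f fP] [g gP] /= fg.
have {}fg : f = g by apply: functional_extensionality_dep.
by subst g; rewrite (Prop_irrelevance fP gP).
Qed.

Definition chmap_id X : chmap X X.
Proof. by exists (fun n => idm (X n)) => n; rewrite comp1m compm1. Defined.

Definition chmap_comp X Y Z (g : chmap Y Z) (f : chmap X Y) : chmap X Z.
Proof.
by exists (fun n => g n \oc f n) => n; rewrite -compA cmapP !compA cmapP.
Defined.

Definition Ch : category.
Proof.
by exists (cplx A) (@chmap A) chmap_id chmap_comp => *; apply: chmap_eq => n /=;
  rewrite ?comp1m ?compm1 ?compA.
Defined.

End ComplexCategory.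

Section MappingCone.
Variables (A : addCategory) (X Y : cplx A) (f : chmap X Y).

(** In degree [n] this is [X_(n-1) (+) Y_n]; the differential is
    [(x, y) |-> (- d x, f x + d y)]. *)
Definition cone_ob n : A := if n is m.+1 then bip (X m) (Y m.+1) else Y 0.

Definition cone_d n : hom (cone_ob n.+1) (cone_ob n) :=
  match n return hom (cone_ob n.+1) (cone_ob n) with
  | 0 => bip_out (f 0) (cd Y 0)
  | m.+1 => bip_in (bip_out (- cd X m) 0) (bip_out (f m.+1) (cd Y m.+1))
  end.

Lemma cone_dd n : cone_d n \oc cone_d n.+1 = 0.
Proof.
have key m : bip_out (f m) (cd Y m) \oc
    bip_in (bip_out (- cd X m) 0) (bip_out (f m.+1) (cd Y m.+1)) = 0.
  rewrite bip_out_in /bip_out !compmDr !comp0m !compm0 addr0 !compA cdd comp0m.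
  rewrite addr0 -compmDl.
  by rewrite compmN cmapP addNr comp0m.
case: n => [|n] /=; first exact: key.
rewrite bip_in_comp key bip_out_in comp0m addr0 /bip_out comp0m addr0.
by rewrite compA compNm compmN opprK cdd comp0m bip_in0.
Qed.

Lemma cone_bnd : exists b : nat, forall n, (b <= n)%N -> zero_object (cone_ob n).
Proof.
have [b bX] := cbnd X; have [c cY] := cbnd Y.
exists (maxn b c).+1 => -[//|n]; rewrite ltnS geq_max => /andP[bn cn].
by apply: zero_object_bip; [exact: bX | apply: cY; exact: leqW].
Qed.

Definition cone : cplx A := Cplx cone_dd cone_bnd.

End MappingCone.

Section MapComplex.
Variables (A B : addCategory) (F : addFunctor A B).

Lemma map_cdd (X : cplx A) n : fmap F (cd X n) \oc fmap F (cd X n.+1) = 0.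
Proof. by rewrite -fmapM cdd fmap0. Qed.

Lemma map_cbnd (X : cplx A) :
  exists b : nat, forall n, (b <= n)%N -> zero_object (F (X n)).
Proof.
by have [b bX] := cbnd X; exists b => n /bX; exact: fmap_zero_object.
Qed.

Definition map_cplx (X : cplx A) : cplx B := Cplx (map_cdd X) (map_cbnd X).

Definition map_chmap (X Y : cplx A) (f : chmap X Y) :
  chmap (map_cplx X) (map_cplx Y).
Proof. by exists (fun n => fmap F (f n)) => n /=; rewrite -!fmapM cmapP. Defined.

End MapComplex.

(** [Z n] is the object of [n]-cycles: the conflations
    [Z n.+1 -> X n.+1 -> Z n] are spliced together, and at the bottom
    [Z 0 = X 0]. *)
Definition acyclic (E : exactCategory) (X : cplx E) : Prop :=
  exists (Z : nat -> E) (i : forall n, hom (Z n) (X n))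
         (p : forall n, hom (X n.+1) (Z n)),
    [/\ forall n, cd X n = i n \oc p n,
        isom (i 0)
      & forall n, conflation (i n.+1) (p n)].

Definition quasi_iso (E : exactCategory) (X Y : cplx E) (f : chmap X Y) : Prop :=
  acyclic (cone f).

Definition exact_cplx (A : addCategory) (X : cplx A) : Prop :=
  exact_at (cd X 0) (0 : hom (X 0) zob) /\ forall n, exact_at (cd X n.+1) (cd X n).

(** The abelian category [B] is taken in the same universe as [E]; this loses
    nothing, as [B] can be replaced by the closure of the image of [E] under
    finite direct sums, kernels and cokernels. Complexes in degrees [>= 0]
    represent all bounded ones up to a shift. *)
Definition supports_long_exact_sequences (E : exactCategory) : Prop :=
  exists (B : addCategory) (I : addFunctor E B),
    [/\ abelian B,
        fully_faithful I,
        forall (A C : E) (X : B) (f : hom (I A) X) (g : hom X (I C)),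
          kernel_cokernel_pair f g -> exists Y : E, isomorphic X (I Y),
        forall (A X C : E) (f : hom A X) (g : hom X C),
          conflation f g <-> kernel_cokernel_pair (fmap I f) (fmap I g)
      & forall X : cplx E, acyclic X <-> exact_cplx (map_cplx I X)].

Record bcplx (A : addCategory) := BCplx {
  bob :> nat -> A;
  bd : forall n, hom (bob n.+1) (bob n);
  bd' : forall n, hom (bob n.+1) (bob n);
  bdd : forall n, bd n \oc bd n.+1 = 0;
  bdd' : forall n, bd' n \oc bd' n.+1 = 0;
  bbnd : exists b : nat, forall n, (b <= n)%N -> zero_object (bob n)
}.
Arguments bd {A} N n : rename.
Arguments bd' {A} N n : rename.

Definition top (A : addCategory) (N : bcplx A) : cplx A :=
  Cplx (bdd N) (bbnd N).

Definition bot (A : addCategory) (N : bcplx A) : cplx A :=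
  Cplx (bdd' N) (bbnd N).

Record bmap (A : addCategory) (X Y : bcplx A) := BMap {
  bmap_fun :> forall n, hom (X n) (Y n);
  bmapP : forall n, bmap_fun n \oc bd X n = bd Y n \oc bmap_fun n.+1;
  bmapP' : forall n, bmap_fun n \oc bd' X n = bd' Y n \oc bmap_fun n.+1
}.

Definition top_map (A : addCategory) (X Y : bcplx A) (f : bmap X Y) :
  chmap (top X) (top Y) := @ChMap A (top X) (top Y) f (bmapP f).

Definition bot_map (A : addCategory) (X Y : bcplx A) (f : bmap X Y) :
  chmap (bot X) (bot Y) := @ChMap A (bot X) (bot Y) f (bmapP' f).

Section BinaryCategory.
Variable A : addCategory.
Implicit Types X Y Z : bcplx A.

Lemma bmap_eq X Y (f g : bmap X Y) : (forall n, f n = g n) -> f = g.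
Proof.
case: f g => [f fP fP'] [g gP gP'] /= fg.
have {}fg : f = g by apply: functional_extensionality_dep.
by subst g; rewrite (Prop_irrelevance fP gP) (Prop_irrelevance fP' gP').
Qed.

Definition bmap_id X : bmap X X.
Proof. by exists (fun n => idm (X n)) => n; rewrite comp1m compm1. Defined.

Definition bmap_comp X Y Z (g : bmap Y Z) (f : bmap X Y) : bmap X Z.
Proof.
by exists (fun n => g n \oc f n) => n; rewrite -compA ?bmapP ?bmapP' !compA
  ?bmapP ?bmapP'.
Defined.

Definition Bin : category.
Proof.
by exists (bcplx A) (@bmap A) bmap_id bmap_comp => *; apply: bmap_eq => n /=;
  rewrite ?comp1m ?compm1 ?compA.
Defined.

End BinaryCategory.

Definition bdup (A : addCategory) (X : cplx A) : bcplx A :=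
  BCplx (@cdd A X) (@cdd A X) (@cbnd A X).

Definition bdup_map (A : addCategory) (X Y : cplx A) (f : chmap X Y) :
  bmap (bdup X) (bdup Y) := @BMap A (bdup X) (bdup Y) f (cmapP f) (cmapP f).

Section Concentrated.
Variable A : addCategory.

Definition conc_ob (P : A) n : A := if n is 0 then P else zob.

Lemma conc_dd (P : A) n : (0 : hom (conc_ob P n.+1) (conc_ob P n))
  \oc (0 : hom (conc_ob P n.+2) (conc_ob P n.+1)) = 0.
Proof. exact: comp0m. Qed.

Lemma conc_bnd (P : A) :
  exists b : nat, forall n, (b <= n)%N -> zero_object (conc_ob P n).
Proof. by exists 1%N => -[//|n] _; exact: zobP. Qed.

Definition conc (P : A) : cplx A := Cplx (conc_dd P) (conc_bnd P).

Definition bconc (P : A) : bcplx A :=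
  BCplx (conc_dd P) (conc_dd P) (conc_bnd P).

Definition conc_fun (P Q : A) (f : hom P Q) n : hom (conc_ob P n) (conc_ob Q n) :=
  match n return hom (conc_ob P n) (conc_ob Q n) with
  | 0 => f
  | _ => idm zob
  end.

Definition conc_map (P Q : A) (f : hom P Q) : chmap (conc P) (conc Q).
Proof. by exists (conc_fun f) => n /=; rewrite compm0 comp0m. Defined.

Definition bconc_map (P Q : A) (f : hom P Q) : bmap (bconc P) (bconc Q).
Proof. by exists (conc_fun f) => n /=; rewrite compm0 comp0m. Defined.

End Concentrated.

Section GeneratedSubgroup.
Variables (V : zmodType) (S : V -> Prop).

Inductive gen : V -> Prop :=
  | gen_in x : S x -> gen x
  | gen_0 : gen 0
  | gen_B x y : gen x -> gen y -> gen (x - y).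

Definition gen_pred : {pred V} := fun x => `[< gen x >].

Lemma gen_zmod_closed : zmod_closed gen_pred.
Proof.
split=> [|x y]; rewrite !unfold_in; first exact/asboolP/gen_0.
by move=> /asboolP gx /asboolP gy; apply/asboolP/gen_B.
Qed.

HB.instance Definition _ := GRing.isZmodClosed.Build V gen_pred gen_zmod_closed.

Definition quotg : zmodType := Quotient.quot gen_pred.

Definition qpi (x : V) : quotg := \pi_(Quotient.quot gen_pred)%qT x.

Lemma qpi_zmod_morphism : zmod_morphism qpi.
Proof. by move=> x y; rewrite /qpi !piE. Qed.

HB.instance Definition _ := GRing.isZmodMorphism.Build V quotg qpi qpi_zmod_morphism.

Lemma qpi_eq x y : qpi x = qpi y <-> gen (x - y).
Proof.
split.
  move=> /eqP; rewrite /qpi -Quotient.idealrBE => /asboolP; exact.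
by move=> g; apply/eqP; rewrite /qpi -Quotient.idealrBE; apply/asboolP.
Qed.

Section Lift.
Variables (W : zmodType) (f : {additive V -> W}).
Hypothesis fS : forall x, S x -> f x = 0.

Let lift0 (z : quotg) : W := f (repr z).

Let lift0_pi x : lift0 (qpi x) = f x.
Proof.
apply/eqP; rewrite -subr_eq0 -raddfB; apply/eqP.
have: gen (repr (qpi x) - x) by apply/qpi_eq; rewrite /qpi reprK.
elim=> [y /fS//||y z _ fy _ fz]; first exact: raddf0.
by rewrite raddfB fy fz subrr.
Qed.

Let lift0_zmod_morphism : zmod_morphism lift0.
Proof.
move=> x y; rewrite -[x]reprK -[y]reprK -!/(qpi _) -raddfB !lift0_pi.
exact: raddfB.
Qed.

HB.instance Definition _ :=
  GRing.isZmodMorphism.Build quotg W lift0 lift0_zmod_morphism.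

Definition qlift : {additive quotg -> W} := lift0.

Lemma qlift_pi x : qlift (qpi x) = f x.
Proof. exact: lift0_pi. Qed.

End Lift.
End GeneratedSubgroup.

(** [{classic T}] is [T] with the choice structure required by [freeg]. *)
Notation free_group T := {freeg {classic T} / int}.

Definition fgen (T : Type) (x : T) : free_group T := << (x : {classic T}) >>.

Definition free_lift (T : Type) (W : zmodType) (h : T -> W) :
  free_group T -> W := fglift (h : {classic T} -> zmodule W).

Lemma free_lift_zmod_morphism (T : Type) (W : zmodType) (h : T -> W) :
  zmod_morphism (free_lift h).
Proof. exact: (@lift_is_additive _ {classic T} (zmodule W) h). Qed.

HB.instance Definition _ (T : Type) (W : zmodType) (h : T -> W) :=
  GRing.isZmodMorphism.Build (free_group T) W (free_lift h)
    (free_lift_zmod_morphism h).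

Lemma free_liftE (T : Type) (W : zmodType) (h : T -> W) (x : T) :
  free_lift h (fgen x) = h x.
Proof. by rewrite /free_lift /fgen liftU scale1r. Qed.

Definition K0_rel (C : sesCategory) (z : free_group C) : Prop :=
  exists (X Y Z : C) (f : hom X Y) (g : hom Y Z),
    ses f g /\ z = fgen Y - fgen X - fgen Z.

Definition K0 (C : sesCategory) : zmodType := quotg (@K0_rel C).

Definition K0_cls (C : sesCategory) (X : C) : K0 C :=
  qpi (@K0_rel C) (fgen X).

Definition K0p_rel (C : sesCategory) (p : forall X Y : C, hom X Y -> Prop)
    (z : K0 C) : Prop :=
  exists (X X' : C) (f : hom X X'), p X X' f /\ z = K0_cls X - K0_cls X'.

Definition K0p (C : sesCategory) (p : forall X Y : C, hom X Y -> Prop) :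
  zmodType := quotg (K0p_rel p).

Definition K0p_cls (C : sesCategory) (p : forall X Y : C, hom X Y -> Prop)
  (X : C) : K0p p := qpi (K0p_rel p) (K0_cls X).

Definition preserves_ses (C D : sesCategory) (G : functor C D) : Prop :=
  forall (X Y Z : C) (f : hom X Y) (g : hom Y Z),
    ses f g -> ses (fmap G f) (fmap G g).

Definition preserves_mor (C D : category) (p : forall X Y : C, hom X Y -> Prop)
    (q : forall X Y : D, hom X Y -> Prop) (G : functor C D) : Prop :=
  forall (X Y : C) (f : hom X Y), p X Y f -> q _ _ (fmap G f).

Section K0Functoriality.
Variables (C D : sesCategory) (G : functor C D).
Variables (p : forall X Y : C, hom X Y -> Prop).
Variables (q : forall X Y : D, hom X Y -> Prop).
Arguments p {X Y}.
Arguments q {X Y}.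
Hypotheses (Gses : preserves_ses G) (Gpq : preserves_mor (@p) (@q) G).

Definition K0_pre : {additive free_group C -> K0 D} :=
  free_lift (fun X : C => K0_cls (G X)).

Lemma K0_map_rel z : K0_rel z -> K0_pre z = 0.
Proof.
move=> [X [Y [Z [f [g [fg ->]]]]]]; rewrite !raddfB /= !free_liftE.
rewrite /K0_cls -!raddfB -[RHS](raddf0 (qpi (@K0_rel D))).
apply/qpi_eq; rewrite subr0; apply: gen_in.
by exists (G X), (G Y), (G Z), (fmap G f), (fmap G g); split; first exact: Gses.
Qed.

Definition K0_map : {additive K0 C -> K0 D} := qlift K0_map_rel.

Lemma K0_mapE X : K0_map (K0_cls X) = K0_cls (G X).
Proof. by rewrite qlift_pi /= free_liftE. Qed.

Definition K0p_pre : {additive K0 C -> K0p (@q)} :=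
  qpi (K0p_rel (@q)) \o K0_map.

Lemma K0p_preE X : K0p_pre (K0_cls X) = K0p_cls (@q) (G X).
Proof. exact: (congr1 (qpi _) (K0_mapE X)). Qed.

Lemma K0p_map_rel z : K0p_rel (@p) z -> K0p_pre z = 0.
Proof.
move=> [X [X' [f [pf ->]]]]; rewrite raddfB !K0p_preE -raddfB.
rewrite -[RHS](raddf0 (qpi (K0p_rel (@q)))).
apply/qpi_eq; rewrite subr0; apply: gen_in.
by exists (G X), (G X'), (fmap G f); split; first exact: Gpq.
Qed.

Definition K0p_map : {additive K0p (@p) -> K0p (@q)} := qlift K0p_map_rel.

Lemma K0p_mapE X : K0p_map (K0p_cls (@p) X) = K0p_cls (@q) (G X).
Proof. by rewrite qlift_pi K0p_preE. Qed.

End K0Functoriality.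

Section Cokernel.
Variables (V W : zmodType) (h : {additive V -> W}).

Definition image_rel (y : W) : Prop := exists x, y = h x.

Definition coker : zmodType := quotg image_rel.

Definition coker_pi : {additive W -> coker} := qpi image_rel.

End Cokernel.

Section IsoQuasiIso.
Variable E : exactCategory.
Implicit Types A B : E.

Lemma conflation_isom A B Z (g : hom A B) :
  zero_object Z -> isom g -> conflation (0 : hom Z A) g.
Proof.
move=> Z0 ig; have [K [k kP]] := deflation1 (exactP E) B.
have [[k0 kU] _] := conf_kercok (exactP E) kP.
have K0 : zero_object K.
  rewrite comp1m in k0; apply/zero_objectP; subst k.
  have [|y [_ yU]] := kU K 0; first exact: compm0.
  by rewrite -(yU _ (comp0m _ (idm K))) -(yU _ (comp0m _ 0)).
have [h [hg gh]] := ig.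
apply: (conf_isom (exactP E) (a := 0) (b := h) (c := idm B) _ _ _ _ _ kP).
- exact: zero_object_isom.
- by exists g.
- by exists (idm B); rewrite comp1m.
- exact: zero_object_out.
- by rewrite comp1m gh.
Qed.

Lemma quasi_iso_deg0 (X Y : cplx E) (f : chmap X Y) :
  (forall n, zero_object (X n.+1)) -> (forall n, zero_object (Y n.+1)) ->
  isom (f 0) -> quasi_iso f.
Proof.
move=> X0 Y0 [g [gf fg]].
have cone0 n : zero_object (cone f n.+2) by exact: zero_object_bip.
pose Z n : E := if n is 0 then Y 0 else zob.
pose i n : hom (Z n) (cone f n) :=
  match n return hom (Z n) (cone f n) with 0 => idm (Y 0) | _ => 0 end.
pose p n : hom (cone f n.+1) (Z n) :=
  match n return hom (cone f n.+1) (Z n) with 0 => cd (cone f) 0 | _ => 0 end.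
exists Z, i, p; split.
- by case=> [|n]; [rewrite /= comp1m | exact: zero_object_out].
- by exists (idm (Y 0)); rewrite comp1m.
case=> [|n]; apply: conflation_isom; try exact: zobP.
  exists (in1 (X 0) (Y 1) \oc g); rewrite /p /= /bip_out; split.
    rewrite (zero_object_out (cd Y 0) 0 (Y0 0)) comp0m addr0.
    rewrite -compA (compA g) gf comp1m -[RHS]bipE.
    by rewrite (zero_object_out (in2 (X 0) (Y 1)) 0 (Y0 0)) comp0m addr0.
  rewrite (zero_object_out (cd Y 0) 0 (Y0 0)) comp0m addr0.
  by rewrite compA -(compA (f 0)) pr1in1 compm1.
by apply: zero_object_isom => //; exact: zobP.
Qed.

End IsoQuasiIso.

Section Relative.
Variables (M N : exactCategory) (F : exactFunctor M N).

Record co_ob := CoOb {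
  co_src : M;
  co_tgt : M;
  co_iso : hom (F co_src) (F co_tgt);
  co_isoP : isom co_iso
}.

Record co_mor (X Y : co_ob) := CoMor {
  co_mor1 : hom (co_src X) (co_src Y);
  co_mor2 : hom (co_tgt X) (co_tgt Y);
  co_morP : fmap F co_mor2 \oc co_iso X = co_iso Y \oc fmap F co_mor1
}.

Lemma co_mor_eq X Y (f g : co_mor X Y) :
  co_mor1 f = co_mor1 g -> co_mor2 f = co_mor2 g -> f = g.
Proof.
case: f g => [f1 f2 fP] [g1 g2 gP] /= e1 e2.
by subst g1 g2; rewrite (Prop_irrelevance fP gP).
Qed.

Definition co_id X : co_mor X X.
Proof.
by exists (idm _) (idm _); rewrite !fmap1 comp1m compm1.
Defined.

Definition co_comp X Y Z (g : co_mor Y Z) (f : co_mor X Y) : co_mor X Z.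
Proof.
exists (co_mor1 g \oc co_mor1 f) (co_mor2 g \oc co_mor2 f).
by rewrite !fmapM -compA co_morP !compA co_morP.
Defined.

Definition co_cat : category.
Proof.
by exists co_ob co_mor co_id co_comp => *; apply: co_mor_eq => /=;
  rewrite ?comp1m ?compm1 ?compA.
Defined.

Definition co : sesCategory :=
  @SesCategory co_cat (fun X Y Z (f : co_mor X Y) (g : co_mor Y Z) =>
    conflation (co_mor1 f) (co_mor1 g) /\ conflation (co_mor2 f) (co_mor2 g)).

Lemma isomM (C : category) (A B D : C) (b : hom B D) (a : hom A B) :
  isom a -> isom b -> isom (b \oc a).
Proof.
move=> [a' [a'a aa']] [b' [b'b bb']]; exists (a' \oc b'); split.
  by rewrite -compA (compA b') b'b comp1m.
by rewrite -compA (compA a) aa' comp1m.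
Qed.

Definition Bass_rel (z : K0 co) : Prop :=
  exists (P Q R : M) (a : hom (F P) (F Q)) (b : hom (F Q) (F R))
         (ha : isom a) (hb : isom b),
    z = K0_cls (CoOb (isomM ha hb) : co) - K0_cls (CoOb ha : co)
        - K0_cls (CoOb hb : co).

Definition K0Bass : zmodType := quotg Bass_rel.

Definition K0Bass_cls (X : co) : K0Bass := qpi Bass_rel (K0_cls X).

Record CF_ob := CFOb {
  CF_M : cplx M;
  CF_N : cplx N;
  CF_u : chmap (map_cplx F CF_M) CF_N;
  CF_uP : quasi_iso CF_u
}.

Record CF_mor (X Y : CF_ob) := CFMor {
  CF_phi : chmap (CF_M X) (CF_M Y);
  CF_psi : chmap (CF_N X) (CF_N Y);
  CF_morP : forall n, CF_psi n \oc CF_u X n = CF_u Y n \oc fmap F (CF_phi n)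
}.

Record BF_ob := BFOb {
  BF_Mtop : cplx M;
  BF_Mbot : cplx M;
  BF_N : bcplx N;
  BF_utop : chmap (map_cplx F BF_Mtop) (top BF_N);
  BF_ubot : chmap (map_cplx F BF_Mbot) (bot BF_N);
  BF_utopP : quasi_iso BF_utop;
  BF_ubotP : quasi_iso BF_ubot
}.

Record BF_mor (X Y : BF_ob) := BFMor {
  BF_phitop : chmap (BF_Mtop X) (BF_Mtop Y);
  BF_phibot : chmap (BF_Mbot X) (BF_Mbot Y);
  BF_psi : bmap (BF_N X) (BF_N Y);
  BF_mortopP : forall n,
    BF_psi n \oc BF_utop X n = BF_utop Y n \oc fmap F (BF_phitop n);
  BF_morbotP : forall n,
    BF_psi n \oc BF_ubot X n = BF_ubot Y n \oc fmap F (BF_phibot n)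
}.

Lemma CF_mor_eq X Y (f g : CF_mor X Y) :
  CF_phi f = CF_phi g -> CF_psi f = CF_psi g -> f = g.
Proof.
case: f g => [f1 f2 fP] [g1 g2 gP] /= e1 e2.
by subst g1 g2; rewrite (Prop_irrelevance fP gP).
Qed.

Definition CF_id X : CF_mor X X.
Proof.
by exists (chmap_id _) (chmap_id _) => n /=; rewrite fmap1 comp1m compm1.
Defined.

Definition CF_comp X Y Z (g : CF_mor Y Z) (f : CF_mor X Y) : CF_mor X Z.
Proof.
exists (chmap_comp (CF_phi g) (CF_phi f)) (chmap_comp (CF_psi g) (CF_psi f)).
by move=> n /=; rewrite fmapM -compA CF_morP !compA CF_morP.
Defined.

Definition CF_cat : category.
Proof.
by exists CF_ob CF_mor CF_id CF_comp => *; apply: CF_mor_eq;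
  apply: chmap_eq => n /=; rewrite ?comp1m ?compm1 ?compA.
Defined.

Lemma BF_mor_eq X Y (f g : BF_mor X Y) :
  BF_phitop f = BF_phitop g -> BF_phibot f = BF_phibot g ->
  BF_psi f = BF_psi g -> f = g.
Proof.
case: f g => [f1 f2 f3 fP fP'] [g1 g2 g3 gP gP'] /= e1 e2 e3; subst g1 g2 g3.
by rewrite (Prop_irrelevance fP gP) (Prop_irrelevance fP' gP').
Qed.

Definition BF_id X : BF_mor X X.
Proof.
by exists (chmap_id _) (chmap_id _) (bmap_id _) => n /=;
  rewrite fmap1 comp1m compm1.
Defined.

Definition BF_comp X Y Z (g : BF_mor Y Z) (f : BF_mor X Y) : BF_mor X Z.
Proof.
exists (chmap_comp (BF_phitop g) (BF_phitop f))
       (chmap_comp (BF_phibot g) (BF_phibot f))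
       (bmap_comp (BF_psi g) (BF_psi f)) => n /=; rewrite fmapM -compA.
  by rewrite BF_mortopP !compA BF_mortopP.
by rewrite BF_morbotP !compA BF_morbotP.
Defined.

Definition BF_cat : category.
Proof.
by exists BF_ob BF_mor BF_id BF_comp => *; apply: BF_mor_eq;
  (apply: chmap_eq => n || apply: bmap_eq => n) => /=;
  rewrite ?comp1m ?compm1 ?compA.
Defined.

Definition ses_deg (E : exactCategory) (X Y Z : nat -> E)
    (f : forall n, hom (X n) (Y n)) (g : forall n, hom (Y n) (Z n)) : Prop :=
  forall n, conflation (f n) (g n).

Definition CF : sesCategory :=
  @SesCategory CF_cat (fun X Y Z (f : CF_mor X Y) (g : CF_mor Y Z) =>
    ses_deg (CF_phi f) (CF_phi g) /\ ses_deg (CF_psi f) (CF_psi g)).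

Definition BF : sesCategory :=
  @SesCategory BF_cat (fun X Y Z (f : BF_mor X Y) (g : BF_mor Y Z) =>
    [/\ ses_deg (BF_phitop f) (BF_phitop g),
        ses_deg (BF_phibot f) (BF_phibot g)
      & ses_deg (BF_psi f) (BF_psi g)]).

Definition pC (X Y : CF) (f : hom X Y) : Prop :=
  quasi_iso (CF_phi f) /\ isom (CF_psi f : @hom (Ch N) _ _).

Definition pB (X Y : BF) (f : hom X Y) : Prop :=
  [/\ quasi_iso (BF_phitop f), quasi_iso (BF_phibot f)
    & isom (BF_psi f : @hom (Bin N) _ _)].

Definition Delta_ob (X : CF) : BF :=
  @BFOb (CF_M X) (CF_M X) (bdup (CF_N X))
    (@ChMap N (map_cplx F (CF_M X)) (top (bdup (CF_N X))) _ (cmapP (CF_u X)))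
    (@ChMap N (map_cplx F (CF_M X)) (bot (bdup (CF_N X))) _ (cmapP (CF_u X)))
    (CF_uP X) (CF_uP X).

Definition Delta_mor (X Y : CF) (f : hom X Y) : hom (Delta_ob X) (Delta_ob Y) :=
  @BFMor (Delta_ob X) (Delta_ob Y) (CF_phi f) (CF_phi f) (bdup_map (CF_psi f))
    (CF_morP f) (CF_morP f).

Definition Delta : functor CF BF.
Proof.
by exists Delta_ob Delta_mor => *; apply: BF_mor_eq => //; apply: bmap_eq.
Defined.

Lemma Delta_ses : preserves_ses Delta.
Proof. by move=> X Y Z f g []. Qed.

Lemma Delta_mor_p : preserves_mor pC pB Delta.
Proof.
move=> X Y f [qf [g [gf fg]]]; split=> //; exists (bdup_map g).
by split; apply: bmap_eq => n /=; [move/(congr1 (fun h => cmap h n)): gf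
  | move/(congr1 (fun h => cmap h n)): fg].
Qed.

Definition Delta_K0 : {additive K0p pC -> K0p pB} :=
  K0p_map Delta_ses Delta_mor_p.

Definition K0Grayson : zmodType := coker Delta_K0.

Definition K0Grayson_cls (X : BF) : K0Grayson :=
  coker_pi Delta_K0 (K0p_cls pB X).

(** The chain map [F P -> Q] between complexes concentrated in degree 0; note
    that [F zob] is a zero object, but need not be equal to [zob]. *)
Definition conc_u_fun (P : M) (Q : N) (a : hom (F P) Q) n :
    hom (F (conc_ob P n)) (conc_ob Q n) :=
  match n return hom (F (conc_ob P n)) (conc_ob Q n) with
  | 0 => a
  | _ => 0
  end.

Lemma conc_uP (P : M) (Q : N) (a : hom (F P) Q) n :
  conc_u_fun a n \oc cd (map_cplx F (conc P)) n
  = cd (conc Q) n \oc conc_u_fun a n.+1.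
Proof. by rewrite /= fmap0 compm0 comp0m. Qed.

Definition conc_u (P : M) (Q : N) (a : hom (F P) Q) :
    chmap (map_cplx F (conc P)) (conc Q) :=
  @ChMap N (map_cplx F (conc P)) (conc Q) (conc_u_fun a) (conc_uP a).

Lemma conc_u_quasi_iso (P : M) (Q : N) (a : hom (F P) Q) :
  isom a -> quasi_iso (conc_u a).
Proof.
move=> ia; apply: (@quasi_iso_deg0 N (map_cplx F (conc P)) (conc Q)) => // n.
  by apply: (@fmap_zero_object M N F zob); exact: zobP.
exact: zobP.
Qed.

Lemma isom1 (C : category) (A : C) : isom (idm A).
Proof. by exists (idm A); rewrite comp1m. Qed.

Definition Psi_ob (X : co) : BF :=
  @BFOb (conc (co_src X)) (conc (co_tgt X)) (bconc (F (co_tgt X)))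
    (conc_u (co_iso X)) (conc_u (idm (F (co_tgt X))))
    (conc_u_quasi_iso (co_isoP X)) (conc_u_quasi_iso (isom1 (F (co_tgt X)))).

Definition Psi_mor (X Y : co) (f : hom X Y) : hom (Psi_ob X) (Psi_ob Y).
Proof.
exists (conc_map (co_mor1 f)) (conc_map (co_mor2 f))
       (bconc_map (fmap F (co_mor2 f))) => -[|n] /=.
- exact: co_morP.
- by rewrite compm0 comp0m.
- by rewrite comp1m compm1.
- by rewrite compm0 comp0m.
Defined.

Definition Psi : functor co BF.
Proof.
exists Psi_ob Psi_mor => *; apply: BF_mor_eq;
  (apply: chmap_eq || apply: bmap_eq) => -[|n] //=;
  by rewrite ?fmap1 ?fmapM ?comp1m.
Defined.

End Relative.

(* Main.v *)
From HB Require Import structures.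
From mathcomp Require Import all_boot all_algebra.
From mathcomp Require Import boolp freeg.
Require Import Defs.
Import GRing.Theory.
Local Open Scope ring_scope.

Set Implicit Arguments.
Unset Strict Implicit.
Unset Printing Implicit Defensive.

(* Let [deg0 a b] be the object of B[F] in degree 0 given by two isomorphisms
   [a : F P -> C] and [b : F Q -> C]. Replacing [a, b] by [g a, h b] changes its
   class by that of the acyclic binary complex [C => C] with differentials
   [g, h]. Hence the relation of Bass holds in Grayson's group as soon as the
   pair [1, swap] on [F R (+) F R] has class zero, and it does since the swap
   lifts to [R (+) R].

   The inverse on classes: contract the cones of both quasi-isomorphisms of
   [(M, N, u)] by homotopies [s] of square zero. Then [d + s] is an isomorphism
   [F M_even (+) N_odd -> F M_odd (+) N_even]. After a complement of [N_odd] in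
   the image of [F] is added, the isomorphism for the bottom can be inverted and
   composed with the one for the top, which defines a class in Bass's group. A
   change of contraction amounts to automorphisms [1 + x y] with [y x = 0], which
   are commutators of elementary matrices and have class zero.

   For surjectivity, contractible complexes are added to [M] and [N] until both
   quasi-isomorphisms are isomorphisms in each degree. This needs a common
   complement for the cycles of the two cones. Such an object is an iterated
   extension of shifts of objects in degree 0, and the shift acts as [-1] on
   their classes. *)

(** * Biproducts and split conflations *)

(** The obstacle is the inverse: its value on [(M, N, u)] depends on sums, two contractions and a
    complement. The isomorphisms [d + s] of top and bottom are comparable because both differentials
    of a binary complex live on the same objects, so the two share the summands [N_odd] and
    [N_even]. In their difference [N_even] cancels by composition, and only [N_odd] has to be
    completed.

    The value is treated as a relation, and its additivity on short exact sequences is proved for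
    unrelated choices on the three terms. Independence of the choices is then the case of
    [X = X -> 0]. Invariance under [pB] is reduced to additivity as well: a morphism of [pB] is
    turned into a short exact sequence whose quotient is zero in [N] and contractible in [M]; there
    the isomorphisms [d + s] can be taken from [M], and such isomorphisms have class zero. *)

Section Biproducts.
Variable C : addCategory.
Implicit Types A B D T : C.

Lemma pr1_bip_in A B T (a : hom T A) (b : hom T B) :
  pr1 A B \oc bip_in a b = a.
Proof.
by rewrite /bip_in compmDr !compA pr1in1 pr1in2 comp1m comp0m addr0.
Qed.

Lemma pr2_bip_in A B T (a : hom T A) (b : hom T B) :
  pr2 A B \oc bip_in a b = b.
Proof.
by rewrite /bip_in compmDr !compA pr2in1 pr2in2 comp1m comp0m add0r.
Qed.

Lemma bip_in_eta A B T (f : hom T (bip A B)) :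
  bip_in (pr1 A B \oc f) (pr2 A B \oc f) = f.
Proof. by rewrite /bip_in !compA -compmDl bipE comp1m. Qed.

Lemma bip_ext A B T (f g : hom T (bip A B)) :
  pr1 A B \oc f = pr1 A B \oc g -> pr2 A B \oc f = pr2 A B \oc g -> f = g.
Proof. by move=> e1 e2; rewrite -[f]bip_in_eta -[g]bip_in_eta e1 e2. Qed.

Lemma bip_out_eta A B T (f : hom (bip A B) T) :
  bip_out (f \oc in1 A B) (f \oc in2 A B) = f.
Proof. by rewrite /bip_out -!compA -compmDr bipE compm1. Qed.

Lemma bip_ext_out A B T (f g : hom (bip A B) T) :
  f \oc in1 A B = g \oc in1 A B -> f \oc in2 A B = g \oc in2 A B -> f = g.
Proof. by move=> e1 e2; rewrite -[f]bip_out_eta -[g]bip_out_eta e1 e2. Qed.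

Lemma bip_in_pr A B : bip_in (pr1 A B) (pr2 A B) = idm (bip A B).
Proof. by rewrite -[RHS]bip_in_eta !compm1. Qed.

Lemma in1E A B : in1 A B = bip_in (idm A) 0.
Proof. by rewrite /bip_in compm1 compm0 addr0. Qed.

Lemma in2E A B : in2 A B = bip_in 0 (idm B).
Proof. by rewrite /bip_in compm1 compm0 add0r. Qed.

Lemma bip_inD A B T (a a' : hom T A) (b b' : hom T B) :
  bip_in a b + bip_in a' b' = bip_in (a + a') (b + b').
Proof. by rewrite /bip_in !compmDr addrACA. Qed.

Lemma bip_inN A B T (a : hom T A) (b : hom T B) :
  - bip_in a b = bip_in (- a) (- b).
Proof. by rewrite /bip_in !compmN opprD. Qed.

Lemma bip_out_in1 A B T (a : hom A T) (b : hom B T) : bip_out a b \oc in1 A B = a.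
Proof. by rewrite in1E bip_out_in compm1 compm0 addr0. Qed.

Lemma bip_out_in2 A B T (a : hom A T) (b : hom B T) : bip_out a b \oc in2 A B = b.
Proof. by rewrite in2E bip_out_in compm1 compm0 add0r. Qed.

Lemma compBl A B D (g g' : hom B D) (f : hom A B) :
  (g - g') \oc f = g \oc f - g' \oc f.
Proof. by rewrite compmDl compNm. Qed.

Lemma compBr A B D (g : hom B D) (f f' : hom A B) :
  g \oc (f - f') = g \oc f - g \oc f'.
Proof. by rewrite compmDr compmN. Qed.

Lemma comp_bip_out A B D T (h : hom D T) (a : hom A D) (b : hom B D) :
  h \oc bip_out a b = bip_out (h \oc a) (h \oc b).
Proof. by rewrite /bip_out compmDr !compA. Qed.

Definition bip_map A B A' B' (f : hom A A') (g : hom B B') :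
  hom (bip A B) (bip A' B') := bip_in (f \oc pr1 A B) (g \oc pr2 A B).

Lemma pr1_map A B A' B' (f : hom A A') (g : hom B B') :
  pr1 A' B' \oc bip_map f g = f \oc pr1 A B.
Proof. exact: pr1_bip_in. Qed.

Lemma pr2_map A B A' B' (f : hom A A') (g : hom B B') :
  pr2 A' B' \oc bip_map f g = g \oc pr2 A B.
Proof. exact: pr2_bip_in. Qed.

Lemma bip_map_in A B A' B' T (f : hom A A') (g : hom B B') (a : hom T A)
  (b : hom T B) : bip_map f g \oc bip_in a b = bip_in (f \oc a) (g \oc b).
Proof. by rewrite /bip_map bip_in_comp -!compA pr1_bip_in pr2_bip_in. Qed.

Lemma bip_map_in1 A B A' B' (f : hom A A') (g : hom B B') :
  bip_map f g \oc in1 A B = in1 A' B' \oc f.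
Proof. by rewrite !in1E bip_map_in bip_in_comp compm0 compm1 comp0m comp1m. Qed.

Lemma bip_map_in2 A B A' B' (f : hom A A') (g : hom B B') :
  bip_map f g \oc in2 A B = in2 A' B' \oc g.
Proof. by rewrite !in2E bip_map_in bip_in_comp compm0 compm1 comp0m comp1m. Qed.

Lemma bip_map_comp A B A' B' A2 B2 (f : hom A A') (g : hom B B')
    (f' : hom A' A2) (g' : hom B' B2) :
  bip_map f' g' \oc bip_map f g = bip_map (f' \oc f) (g' \oc g).
Proof. by rewrite {2}/bip_map bip_map_in !compA. Qed.

Lemma bip_map1 A B : bip_map (idm A) (idm B) = idm (bip A B).
Proof. by rewrite /bip_map !comp1m bip_in_pr. Qed.

Lemma bip_mapD A B A' B' (f f' : hom A A') (g g' : hom B B') :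
  bip_map f g + bip_map f' g' = bip_map (f + f') (g + g').
Proof. by rewrite /bip_map bip_inD -!compmDl. Qed.

Lemma bip_map_isom A B A' B' (f : hom A A') (g : hom B B') :
  isom f -> isom g -> isom (bip_map f g).
Proof.
move=> [f' [ff' f'f]] [g' [gg' g'g]]; exists (bip_map f' g').
by rewrite !bip_map_comp ff' f'f gg' g'g !bip_map1.
Qed.

End Biproducts.

Section FunctorBiproducts.
Variables (C D : addCategory) (F : addFunctor C D).
Implicit Types A B : C.
Implicit Types T : D.

Lemma fmapN A B (f : hom A B) : fmap F (- f) = - fmap F f.
Proof. by apply: (addrI (fmap F f)); rewrite -fmapD !subrr fmap0. Qed.

(** [F (bip A B)] is isomorphic to [bip (F A) (F B)] but need not be equal to it, so maps into it
    get their own pairing. *)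
Definition fbip_in A B T (a : hom T (F A)) (b : hom T (F B)) :
  hom T (F (bip A B)) := fmap F (in1 A B) \oc a + fmap F (in2 A B) \oc b.

Lemma fpr1_in A B T (a : hom T (F A)) (b : hom T (F B)) :
  fmap F (pr1 A B) \oc fbip_in a b = a.
Proof.
rewrite /fbip_in compmDr !compA -!fmapM pr1in1 pr1in2 fmap1 fmap0.
by rewrite comp1m comp0m addr0.
Qed.

Lemma fpr2_in A B T (a : hom T (F A)) (b : hom T (F B)) :
  fmap F (pr2 A B) \oc fbip_in a b = b.
Proof.
rewrite /fbip_in compmDr !compA -!fmapM pr2in1 pr2in2 fmap1 fmap0.
by rewrite comp1m comp0m add0r.
Qed.

Lemma fbip_in_eta A B T (f : hom T (F (bip A B))) :
  fbip_in (fmap F (pr1 A B) \oc f) (fmap F (pr2 A B) \oc f) = f.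
Proof. by rewrite /fbip_in !compA -compmDl -!fmapM -fmapD bipE fmap1 comp1m. Qed.

Lemma fbip_ext A B T (f g : hom T (F (bip A B))) :
  fmap F (pr1 A B) \oc f = fmap F (pr1 A B) \oc g ->
  fmap F (pr2 A B) \oc f = fmap F (pr2 A B) \oc g -> f = g.
Proof. by move=> e1 e2; rewrite -[f]fbip_in_eta -[g]fbip_in_eta e1 e2. Qed.

Lemma fbip_in_comp A B T T' (a : hom T (F A)) (b : hom T (F B)) (h : hom T' T) :
  fbip_in a b \oc h = fbip_in (a \oc h) (b \oc h).
Proof. by rewrite /fbip_in compmDl !compA. Qed.

Lemma fmap_bip_in A B (Q : C) (a : hom Q A) (b : hom Q B) :
  fmap F (bip_in a b) = fbip_in (fmap F a) (fmap F b).
Proof. by rewrite /bip_in fmapD !fmapM. Qed.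

Definition fbip_iso A B : hom (F (bip A B)) (bip (F A) (F B)) :=
  bip_in (fmap F (pr1 A B)) (fmap F (pr2 A B)).

Lemma fbip_iso_isom A B : isom (fbip_iso A B).
Proof.
exists (fbip_in (pr1 _ _) (pr2 _ _)); split.
  by rewrite fbip_in_comp pr1_bip_in pr2_bip_in -[RHS]fbip_in_eta !compm1.
by rewrite /fbip_iso bip_in_comp fpr1_in fpr2_in bip_in_pr.
Qed.

End FunctorBiproducts.

(** Inserting [i r + s p = 1] between [r] and [s] gives [r s = r s + r s], and similarly for
    [p i]. *)
Lemma splitting_orthogonal (C : addCategory) (A B D : C) (i : hom A B) (p : hom B D)
    (r : hom B A) (s : hom D B) :
  r \oc i = idm A -> p \oc s = idm D -> i \oc r + s \oc p = idm B ->
  r \oc s = 0 /\ p \oc i = 0.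
Proof.
move=> ri ps irsp; split.
  apply: (addrI (r \oc s)); rewrite addr0 -[in RHS](comp1m s) -irsp compmDl compmDr.
  by rewrite -!compA ps compm1 (compA r i) ri comp1m.
apply: (addrI (p \oc i)); rewrite addr0 -[in RHS](comp1m i) -irsp compmDl compmDr.
by rewrite -!compA ri compm1 (compA p s) ps comp1m.
Qed.

Section Conflations.
Variable E : exactCategory.
Implicit Types A B D : E.

(** The axioms do not list split sequences among the conflations. The map [0 -> B] is an inflation
    because it is paired with [1_B], and [in1] is its pushout along [0 -> A]. *)
Lemma conflation_in1_pr2 A B : conflation (in1 A B) (pr2 A B).
Proof.
have zB : inflation (@conflation E) (0 : hom zob B).
  exists B, (idm B); apply: conflation_isom; first exact: zobP.
  by exists (idm B); rewrite comp1m.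
have [B' [i' [f' [[_ poU] [D [p ip]]]]]] :=
  inflation_pushout (exactP E) (0 : hom zob A) zB.
have [|h [[hf hi] _]] := poU _ (in2 A B) (in1 A B); first by rewrite !compm0.
have [|r [[rf ri] _]] := poU _ (0 : hom B A) (idm A); first by rewrite !compm0.
have [|q [[qf qi] _]] := poU _ (idm B) (0 : hom A B); first by rewrite !compm0.
pose k := bip_out i' f'.
have kh : k \oc h = idm B'.
  have [|z [_ zU]] := poU _ f' i'; first by rewrite !compm0.
  rewrite -(zU (k \oc h)); first by apply/zU; rewrite !comp1m.
  by rewrite -!compA hf hi bip_out_in1 bip_out_in2.
have hk : h \oc k = idm (bip A B).
  apply: bip_ext_out; rewrite -compA comp1m.
    by rewrite bip_out_in1 hi.
  by rewrite bip_out_in2 hf.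
have [[pi0 _] [_ cokU]] := conf_kercok (exactP E) ip.
have p2h : pr2 A B \oc h = q.
  have [|z [_ zU]] := poU _ (idm B) (0 : hom A B); first by rewrite !compm0.
  rewrite -(zU (pr2 A B \oc h)); last by rewrite -!compA hf hi pr2in2 pr2in1.
  exact: zU.
(* [c] compares the cokernel [p] supplied by the pushout axiom with the projection to [B]; the
   inclusion [f'] of [B] followed by [p] is its inverse. *)
have [c [cp _]] := cokU _ q qi.
pose c' := p \oc f'.
have icc : isom c.
  exists c'; split; last by rewrite /c' compA cp qf.
  have [z [_ zU]] := cokU _ p pi0.
  rewrite -(zU (c' \oc c)); first by apply/zU; rewrite comp1m.
  rewrite -compA cp -[p in RHS]compm1 -kh -[q]compm1 -kh !compA.
  congr (_ \oc h); apply: bip_ext_out; rewrite -!compA /k ?bip_out_in1 ?bip_out_in2.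
    by rewrite qi !compm0 pi0.
  by rewrite qf compm1.
apply: (conf_isom (exactP E) (a := idm A) (b := h) (c := c) _ _ _ _ _ ip) => //.
- by exists (idm A); rewrite comp1m.
- by exists k.
- by rewrite hi compm1.
- by rewrite cp p2h.
Qed.

Lemma split_conflation A B D (i : hom A B) (p : hom B D) (r : hom B A)
    (s : hom D B) : r \oc i = idm A -> p \oc s = idm D ->
  i \oc r + s \oc p = idm B -> conflation i p.
Proof.
move=> ri ps irsp; have [rs pi0] := splitting_orthogonal ri ps irsp.
apply: (conf_isom (exactP E) (a := idm A) (b := bip_out i s) (c := idm D) _ _ _
   _ _ (conflation_in1_pr2 A D)).
- by exists (idm A); rewrite comp1m.
- exists (bip_in r p); split; last by rewrite bip_out_in.
  rewrite bip_in_comp -[RHS]bip_in_pr; congr bip_in; apply: bip_ext_out;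
    rewrite -!compA ?bip_out_in1 ?bip_out_in2 ?pr1in1 ?pr2in2 ?pr1in2 ?pr2in1 //.
- by exists (idm D); rewrite comp1m.
- by rewrite bip_out_in1 compm1.
- by rewrite comp1m comp_bip_out pi0 ps /bip_out comp0m add0r comp1m.
Qed.

End Conflations.

(** * Complexes, contractions and quasi-isomorphisms *)

Lemma dep_choice (I : Type) (T : I -> Type) (P : forall i, T i -> Prop) :
  (forall i, exists y, P i y) -> exists f : forall i, T i, forall i, P i (f i).
Proof.
by move=> h; exists (fun i => projT1 (cid (h i))) => i; case: (cid (h i)).
Qed.

Section Contractions.
Variable A : addCategory.
Implicit Types X Y : cplx A.

Record contraction X (s : forall n, hom (X n) (X n.+1)) : Prop := Contraction {
  contr0 : cd X 0 \oc s 0 = idm (X 0);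
  contrS : forall n, cd X n.+1 \oc s n.+1 + s n \oc cd X n = idm (X n.+1);
  contr_sq : forall n, s n.+1 \oc s n = 0
}.

(* The complexes that split into the isomorphisms [q n : Z n -> X n.+1]; [Z n]
   is the object of [n]-cycles. *)
Definition elementary X (Z : nat -> A) : Prop :=
  exists (i : forall n, hom (Z n) (X n)) (p : forall n, hom (X n.+1) (Z n))
    (r : forall n, hom (X n) (Z n)) (q : forall n, hom (Z n) (X n.+1)),
  [/\ forall n, cd X n = i n \oc p n,
      forall n, r n \oc i n = idm (Z n) /\ p n \oc q n = idm (Z n),
      i 0 \oc r 0 = idm (X 0),
      forall n, i n.+1 \oc r n.+1 + q n \oc p n = idm (X n.+1)
    & forall n, r n.+1 \oc q n = 0 /\ p n \oc i n.+1 = 0].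

Lemma elementary_contraction X Z : elementary X Z ->
  exists s : forall n, hom (X n) (X n.+1), contraction s.
Proof.
move=> [i [p [r [q [di ripq ir0 irqp rq0]]]]].
exists (fun n => q n \oc r n); split.
- by rewrite di -compA (compA (p 0)) (proj2 (ripq 0)) comp1m.
- move=> n; rewrite !di -!compA (compA (p n.+1)) (proj2 (ripq n.+1)) comp1m.
  by rewrite (compA (r n)) (proj1 (ripq n)) comp1m.
- by move=> n; rewrite -compA (compA (r n.+1)) (proj1 (rq0 n)) comp0m compm0.
Qed.

Lemma chmap_inv X Y (f : chmap X Y) : (forall n, isom (f n)) ->
  exists g : chmap Y X, forall n, g n \oc f n = idm (X n) /\ f n \oc g n = idm (Y n).
Proof.
move=> /dep_choice[g gP].
have cg n : g n \oc cd Y n = cd X n \oc g n.+1.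
  rewrite -[LHS]compm1 -(proj2 (gP n.+1)) -compA (compA (cd Y n)) -cmapP.
  by rewrite -compA (compA (g n)) (proj1 (gP n)) comp1m.
by exists (ChMap cg).
Qed.

(** A strong deformation retraction of [Y] onto [X]. The side condition [sdr_ku] kills the cross
    term in the contraction of the cone of [u]. *)
Record sdr X Y (u : chmap X Y) (v : chmap Y X)
    (k : forall n, hom (Y n) (Y n.+1)) : Prop := Sdr {
  sdr_vu : forall n, v n \oc u n = idm (X n);
  sdr_ku : forall n, k n \oc u n = 0;
  sdr_0 : cd Y 0 \oc k 0 + u 0 \oc v 0 = idm (Y 0);
  sdr_S : forall n, cd Y n.+1 \oc k n.+1 + k n \oc cd Y n + u n.+1 \oc v n.+1
    = idm (Y n.+1)
}.

(** The kernel [k] of [g] serves as the image of [f]. Writing [f = k e], the homotopy identity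
    restricted to the kernel gives [e s k = 1], so [e] is a split epimorphism. *)
Lemma exact_at_contractible (abA : abelian A) (P Q R : A) (f : hom P Q)
    (g : hom Q R) (s : hom Q P) (t : hom R Q) :
  g \oc f = 0 -> f \oc s + t \oc g = idm Q -> exact_at f g.
Proof.
move=> gf st; have [kerA _ _ _] := abA; have [K [k [gk kU]]] := kerA _ _ g.
have [e [ke _]] := kU _ f gf.
have kmono : monic k.
  move=> T x y kxy; have [|z [_ zU]] := kU T (k \oc x).
    by rewrite compA gk comp0m.
  by rewrite -(zU x erefl) -(zU y (esym kxy)).
have esk : e \oc (s \oc k) = idm K.
  apply: kmono; rewrite compA ke compm1 -[RHS](comp1m k) -st compmDl -!compA.
  by rewrite gk compm0 addr0.
exists K, e, k; split=> // T x y xy.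
by rewrite -[x]compm1 -[y]compm1 -esk !compA xy.
Qed.

End Contractions.

Section Acyclicity.
Variable E : exactCategory.
Implicit Types X Y : cplx E.

(* This is the only use of the embedding into an abelian category: in
   particular it provides the kernels of split epimorphisms in [E]. *)
Lemma contractible_acyclic (hE : supports_long_exact_sequences E) X
    (s : forall n, hom (X n) (X n.+1)) :
  cd X 0 \oc s 0 = idm (X 0) ->
  (forall n, cd X n.+1 \oc s n.+1 + s n \oc cd X n = idm (X n.+1)) ->
  acyclic X.
Proof.
move=> s0 sS; have [B [I [abB _ _ _ acycE]]] := hE; apply/acycE; split.
  apply: (exact_at_contractible abB (s := fmap I (s 0)) (t := 0)) => //.
    exact: comp0m.
  by rewrite comp0m addr0 -fmapM s0 fmap1.
move=> n; apply: (exact_at_contractible abB (s := fmap I (s n.+1)) (t := fmap I (s n))) => //.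
  exact: map_cdd.
by rewrite -!fmapM -fmapD sS fmap1.
Qed.

Lemma acyclic_splitting (spl : split_exact E) X : acyclic X ->
  exists Z, elementary X Z.
Proof.
move=> [Z [i [p [di [r0 [r0i ir0]] cip]]]].
have /dep_choice[rq rqP] n : exists rq : hom (X n.+1) (Z n.+1) * hom (Z n) (X n.+1),
    [/\ rq.1 \oc i n.+1 = idm _, p n \oc rq.2 = idm _
      & i n.+1 \oc rq.1 + rq.2 \oc p n = idm _].
  by have [r [s rsP]] := spl _ _ _ _ _ (cip n); exists (r, s).
pose r n : hom (X n) (Z n) :=
  match n return hom (X n) (Z n) with 0 => r0 | m.+1 => (rq m).1 end.
exists Z, i, p, r, (fun n => (rq n).2); split=> //.
- case=> [|n] /=; first by have [_ ? _] := rqP 0; split.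
  by have [? _ _] := rqP n; have [_ ? _] := rqP n.+1; split.
- by move=> n; have [] := rqP n.
by move=> n; have [ri ps rs1] := rqP n; exact: splitting_orthogonal.
Qed.

Lemma acyclic_contraction (spl : split_exact E) X : acyclic X ->
  exists s : forall n, hom (X n) (X n.+1), contraction s.
Proof. by move=> /(acyclic_splitting spl)[Z]; exact: elementary_contraction. Qed.

(* A strong deformation retraction [v] with homotopy [k] gives the contraction
   [(x, y) |-> (v y, k y)] of the mapping cone. *)
Lemma sdr_quasi_iso (hE : supports_long_exact_sequences E) X Y
    (u : chmap X Y) (v : chmap Y X) (k : forall n, hom (Y n) (Y n.+1)) :
  sdr u v k -> quasi_iso u.
Proof.
move=> [vu ku k0 kS].
pose s n : hom (cone u n) (cone u n.+1) :=
  match n return hom (cone u n) (cone u n.+1) with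
  | 0 => bip_in (v 0) (k 0)
  | m.+1 => bip_in (v m.+1) (k m.+1) \oc pr2 _ _
  end.
apply: (contractible_acyclic hE (s := s)) => [|n].
  by rewrite /= bip_out_in addrC.
have -> : s n \oc cd (cone u) n = bip_in (v n) (k n) \oc bip_out (u n) (cd Y n).
  by case: n => [//|n]; rewrite /= -compA pr2_bip_in.
rewrite /= (compA _ (bip_in _ _)) bip_in_comp !bip_out_in comp0m addr0.
rewrite comp_bip_out; apply: (@bip_ext_out _ (X n) (Y n.+1)).
  rewrite compmDl -compA pr2in1 compm0 add0r bip_out_in1 bip_in_comp vu ku.
  by rewrite comp1m in1E.
rewrite compmDl -compA pr2in2 compm1 bip_out_in2 bip_in_comp comp1m in2E.
rewrite bip_inD compNm cmapP addNr; congr bip_in.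
by rewrite -addrA addrC kS.
Qed.

Definition chmap0 X Y : chmap X Y.
Proof. by exists (fun _ => 0) => n; rewrite compm0 comp0m. Defined.

Lemma iso_quasi_iso (hE : supports_long_exact_sequences E) X Y (u : chmap X Y) :
  (forall n, isom (u n)) -> quasi_iso u.
Proof.
move=> /chmap_inv[v vP].
apply: (sdr_quasi_iso hE (v := v) (k := fun _ => 0)); split=> [n|n||n].
- exact: (proj1 (vP n)).
- exact: comp0m.
- by rewrite compm0 add0r; exact: (proj2 (vP 0)).
- by rewrite compm0 comp0m !add0r; exact: (proj2 (vP n.+1)).
Qed.

Lemma zero_quasi_iso (hE : supports_long_exact_sequences E) X Y (u : chmap X Y)
    (s : forall n, hom (Y n) (Y n.+1)) :
  (forall n, zero_object (X n)) -> contraction s -> quasi_iso u.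
Proof.
move=> X0 [s0 sS _].
apply: (sdr_quasi_iso hE (v := chmap0 Y X) (k := s)); split=> [n|n||n].
- exact: zero_object_in.
- exact: zero_object_out.
- by rewrite compm0 addr0.
- by rewrite compm0 addr0.
Qed.

End Acyclicity.

(** * The Grothendieck groups *)

Section Generation.

Lemma free_group_ind (T : Type) (P : free_group T -> Prop) :
  P 0 -> (forall x, P (fgen x)) -> (forall y z, P y -> P z -> P (y - z)) ->
  forall z, P z.
Proof.
move=> P0 Pg PB.
have PN y : P y -> P (- y) by rewrite -sub0r; exact: PB.
have PD y z : P y -> P z -> P (y + z).
  by move=> Py /PN Pz; rewrite -[z]opprK; exact: PB.
have PMn y n : P y -> P (y *+ n).
  by move=> Py; elim: n => [|n IH]; rewrite ?mulr0n // mulrS; exact: PD.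
apply: freeg_ind_dom0 => // k x D _ _; apply: PD.
have -> : << k *g x >> = fgen (x : T) *~ k.
  by rewrite /fgen freegU_mulz intz.
by case: k => n; rewrite ?NegzE ?mulrNz -pmulrn; [|apply: PN]; exact: PMn.
Qed.

Lemma quotg_ind (V : zmodType) (S : V -> Prop) (P : quotg S -> Prop) :
  (forall x, P (qpi S x)) -> forall z, P z.
Proof. by move=> Pq z; rewrite -[z]reprK; exact: Pq. Qed.

Lemma qpi_rel (V : zmodType) (S : V -> Prop) (x : V) : S x -> qpi S x = 0.
Proof.
move=> Sx; rewrite -[RHS](raddf0 (qpi S)); apply/qpi_eq; rewrite subr0.
exact: gen_in.
Qed.

Lemma qpi_relB (V : zmodType) (S : V -> Prop) (x y : V) :
  S (x - y) -> qpi S x = qpi S y.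
Proof. by move=> Sxy; apply/qpi_eq; exact: gen_in. Qed.

Lemma qpi_relD (V : zmodType) (S : V -> Prop) (x y z : V) :
  S (x - y - z) -> qpi S x = qpi S y + qpi S z.
Proof. by rewrite -raddfD -addrA -opprD => /qpi_relB. Qed.

Lemma K0_ind (C : sesCategory) (P : K0 C -> Prop) :
  P 0 -> (forall X, P (K0_cls X)) -> (forall y z, P y -> P z -> P (y - z)) ->
  forall z, P z.
Proof.
move=> P0 Pc PB; apply: quotg_ind; apply: free_group_ind => //.
  by rewrite raddf0.
by move=> y z Py Pz; rewrite raddfB; exact: PB.
Qed.

Lemma K0_ses (C : sesCategory) (X Y Z : C) (f : hom X Y) (g : hom Y Z) :
  ses f g -> K0_cls Y = K0_cls X + K0_cls Z.
Proof.
by move=> fg; apply: qpi_relD; exists X, Y, Z, f, g.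
Qed.

Lemma K0_lift (C : sesCategory) (W : zmodType) (h : C -> W) :
  (forall (X Y Z : C) (f : hom X Y) (g : hom Y Z), ses f g -> h Y = h X + h Z) ->
  exists H : {additive K0 C -> W}, forall X, H (K0_cls X) = h X.
Proof.
move=> hses; have hrel z : K0_rel z -> free_lift h z = 0.
  move=> [X [Y [Z [f [g [fg ->]]]]]].
  by rewrite !raddfB /= !free_liftE (hses _ _ _ _ _ fg) addrAC addrK subrr.
exists (qlift (f := free_lift h) hrel) => X.
by rewrite qlift_pi /= free_liftE.
Qed.

End Generation.

Section RelativeGroups.
Variables (M N : exactCategory) (F : exactFunctor M N).

Lemma K0Bass_ind (P : K0Bass F -> Prop) :
  P 0 -> (forall X, P (K0Bass_cls X)) -> (forall y z, P y -> P z -> P (y - z)) ->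
  forall z, P z.
Proof.
move=> P0 Pc PB; apply: quotg_ind; apply: K0_ind => //.
  by rewrite raddf0.
by move=> y z Py Pz; rewrite raddfB; exact: PB.
Qed.

Lemma K0Grayson_ind (P : K0Grayson F -> Prop) :
  P 0 -> (forall X, P (K0Grayson_cls X)) ->
  (forall y z, P y -> P z -> P (y - z)) -> forall z, P z.
Proof.
move=> P0 Pc PB; apply: quotg_ind; apply: quotg_ind; apply: K0_ind => //.
  by rewrite !raddf0.
by move=> y z Py Pz; rewrite !raddfB; exact: PB.
Qed.

Lemma K0Bass_ses (X Y Z : co F) (f : hom X Y) (g : hom Y Z) :
  ses f g -> K0Bass_cls Y = K0Bass_cls X + K0Bass_cls Z.
Proof. by move=> fg; rewrite /K0Bass_cls (K0_ses fg) raddfD. Qed.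

Lemma K0Bass_comp (P Q R : M) (a : hom (F P) (F Q)) (b : hom (F Q) (F R))
    (ha : isom a) (hb : isom b) :
  K0Bass_cls (CoOb (isomM ha hb)) = K0Bass_cls (CoOb ha) + K0Bass_cls (CoOb hb).
Proof.
by apply: qpi_relD; exists P, Q, R, a, b, ha, hb.
Qed.

Lemma K0Bass_lift (W : zmodType) (h : co F -> W) :
  (forall (X Y Z : co F) (f : hom X Y) (g : hom Y Z),
    ses f g -> h Y = h X + h Z) ->
  (forall (P Q R : M) (a : hom (F P) (F Q)) (b : hom (F Q) (F R))
      (ha : isom a) (hb : isom b),
    h (CoOb (isomM ha hb)) = h (CoOb ha) + h (CoOb hb)) ->
  exists H : {additive K0Bass F -> W}, forall X, H (K0Bass_cls X) = h X.
Proof.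
move=> /(@K0_lift (co F))[H HE] hcomp.
have Hrel z : Bass_rel z -> H z = 0.
  move=> [P [Q [R [a [b [ha [hb ->]]]]]]].
  by rewrite !raddfB !HE hcomp addrAC addrK subrr.
by exists (qlift Hrel) => X; rewrite qlift_pi.
Qed.

Lemma K0Grayson_ses (X Y Z : BF F) (f : hom X Y) (g : hom Y Z) :
  ses f g -> K0Grayson_cls Y = K0Grayson_cls X + K0Grayson_cls Z.
Proof. by move=> fg; rewrite /K0Grayson_cls /K0p_cls (K0_ses fg) !raddfD. Qed.

Lemma K0Grayson_p (X Y : BF F) (f : hom X Y) :
  pB f -> K0Grayson_cls X = K0Grayson_cls Y.
Proof.
by move=> pf; congr (coker_pi _ _); apply: qpi_relB; exists X, Y, f.
Qed.

Lemma K0Grayson_Delta (X : CF F) : K0Grayson_cls (Delta_ob X) = 0.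
Proof.
apply: qpi_rel; exists (K0p_cls (@pC _ _ F) X).
by rewrite K0p_mapE.
Qed.

Lemma K0Grayson_lift (W : zmodType) (h : BF F -> W) :
  (forall (X Y Z : BF F) (f : hom X Y) (g : hom Y Z),
    ses f g -> h Y = h X + h Z) ->
  (forall (X Y : BF F) (f : hom X Y), pB f -> h X = h Y) ->
  (forall X : CF F, h (Delta_ob X) = 0) ->
  exists H : {additive K0Grayson F -> W}, forall X, H (K0Grayson_cls X) = h X.
Proof.
move=> /(@K0_lift (BF F))[H HE] hp hD.
have Hrel z : K0p_rel (@pB _ _ F) z -> H z = 0.
  by move=> [X [Y [f [pf ->]]]]; rewrite raddfB !HE (hp _ _ _ pf) subrr.
have H'rel w : image_rel (Delta_K0 F) w -> qlift Hrel w = 0.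
  move=> [x ->]; move: x; apply: quotg_ind; apply: K0_ind.
  - by rewrite !raddf0.
  - by move=> X; rewrite (K0p_mapE _ _ X) qlift_pi HE hD.
  - by move=> y z Py Pz; rewrite !raddfB Py Pz subrr.
by exists (qlift H'rel) => X; rewrite !qlift_pi HE.
Qed.

End RelativeGroups.

(** * Shifts and two-term complexes *)

Section TrivialConflations.
Variable E : exactCategory.
Implicit Types A B Z : E.

Lemma conflation_isom_l A B Z (f : hom A B) (g : hom B Z) :
  isom f -> zero_object Z -> conflation f g.
Proof.
move=> [f' [f'f ff']] Z0; apply: (split_conflation (r := f') (s := 0)) => //.
  exact: zero_object_in.
by rewrite comp0m addr0.
Qed.

Lemma conflation_isom_r A B Z (f : hom Z A) (g : hom A B) :
  isom g -> zero_object Z -> conflation f g.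
Proof.
move=> [g' [g'g gg']] Z0; apply: (split_conflation (r := 0) (s := g')) => //.
  exact: zero_object_in.
by rewrite compm0 add0r.
Qed.

Lemma conflation_zero A B Z (f : hom A B) (g : hom B Z) :
  zero_object A -> zero_object B -> zero_object Z -> conflation f g.
Proof. by move=> A0 B0 Z0; apply: conflation_isom_l => //; exact: zero_object_isom. Qed.

End TrivialConflations.

Section Shift.
Variable A : addCategory.

Definition sh_ob (X : nat -> A) n : A := if n is m.+1 then X m else zob.

(** The differential keeps its sign, so that the cone of a shifted map is the shifted cone up to
    zero summands. *)
Definition sh_d (X : nat -> A) (d : forall n, hom (X n.+1) (X n)) n :
    hom (sh_ob X n.+1) (sh_ob X n) :=
  match n return hom (sh_ob X n.+1) (sh_ob X n) with 0 => 0 | m.+1 => d m end.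

Lemma sh_dd (X : nat -> A) (d : forall n, hom (X n.+1) (X n)) :
  (forall n, d n \oc d n.+1 = 0) -> forall n, sh_d d n \oc sh_d d n.+1 = 0.
Proof. by move=> dd [|n] /=; [exact: comp0m | exact: dd]. Qed.

Lemma sh_bnd (X : nat -> A) :
  (exists b : nat, forall n, (b <= n)%N -> zero_object (X n)) ->
  exists b : nat, forall n, (b <= n)%N -> zero_object (sh_ob X n).
Proof. by move=> [b bX]; exists b.+1 => -[//|n]; exact: bX. Qed.

Definition sh_cplx (X : cplx A) : cplx A :=
  Cplx (sh_dd (@cdd A X)) (sh_bnd (@cbnd A X)).

Definition sh_bcplx (X : bcplx A) : bcplx A :=
  BCplx (sh_dd (@bdd A X)) (sh_dd (@bdd' A X)) (sh_bnd (@bbnd A X)).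

Definition sh_fun (X Y : nat -> A) (f : forall n, hom (X n) (Y n)) n :
    hom (sh_ob X n) (sh_ob Y n) :=
  match n return hom (sh_ob X n) (sh_ob Y n) with
  | 0 => idm zob | m.+1 => f m end.

Lemma sh_funP (X Y : nat -> A) (dX : forall n, hom (X n.+1) (X n))
    (dY : forall n, hom (Y n.+1) (Y n)) (f : forall n, hom (X n) (Y n)) :
  (forall n, f n \oc dX n = dY n \oc f n.+1) ->
  forall n, sh_fun f n \oc sh_d dX n = sh_d dY n \oc sh_fun f n.+1.
Proof. by move=> fP [|n] /=; [rewrite compm0 comp0m | exact: fP]. Qed.

Definition sh_chmap (X Y : cplx A) (f : chmap X Y) :
    chmap (sh_cplx X) (sh_cplx Y) :=
  @ChMap _ (sh_cplx X) (sh_cplx Y) (sh_fun f) (sh_funP (cmapP f)).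

Definition sh_bmap (X Y : bcplx A) (f : bmap X Y) :
    bmap (sh_bcplx X) (sh_bcplx Y) :=
  @BMap _ (sh_bcplx X) (sh_bcplx Y) (sh_fun f)
    (sh_funP (bmapP f)) (sh_funP (bmapP' f)).

Definition two_ob (P Q : A) n : A :=
  match n with 0 => Q | 1 => P | _ => zob end.

Definition two_d (P Q : A) (f : hom P Q) n : hom (two_ob P Q n.+1) (two_ob P Q n) :=
  match n return hom (two_ob P Q n.+1) (two_ob P Q n) with 0 => f | _ => 0 end.

Lemma two_dd (P Q : A) (f : hom P Q) n : two_d f n \oc two_d f n.+1 = 0.
Proof. exact: compm0. Qed.

Lemma two_bnd (P Q : A) :
  exists b : nat, forall n, (b <= n)%N -> zero_object (two_ob P Q n).
Proof. by exists 2 => -[|[|n]] // _; exact: zobP. Qed.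

Definition two (P Q : A) (f : hom P Q) : cplx A := Cplx (two_dd f) (two_bnd P Q).

Definition btwo (P Q : A) (f g : hom P Q) : bcplx A :=
  BCplx (two_dd f) (two_dd g) (two_bnd P Q).

Lemma two_contraction (P Q : A) (f : hom P Q) : isom f ->
  exists s : forall n, hom (two f n) (two f n.+1), contraction s.
Proof.
move=> [g [gf fg]].
exists (fun n => match n return hom (two f n) (two f n.+1) with 0 => g | _ => 0 end).
split=> [//|[|n]|n]; rewrite /= ?comp0m ?compm0 ?add0r //.
by apply: zero_object_in; exact: zobP.
Qed.

(* The extension of a complex in degree 0 by one in degree 1 that gives a
   two-term complex. *)
Definition two_in (P Q : A) n : hom (conc_ob Q n) (two_ob P Q n) :=
  match n return hom (conc_ob Q n) (two_ob P Q n) with 0 => idm Q | _ => 0 end.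

Definition two_out (P Q : A) n : hom (two_ob P Q n) (sh_ob (conc_ob P) n) :=
  match n return hom (two_ob P Q n) (sh_ob (conc_ob P) n) with
  | 0 => 0 | 1 => idm P | m.+2 => 0 end.

Lemma two_inP (P Q : A) (f : hom P Q) n :
  two_in P Q n \oc 0 = two_d f n \oc two_in P Q n.+1.
Proof. by rewrite !compm0. Qed.

Lemma two_outP (P Q : A) (f : hom P Q) n :
  two_out P Q n \oc two_d f n
  = sh_d (fun n => 0 : hom (conc_ob P n.+1) (conc_ob P n)) n \oc two_out P Q n.+1.
Proof. by case: n => [|[|n]] /=; rewrite ?compm0 ?comp0m. Qed.

End Shift.

Lemma two_conflation (E : exactCategory) (P Q : E) n :
  conflation (two_in P Q n) (two_out P Q n).
Proof.
case: n => [|[|n]] /=.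
- by apply: conflation_isom_l; [exact: isom1 | exact: zobP].
- by apply: conflation_isom_r; [exact: isom1 | exact: zobP].
- by apply: conflation_zero; exact: zobP.
Qed.

(** The cone of a shifted map is only isomorphic to the shift of the cone. The cycles are therefore
    reused as they stand and only their maps are transported along [e]. *)
Lemma acyclic_shift (E : exactCategory) (X Y : cplx E)
    (e : forall n, hom (X n) (Y n.+1)) :
  zero_object (Y 0) -> (forall n, isom (e n)) ->
  (forall n, cd Y n.+1 \oc e n.+1 = e n \oc cd X n) -> acyclic X -> acyclic Y.
Proof.
move=> Y0 /dep_choice[e' eP] eX [Z [i [p [di i0 cip]]]].
pose i' n : hom (sh_ob Z n) (Y n) :=
  match n return hom (sh_ob Z n) (Y n) with 0 => 0 | m.+1 => e m \oc i m end.
pose p' n : hom (Y n.+1) (sh_ob Z n) :=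
  match n return hom (Y n.+1) (sh_ob Z n) with
  | 0 => 0 | m.+1 => p m \oc e' m.+1 end.
have ie n : isom (e n) by exists (e' n).
exists (sh_ob Z), i', p'; split.
- case=> [|n] /=; first exact: zero_object_in.
  rewrite -compA (compA (i n)) -di (compA (e n)) -eX -compA.
  by rewrite (proj2 (eP n.+1)) compm1.
- by apply: zero_object_isom => //; exact: zobP.
case=> [|n]; first by apply: conflation_isom_l; [exact: isomM | exact: zobP].
apply: (conf_isom (exactP E) (isom1 _) (ie n.+1) (isom1 _) _ _ (cip n)) => /=.
  by rewrite compm1.
by rewrite comp1m -compA (proj1 (eP n.+1)) compm1.
Qed.

Section RelativeShift.
Variables (M N : exactCategory) (F : exactFunctor M N).

Definition sh_u_fun (X : nat -> M) (Y : nat -> N) (u : forall n, hom (F (X n)) (Y n))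
    n : hom (F (sh_ob X n)) (sh_ob Y n) :=
  match n return hom (F (sh_ob X n)) (sh_ob Y n) with 0 => 0 | m.+1 => u m end.

Lemma sh_uP (X : cplx M) (Y : cplx N) (u : chmap (map_cplx F X) Y) n :
  sh_u_fun u n \oc cd (map_cplx F (sh_cplx X)) n
  = cd (sh_cplx Y) n \oc sh_u_fun u n.+1.
Proof. by case: n => [|n] /=; [rewrite !comp0m | exact: (cmapP u)]. Qed.

Definition sh_u (X : cplx M) (Y : cplx N) (u : chmap (map_cplx F X) Y) :
    chmap (map_cplx F (sh_cplx X)) (sh_cplx Y) :=
  @ChMap N (map_cplx F (sh_cplx X)) (sh_cplx Y) (sh_u_fun u) (sh_uP u).

Lemma sh_u_quasi_iso (X : cplx M) (Y : cplx N) (u : chmap (map_cplx F X) Y) :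
  quasi_iso u -> quasi_iso (sh_u u).
Proof.
have Fz : zero_object (F zob) by apply: (@fmap_zero_object M N F zob); exact: zobP.
(* In degree 1 the new cone is [F zob (+) Y 0]; its first summand is zero but present, hence the
   inclusion [in2]. *)
pose e n : hom (cone u n) (cone (sh_u u) n.+1) :=
  match n return hom (cone u n) (cone (sh_u u) n.+1) with
  | 0 => in2 _ _ | m.+1 => idm _ end.
apply: (acyclic_shift (e := e)); first exact: zobP.
  case=> [|n]; last exact: isom1.
  exists (pr2 _ _); split; first exact: pr2in2.
  by rewrite -[RHS]bipE (zero_object_in (pr1 _ _) 0 Fz) compm0 add0r.
case=> [|n]; rewrite /= compm1 ?comp1m //.
by rewrite /bip_in (zero_object_in (bip_out (- _) _) 0 Fz) compm0 add0r.
Qed.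

Lemma sh_chmap_quasi_iso (E : exactCategory) (X Y : cplx E) (u : chmap X Y) :
  quasi_iso u -> quasi_iso (sh_chmap u).
Proof.
pose e n : hom (cone u n) (cone (sh_chmap u) n.+1) :=
  match n return hom (cone u n) (cone (sh_chmap u) n.+1) with
  | 0 => in2 _ _ | m.+1 => idm _ end.
apply: (acyclic_shift (e := e)); first exact: zobP.
  case=> [|n]; last exact: isom1.
  exists (pr2 _ _); split; first exact: pr2in2.
  by rewrite -[RHS]bipE (zero_object_in (pr1 _ _) 0 (@zobP E)) compm0 add0r.
case=> [|n]; rewrite /= compm1 ?comp1m //.
by rewrite /bip_in (zero_object_in (bip_out (- _) _) 0 (@zobP E)) compm0 add0r.
Qed.

Definition Sh (X : BF F) : BF F :=
  @BFOb _ _ F (sh_cplx (BF_Mtop X)) (sh_cplx (BF_Mbot X)) (sh_bcplx (BF_N X))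
    (sh_u (BF_utop X)) (sh_u (BF_ubot X))
    (sh_u_quasi_iso (BF_utopP X)) (sh_u_quasi_iso (BF_ubotP X)).

Definition Sh_map (X Y : BF F) (f : hom X Y) : hom (Sh X) (Sh Y).
Proof.
exists (sh_chmap (BF_phitop f)) (sh_chmap (BF_phibot f)) (sh_bmap (BF_psi f));
  case=> [|n] /=; rewrite ?compm0 ?comp0m //.
  exact: BF_mortopP.
exact: BF_morbotP.
Defined.

Lemma sh_ses (E : exactCategory) (X Y Z : nat -> E)
    (f : forall n, hom (X n) (Y n)) (g : forall n, hom (Y n) (Z n)) :
  ses_deg f g -> ses_deg (sh_fun f) (sh_fun g).
Proof. by move=> fg [|n]; [apply: conflation_zero; exact: zobP | exact: fg]. Qed.

End RelativeShift.

(** * From Bass's group to Grayson's group *)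

Section DegreeZero.
Variables (M N : exactCategory) (F : exactFunctor M N).
Hypothesis hM : supports_long_exact_sequences M.
Hypothesis hN : supports_long_exact_sequences N.
Local Notation cls := (@K0Grayson_cls M N F).

(** [pB] asks for an inverse of [BF_psi] as a map of binary complexes; the degreewise inverses
    commute with both differentials because [BF_psi f] does. *)
Lemma K0Grayson_isom (X Y : BF F) (f : BF_mor X Y) :
  (forall n, isom (BF_phitop f n)) -> (forall n, isom (BF_phibot f n)) ->
  (forall n, isom (BF_psi f n)) -> cls X = cls Y.
Proof.
move=> ft fb fp; apply: (@K0Grayson_p _ _ _ _ _ f); split.
- exact: (iso_quasi_iso hM).
- exact: (iso_quasi_iso hM).
have /dep_choice[g gP] := fp.
have gc (dX : forall n, hom (BF_N X n.+1) (BF_N X n))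
    (dY : forall n, hom (BF_N Y n.+1) (BF_N Y n)) :
    (forall n, BF_psi f n \oc dX n = dY n \oc BF_psi f n.+1) ->
    forall n, g n \oc dY n = dX n \oc g n.+1.
  move=> fd n; rewrite -[LHS]compm1 -(proj2 (gP n.+1)) -compA (compA (dY n)) -fd.
  by rewrite -compA (compA (g n)) (proj1 (gP n)) comp1m.
exists (BMap (gc _ _ (bmapP (BF_psi f))) (gc _ _ (bmapP' (BF_psi f)))).
by split; apply: bmap_eq => n /=; case: (gP n).
Qed.

Definition deg0 P Q (C : N) (a : hom (F P) C) (b : hom (F Q) C) (ha : isom a)
    (hb : isom b) : BF F :=
  @BFOb _ _ F (conc P) (conc Q) (bconc C) (conc_u a) (conc_u b)
    (conc_u_quasi_iso ha) (conc_u_quasi_iso hb).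

Lemma conc_isom (A : addCategory) (P Q : A) (f : hom P Q) n :
  isom f -> isom (conc_fun f n).
Proof. by case: n => [//|n] _; exact: isom1. Qed.

Lemma deg0_isom P Q C P' Q' C' (a : hom (F P) C) (b : hom (F Q) C)
    (a' : hom (F P') C') (b' : hom (F Q') C') (ha : isom a) (hb : isom b)
    (ha' : isom a') (hb' : isom b') (p : hom P P') (q : hom Q Q') (c : hom C C') :
  isom p -> isom q -> isom c ->
  c \oc a = a' \oc fmap F p -> c \oc b = b' \oc fmap F q ->
  cls (deg0 ha hb) = cls (deg0 ha' hb').
Proof.
move=> ip iq ic ca cb.
have kt n : bconc_map c n \oc BF_utop (deg0 ha hb) n
    = BF_utop (deg0 ha' hb') n \oc fmap F (conc_map p n).
  by case: n => [//|n] /=; rewrite compm0 comp0m.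
have kb n : bconc_map c n \oc BF_ubot (deg0 ha hb) n
    = BF_ubot (deg0 ha' hb') n \oc fmap F (conc_map q n).
  by case: n => [//|n] /=; rewrite compm0 comp0m.
pose f := @BFMor _ _ F (deg0 ha hb) (deg0 ha' hb') (conc_map p) (conc_map q)
  (bconc_map c) kt kb.
by apply: (@K0Grayson_isom _ _ f) => n; exact: conc_isom.
Qed.

Lemma conc_conflation (E : exactCategory) (A B D : E) (f : hom A B) (g : hom B D) n :
  conflation f g -> conflation (conc_fun f n) (conc_fun g n).
Proof. by case: n => [//|n] _; apply: conflation_zero; exact: zobP. Qed.

Definition fdir P P' (C C' : N) (a : hom (F P) C) (a' : hom (F P') C') :
    hom (F (bip P P')) (bip C C') :=
  bip_in (a \oc fmap F (pr1 P P')) (a' \oc fmap F (pr2 P P')).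

Lemma fdir_isom P P' C C' (a : hom (F P) C) (a' : hom (F P') C') :
  isom a -> isom a' -> isom (fdir a a').
Proof.
move=> ia ia'; have -> : fdir a a' = bip_map a a' \oc fbip_iso F P P'.
  by rewrite /fbip_iso bip_map_in.
by apply: isomM; [exact: fbip_iso_isom | exact: bip_map_isom].
Qed.

Lemma fdir_in1 P P' C C' (a : hom (F P) C) (a' : hom (F P') C') :
  in1 C C' \oc a = fdir a a' \oc fmap F (in1 P P').
Proof.
rewrite /fdir bip_in_comp -!compA -!fmapM pr1in1 pr2in1 fmap0 fmap1 compm1 compm0.
by rewrite in1E bip_in_comp comp1m comp0m.
Qed.

Lemma fdir_pr2 P P' C C' (a : hom (F P) C) (a' : hom (F P') C') :
  pr2 C C' \oc fdir a a' = a' \oc fmap F (pr2 P P').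
Proof. exact: pr2_bip_in. Qed.

Lemma deg0_sum P Q C P' Q' C' (a : hom (F P) C) (b : hom (F Q) C)
    (a' : hom (F P') C') (b' : hom (F Q') C') (ha : isom a) (hb : isom b)
    (ha' : isom a') (hb' : isom b') :
  cls (deg0 (fdir_isom ha ha') (fdir_isom hb hb'))
  = cls (deg0 ha hb) + cls (deg0 ha' hb').
Proof.
set Y := deg0 (fdir_isom _ _) _.
have it n : bconc_map (in1 C C') n \oc BF_utop (deg0 ha hb) n
    = BF_utop Y n \oc fmap F (conc_map (in1 P P') n).
  by case: n => [|n] /=; [exact: fdir_in1 | rewrite compm0 comp0m].
have ib n : bconc_map (in1 C C') n \oc BF_ubot (deg0 ha hb) n
    = BF_ubot Y n \oc fmap F (conc_map (in1 Q Q') n).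
  by case: n => [|n] /=; [exact: fdir_in1 | rewrite compm0 comp0m].
have pt n : bconc_map (pr2 C C') n \oc BF_utop Y n
    = BF_utop (deg0 ha' hb') n \oc fmap F (conc_map (pr2 P P') n).
  by case: n => [|n] /=; [exact: fdir_pr2 | rewrite compm0 comp0m].
have pb n : bconc_map (pr2 C C') n \oc BF_ubot Y n
    = BF_ubot (deg0 ha' hb') n \oc fmap F (conc_map (pr2 Q Q') n).
  by case: n => [|n] /=; [exact: fdir_pr2 | rewrite compm0 comp0m].
pose i := @BFMor _ _ F (deg0 ha hb) Y (conc_map (in1 P P')) (conc_map (in1 Q Q')) (bconc_map (in1 C C')) it ib.
pose p := @BFMor _ _ F Y (deg0 ha' hb')
  (conc_map (pr2 P P')) (conc_map (pr2 Q Q')) (bconc_map (pr2 C C')) pt pb.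
by apply: (@K0Grayson_ses _ _ _ _ _ _ i p); split=> n;
  apply: conc_conflation; exact: conflation_in1_pr2.
Qed.

Definition two_u_fun P (C : N) (a0 a1 : hom (F P) C) n :
    hom (F (two_ob P P n)) (two_ob C C n) :=
  match n return hom (F (two_ob P P n)) (two_ob C C n) with
  | 0 => a0 | 1 => a1 | _ => 0 end.

Lemma two_uP P (C : N) (a0 a1 : hom (F P) C) (g : hom C C) : a0 = g \oc a1 ->
  forall n, two_u_fun a0 a1 n \oc cd (map_cplx F (two (idm P))) n
  = two_d g n \oc two_u_fun a0 a1 n.+1.
Proof.
by move=> ag [|[|n]] /=; rewrite ?fmap1 ?fmap0 ?compm0 ?comp0m // compm1.
Qed.

Lemma two_u_isom P (C : N) (a0 a1 : hom (F P) C) n :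
  isom a0 -> isom a1 -> isom (two_u_fun a0 a1 n).
Proof.
case: n => [|[|n]] //= _ _; apply: zero_object_isom; last exact: zobP.
by apply: (@fmap_zero_object M N F zob); exact: zobP.
Qed.

Section TwoTerm.
Variables (C : N) (g h : hom C C).
Hypotheses (ig : isom g) (ih : isom h).

Lemma zero_two_quasi_iso (k : hom C C)
    (u : chmap (map_cplx F (conc zob)) (two k)) : isom k -> quasi_iso u.
Proof.
move=> /two_contraction[s sP]; apply: (zero_quasi_iso hN u _ sP) => n.
by apply: (@fmap_zero_object M N F); case: n => [|n]; exact: zobP.
Qed.

Definition two0 : BF F := @BFOb _ _ F (conc zob) (conc zob) (btwo g h)
  (chmap0 (map_cplx F (conc zob)) (two g)) (chmap0 (map_cplx F (conc zob)) (two h))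
  (zero_two_quasi_iso _ ig) (zero_two_quasi_iso _ ih).

(** Let [Y] have the components [P = P] and [Q = Q] in [M], mapped isomorphically to [C => C]. Its
    class is computed twice: the map from [two0] to [Y] is in [pB] because [P = P] and [Q = Q] are
    contractible, and [Y] is an extension of its degree 1 part by its degree 0 part. *)
Lemma two0_deg0 P Q (a0 a1 : hom (F P) C) (b0 b1 : hom (F Q) C) (ha0 : isom a0)
    (ha1 : isom a1) (hb0 : isom b0) (hb1 : isom b1) :
  a0 = g \oc a1 -> b0 = h \oc b1 ->
  cls two0 = cls (deg0 ha0 hb0) + cls (Sh (deg0 ha1 hb1)).
Proof.
move=> ag bh.
pose ut := @ChMap N (map_cplx F (two (idm P))) (top (btwo g h)) _ (two_uP ag).
pose ub := @ChMap N (map_cplx F (two (idm Q))) (bot (btwo g h)) _ (two_uP bh).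
have qt : quasi_iso ut by apply: (iso_quasi_iso hN) => n; exact: two_u_isom.
have qb : quasi_iso ub by apply: (iso_quasi_iso hN) => n; exact: two_u_isom.
pose Y : BF F := @BFOb _ _ F (two (idm P)) (two (idm Q)) (btwo g h) ut ub qt qb.
have kt n : bmap_id (btwo g h) n \oc BF_utop two0 n
    = BF_utop Y n \oc fmap F (chmap0 (conc zob) (two (idm P)) n).
  by rewrite /= fmap0 !compm0.
have kb n : bmap_id (btwo g h) n \oc BF_ubot two0 n
    = BF_ubot Y n \oc fmap F (chmap0 (conc zob) (two (idm Q)) n).
  by rewrite /= fmap0 !compm0.
have zq (R : M) : quasi_iso (chmap0 (conc zob) (two (idm R))).
  have [s sP] := two_contraction (isom1 R).
  by apply: (zero_quasi_iso hM _ _ sP) => -[|n]; exact: zobP.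
rewrite (@K0Grayson_p _ _ _ two0 Y (@BFMor _ _ F two0 Y (chmap0 _ _) (chmap0 _ _) (bmap_id (btwo g h)) kt kb)); last first.
  by split; [exact: zq | exact: zq | exact: isom1].
have F0 n : zero_object (F (conc_ob zob n)).
  by apply: (@fmap_zero_object M N F); case: n => [|n]; exact: zobP.
pose ci (E : exactCategory) (A B : E) (f : hom A B) :=
  @ChMap E (conc B) (two f) _ (two_inP f).
pose co (E : exactCategory) (A B : E) (f : hom A B) :=
  @ChMap E (two f) (sh_cplx (conc A)) _ (two_outP f).
pose bi := @BMap N (bconc C) (btwo g h) _ (two_inP g) (two_inP h).
pose bo := @BMap N (btwo g h) (sh_bcplx (bconc C)) _ (two_outP g) (two_outP h).
have iT n : bi n \oc BF_utop (deg0 ha0 hb0) n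
    = BF_utop Y n \oc fmap F (ci _ _ _ (idm P) n).
  by case: n => [|n] /=; rewrite ?fmap1 ?fmap0 ?compm0 // compm1 comp1m.
have iB n : bi n \oc BF_ubot (deg0 ha0 hb0) n
    = BF_ubot Y n \oc fmap F (ci _ _ _ (idm Q) n).
  by case: n => [|n] /=; rewrite ?fmap1 ?fmap0 ?compm0 // compm1 comp1m.
have oT n : bo n \oc BF_utop Y n
    = BF_utop (Sh (deg0 ha1 hb1)) n \oc fmap F (co _ _ _ (idm P) n).
  by case: n => [|[|n]] /=; rewrite ?fmap1 ?fmap0 ?compm0 ?comp0m // compm1 comp1m.
have oB n : bo n \oc BF_ubot Y n
    = BF_ubot (Sh (deg0 ha1 hb1)) n \oc fmap F (co _ _ _ (idm Q) n).
  by case: n => [|[|n]] /=; rewrite ?fmap1 ?fmap0 ?compm0 ?comp0m // compm1 comp1m.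
pose i := @BFMor _ _ F (deg0 ha0 hb0) Y (ci _ _ _ (idm P)) (ci _ _ _ (idm Q)) bi iT iB.
pose p := @BFMor _ _ F Y (Sh (deg0 ha1 hb1))
  (co _ _ _ (idm P)) (co _ _ _ (idm Q)) bo oT oB.
by apply: (@K0Grayson_ses _ _ _ _ _ _ i p); split=> n; exact: two_conflation.
Qed.

End TwoTerm.

Lemma two0_id C : cls (two0 (isom1 C) (isom1 C)) = 0.
Proof.
have q : quasi_iso (chmap0 (map_cplx F (conc zob)) (two (idm C))).
  exact: (zero_two_quasi_iso _ (isom1 C)).
rewrite -(K0Grayson_Delta (CFOb q)).
set X := Delta_ob _; set Y := two0 _ _.
have kt n : bmap_id (btwo (idm C) (idm C)) n \oc BF_utop Y n
    = BF_utop X n \oc fmap F (chmap_id (conc zob) n) by rewrite compm0 comp0m.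
have kb n : bmap_id (btwo (idm C) (idm C)) n \oc BF_ubot Y n
    = BF_ubot X n \oc fmap F (chmap_id (conc zob) n) by rewrite compm0 comp0m.
by apply: (@K0Grayson_isom _ _ (@BFMor _ _ F Y X (chmap_id _) (chmap_id _) (bmap_id _) kt kb)) => n; exact: isom1.
Qed.

(** For [g = h = 1] the binary complex [C => C] is diagonal, so the two summands of [two0_deg0]
    cancel. *)
Lemma deg0_shift P Q (C : N) (a : hom (F P) C) (b : hom (F Q) C) (ha : isom a)
  (hb : isom b) : cls (Sh (deg0 ha hb)) = - cls (deg0 ha hb).
Proof.
apply/eqP; rewrite -addr_eq0 addrC; apply/eqP.
by rewrite -(two0_deg0 (isom1 C) (isom1 C)) ?comp1m //; exact: two0_id.
Qed.

Lemma deg0_diff P Q C (a0 a1 : hom (F P) C) (b0 b1 : hom (F Q) C) (ha0 : isom a0)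
    (ha1 : isom a1) (hb0 : isom b0) (hb1 : isom b1) (g h : hom C C)
    (ig : isom g) (ih : isom h) :
  a0 = g \oc a1 -> b0 = h \oc b1 ->
  cls (deg0 ha0 hb0) - cls (deg0 ha1 hb1) = cls (two0 ig ih).
Proof. by move=> ag bh; rewrite -deg0_shift (two0_deg0 ig ih ha0 ha1 hb0 hb1 ag bh). Qed.

Lemma deg0_dup P (C : N) (a : hom (F P) C) (ha : isom a) : cls (deg0 ha ha) = 0.
Proof.
rewrite -(K0Grayson_Delta (CFOb (conc_u_quasi_iso ha))).
set X := Delta_ob _; set Y := deg0 _ _.
have kt n : bmap_id (bconc C) n \oc BF_utop Y n
    = BF_utop X n \oc fmap F (chmap_id (conc P) n).
  by rewrite /= fmap1 compm1 comp1m.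
have kb n : bmap_id (bconc C) n \oc BF_ubot Y n
    = BF_ubot X n \oc fmap F (chmap_id (conc P) n).
  by rewrite /= fmap1 compm1 comp1m.
by apply: (@K0Grayson_isom _ _ (@BFMor _ _ F Y X (chmap_id _) (chmap_id _) (bmap_id _) kt kb)) => n; exact: isom1.
Qed.

Definition swap (A : addCategory) (P Q : A) : hom (bip P Q) (bip Q P) :=
  bip_in (pr2 P Q) (pr1 P Q).

Lemma swapK (A : addCategory) (P Q : A) : swap Q P \oc swap P Q = idm (bip P Q).
Proof. by rewrite /swap bip_in_comp pr1_bip_in pr2_bip_in bip_in_pr. Qed.

Lemma swap_isom (A : addCategory) (P Q : A) : isom (swap P Q).
Proof. by exists (swap Q P); rewrite !swapK. Qed.

(* On [F R (+) F R] the swap is the image of the swap of [R (+) R]. *)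
Lemma two0_swap R : cls (two0 (isom1 (bip (F R) (F R))) (swap_isom (F R) (F R))) = 0.
Proof.
pose i := fdir (idm (F R)) (idm (F R)).
have ii : isom i by apply: fdir_isom; exact: isom1.
have isi : isom (swap (F R) (F R) \oc i) by apply: isomM; last exact: swap_isom.
rewrite -(deg0_diff ii ii isi ii _ (swap_isom _ _)) ?comp1m //.
apply/eqP; rewrite subr_eq0; apply/eqP.
apply: (deg0_isom ii isi ii ii (isom1 _) (swap_isom R R) (isom1 _)).
  by rewrite fmap1 compm1 comp1m.
rewrite comp1m /i /fdir /swap !bip_in_comp pr1_bip_in pr2_bip_in -!compA -!fmapM.
by rewrite pr1_bip_in pr2_bip_in.
Qed.

(** Moving the middle object along [b] turns [(P, a, Q)] into the pair [[b a, b]]. Adding the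
    diagonal [[b, b]] to [[b a, 1]] gives [[b a (+) b, 1 (+) b]], while [[b a, b] + [b, 1]] is
    [[b a (+) b, b (+) 1]]. The tops agree, and the bottoms differ by the swap of [F R (+) F R] and
    by the swap of their sources, which lies in [M]. *)
Lemma Psi_comp (P Q R : M) (a : hom (F P) (F Q)) (b : hom (F Q) (F R))
    (ha : isom a) (hb : isom b) :
  cls (Psi_ob (CoOb (isomM ha hb)))
  = cls (Psi_ob (CoOb ha)) + cls (Psi_ob (CoOb hb)).
Proof.
pose hba := isomM ha hb; pose h1 := isom1 (F R).
have -> : cls (Psi_ob (CoOb ha)) = cls (deg0 hba hb).
  apply: (deg0_isom ha (isom1 _) hba hb (isom1 _) (isom1 _) hb).
    by rewrite fmap1 compm1.
  by rewrite fmap1 compm1.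
rewrite -[LHS]addr0 -(deg0_dup hb).
rewrite -[LHS](deg0_sum hba h1 hb hb) -[RHS](deg0_sum hba hb hb h1).
have hs := isomM (fdir_isom hb h1) (swap_isom (F R) (F R)).
have -> : cls (deg0 (fdir_isom hba hb) (fdir_isom h1 hb))
    = cls (deg0 (fdir_isom hba hb) hs).
  apply: (deg0_isom _ _ _ _ (isom1 _) (swap_isom R Q) (isom1 _)).
    by rewrite fmap1 compm1 comp1m.
  rewrite comp1m /fdir /swap !bip_in_comp pr1_bip_in pr2_bip_in -!compA -!fmapM.
  by rewrite pr1_bip_in pr2_bip_in.
apply/eqP; rewrite -subr_eq0; apply/eqP.
rewrite (deg0_diff (fdir_isom hba hb) (fdir_isom hba hb) hs (fdir_isom hb h1)
  (isom1 _) (swap_isom _ _)) ?comp1m //.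
exact: two0_swap.
Qed.

Lemma Psi_ses (X Y Z : co F) (f : hom X Y) (g : hom Y Z) :
  ses f g -> cls (Psi F Y) = cls (Psi F X) + cls (Psi F Z).
Proof.
move=> [fg1 fg2]; apply: (@K0Grayson_ses _ _ _ _ _ _ (fmap (Psi F) f) (fmap (Psi F) g)).
by split=> n; apply: conc_conflation => //; exact: fmap_conflation.
Qed.

Lemma Bass_to_Grayson : exists Phi : {additive K0Bass F -> K0Grayson F},
  forall X : co F, Phi (K0Bass_cls X) = cls (Psi F X).
Proof.
apply: (K0Bass_lift (h := fun X => cls (Psi F X))); first exact: Psi_ses.
exact: Psi_comp.
Qed.

End DegreeZero.

(** * Quotients of isomorphisms in Bass's group *)

Section BassClasses.
Variables (M N : exactCategory) (F : exactFunctor M N).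

(* The class of [(P, a, Q)]; the junk value [0] when [a] is not an isomorphism
   spares us a proof argument. *)
Definition bcl P Q (a : hom (F P) (F Q)) : K0Bass F :=
  if pselect (isom a) is left ia then K0Bass_cls (CoOb ia) else 0.

Lemma bclE P Q (a : hom (F P) (F Q)) (ia : isom a) :
  bcl a = K0Bass_cls (CoOb ia).
Proof.
rewrite /bcl; case: pselect => [ia'|//].
by rewrite (Prop_irrelevance ia' ia).
Qed.

Lemma bcl_comp P Q R (a : hom (F P) (F Q)) (b : hom (F Q) (F R)) :
  isom a -> isom b -> bcl (b \oc a) = bcl a + bcl b.
Proof.
by move=> ia ib; rewrite (bclE (isomM ia ib)) (bclE ia) (bclE ib) K0Bass_comp.
Qed.

Lemma bcl1 P : bcl (idm (F P)) = 0.
Proof.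
apply: (addrI (bcl (idm (F P)))); rewrite addr0 -bcl_comp ?comp1m //; exact: isom1.
Qed.

Lemma bcl_ses P1 P P2 Q1 Q Q2 (i : hom P1 P) (p : hom P P2) (j : hom Q1 Q)
    (q : hom Q Q2) (a1 : hom (F P1) (F Q1)) (a : hom (F P) (F Q))
    (a2 : hom (F P2) (F Q2)) :
  conflation i p -> conflation j q -> isom a1 -> isom a -> isom a2 ->
  fmap F j \oc a1 = a \oc fmap F i -> fmap F q \oc a = a2 \oc fmap F p ->
  bcl a = bcl a1 + bcl a2.
Proof.
move=> ip jq ia1 ia ia2 ea1 ea2; rewrite (bclE ia1) (bclE ia2) (bclE ia).
pose f := @CoMor _ _ F (CoOb ia1) (CoOb ia) i j ea1.
pose g := @CoMor _ _ F (CoOb ia) (CoOb ia2) p q ea2.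
exact: (@K0Bass_ses _ _ _ _ _ _ f g).
Qed.

Lemma bcl_conj P Q P' Q' (a : hom (F P) (F Q)) (a' : hom (F P') (F Q'))
    (p : hom P P') (q : hom Q Q') :
  isom p -> isom q -> isom a -> isom a' -> fmap F q \oc a = a' \oc fmap F p ->
  bcl a = bcl a'.
Proof.
move=> ip iq ia ia' e.
rewrite (@bcl_ses _ _ zob _ _ zob p 0 q 0 a a' (idm _)) //.
- by rewrite bcl1 addr0.
- by apply: conflation_isom_l => //; exact: zobP.
- by apply: conflation_isom_l => //; exact: zobP.
- exact: isom1.
- by rewrite !fmap0 comp1m comp0m.
Qed.

(** The pair [(1, f^-1)] is an isomorphism in [co(F)] from [(P, F f, Q)] to [(P, 1, P)]. *)
Lemma bcl_fmap P Q (f : hom P Q) : isom f -> bcl (fmap F f) = 0.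
Proof.
move=> [g [gf fg]]; rewrite -(bcl1 P).
apply: (bcl_conj (p := idm P) (q := g)).
- exact: isom1.
- by exists f.
- by apply: fmap_isom; exists g.
- exact: isom1.
- by rewrite -fmapM gf !fmap1 comp1m.
Qed.

Lemma bcl_inv P Q (a : hom (F P) (F Q)) (a' : hom (F Q) (F P)) :
  a' \oc a = idm _ -> a \oc a' = idm _ -> bcl a' = - bcl a.
Proof.
move=> a'a aa'; apply/eqP; rewrite -addr_eq0 addrC -bcl_comp ?a'a ?bcl1 //.
  by exists a'.
by exists a.
Qed.

Definition fsum P P' Q Q' (a : hom (F P) (F P')) (b : hom (F Q) (F Q')) :
    hom (F (bip P Q)) (F (bip P' Q')) :=
  fbip_in (a \oc fmap F (pr1 P Q)) (b \oc fmap F (pr2 P Q)).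

Lemma fsum_in P P' Q Q' T (a : hom (F P) (F P')) (b : hom (F Q) (F Q'))
    (x : hom T (F P)) (y : hom T (F Q)) :
  fsum a b \oc fbip_in x y = fbip_in (a \oc x) (b \oc y).
Proof. by rewrite /fsum fbip_in_comp -!compA fpr1_in fpr2_in. Qed.

Lemma fsumM P P' P2 Q Q' Q2 (a : hom (F P) (F P')) (b : hom (F Q) (F Q'))
    (a' : hom (F P') (F P2)) (b' : hom (F Q') (F Q2)) :
  fsum a' b' \oc fsum a b = fsum (a' \oc a) (b' \oc b).
Proof. by rewrite {2}/fsum fsum_in !compA. Qed.

Lemma fsum1 P Q : fsum (idm (F P)) (idm (F Q)) = idm _.
Proof. by rewrite -[RHS]fbip_in_eta /fsum !comp1m !compm1. Qed.

Lemma fsum_isom P P' Q Q' (a : hom (F P) (F P')) (b : hom (F Q) (F Q')) :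
  isom a -> isom b -> isom (fsum a b).
Proof.
move=> [a' [a'a aa']] [b' [b'b bb']]; exists (fsum a' b').
by rewrite !fsumM a'a aa' b'b bb' !fsum1.
Qed.

Lemma fsum_fmap P P' Q Q' (f : hom P P') (g : hom Q Q') :
  fsum (fmap F f) (fmap F g) = fmap F (bip_map f g).
Proof. by rewrite /bip_map fmap_bip_in !fmapM. Qed.

Lemma bcl_triangular P P' Q Q' (u : hom (F (bip P Q)) (F (bip P' Q')))
    (a : hom (F P) (F P')) (b : hom (F Q) (F Q')) :
  isom u -> isom a -> isom b ->
  fmap F (in1 P' Q') \oc a = u \oc fmap F (in1 P Q) ->
  fmap F (pr2 P' Q') \oc u = b \oc fmap F (pr2 P Q) ->
  bcl u = bcl a + bcl b.
Proof. by move=> iu ia ib e1 e2; apply: bcl_ses e1 e2 => //; exact: conflation_in1_pr2. Qed.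

Lemma bcl_triangular' P P' Q Q' (u : hom (F (bip P Q)) (F (bip P' Q')))
    (a : hom (F P) (F P')) (b : hom (F Q) (F Q')) :
  isom u -> isom a -> isom b ->
  fmap F (in2 P' Q') \oc b = u \oc fmap F (in2 P Q) ->
  fmap F (pr1 P' Q') \oc u = a \oc fmap F (pr1 P Q) ->
  bcl u = bcl a + bcl b.
Proof.
move=> iu ia ib e1 e2; rewrite addrC; apply: bcl_ses e1 e2 => //.
  apply: (split_conflation (r := pr2 P Q) (s := in1 P Q)).
  - exact: pr2in2.
  - exact: pr1in1.
  - by rewrite addrC bipE.
apply: (split_conflation (r := pr2 P' Q') (s := in1 P' Q')).
- exact: pr2in2.
- exact: pr1in1.
- by rewrite addrC bipE.
Qed.

Lemma bcl_fsum P P' Q Q' (a : hom (F P) (F P')) (b : hom (F Q) (F Q')) :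
  isom a -> isom b -> bcl (fsum a b) = bcl a + bcl b.
Proof.
move=> ia ib; apply: bcl_triangular => //; first exact: fsum_isom.
  rewrite /fsum fbip_in_comp -!compA -!fmapM pr1in1 pr2in1 fmap0 fmap1 compm0.
  by rewrite compm1 /fbip_in compm0 addr0.
exact: fpr2_in.
Qed.

Lemma unipotent_isom (A : addCategory) (X : A) (n : hom X X) :
  n \oc n = 0 -> isom (idm X + n).
Proof.
move=> nn; exists (idm X - n); split.
  by rewrite compBl comp1m compmDr compm1 nn addr0 addrK.
by rewrite compmDl comp1m compBr compm1 nn subr0 subrK.
Qed.

Lemma bcl_elem1 P Q (x : hom (F Q) (F P)) :
  let n := fmap F (in1 P Q) \oc x \oc fmap F (pr2 P Q) in
  isom (idm _ + n) /\ bcl (idm _ + n) = 0.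
Proof.
move=> n; have iu : isom (idm _ + n).
  apply: unipotent_isom; rewrite /n -!compA (compA (fmap F (pr2 P Q))) -fmapM.
  by rewrite pr2in1 fmap0 comp0m !compm0.
split=> //; rewrite (bcl_triangular iu (isom1 _) (isom1 _)) ?bcl1 ?addr0 //.
  rewrite compmDl comp1m compm1 -!compA -fmapM pr2in1 fmap0 !compm0.
  by rewrite addr0.
by rewrite compmDr compm1 comp1m !compA -fmapM pr2in1 fmap0 !comp0m addr0.
Qed.

Lemma bcl_elem2 P Q (y : hom (F P) (F Q)) :
  let n := fmap F (in2 P Q) \oc y \oc fmap F (pr1 P Q) in
  isom (idm _ + n) /\ bcl (idm _ + n) = 0.
Proof.
move=> n; have iu : isom (idm _ + n).
  apply: unipotent_isom; rewrite /n -!compA (compA (fmap F (pr1 P Q))) -fmapM.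
  by rewrite pr1in2 fmap0 comp0m !compm0.
split=> //; rewrite (bcl_triangular' iu (isom1 _) (isom1 _)) ?bcl1 ?addr0 //.
  rewrite compmDl comp1m compm1 -!compA -fmapM pr1in2 fmap0 !compm0.
  by rewrite addr0.
by rewrite compmDr compm1 comp1m !compA -fmapM pr1in2 fmap0 !comp0m addr0.
Qed.

Hypothesis cofF : cofinal F.

(* [1 + x y] is a commutator of elementary matrices on [F P (+) F L], once the
   middle object is completed to some [F L]. *)
Lemma bcl_unipotent P (C : N) (x : hom C (F P)) (y : hom (F P) C) :
  y \oc x = 0 ->
  isom (idm (F P) + x \oc y) /\ bcl (idm (F P) + x \oc y) = 0.
Proof.
move=> yx; have iu : isom (idm (F P) + x \oc y).
  by apply: unipotent_isom; rewrite -compA (compA y) yx comp0m compm0.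
split=> //; have [C' [L [k [k' [k'k kk']]]]] := cofF C.
pose x' := x \oc pr1 C C' \oc k'; pose y' := k \oc in1 C C' \oc y.
have xy' : x' \oc y' = x \oc y.
  by rewrite /x' /y' -!compA (compA k') k'k comp1m (compA (pr1 _ _)) pr1in1 comp1m.
have yx' : y' \oc x' = 0.
  by rewrite /x' /y' -!compA (compA y) yx comp0m !compm0.
move: x' y' xy' yx' => x' y' xy' yx'.
pose n1 := fmap F (in1 P L) \oc x' \oc fmap F (pr2 P L).
pose n2 := fmap F (in2 P L) \oc y' \oc fmap F (pr1 P L).
have n11 : n1 \oc n1 = 0.
  rewrite /n1 -!compA (compA (fmap F (pr2 P L))) -fmapM.
  by rewrite pr2in1 fmap0 comp0m !compm0.
have n22 : n2 \oc n2 = 0.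
  rewrite /n2 -!compA (compA (fmap F (pr1 P L))) -fmapM.
  by rewrite pr1in2 fmap0 comp0m !compm0.
have n21 : n2 \oc n1 = 0.
  rewrite /n1 /n2 -!compA (compA (fmap F (pr1 P L))) -fmapM pr1in1 fmap1 comp1m.
  by rewrite (compA y') yx' comp0m compm0.
have n12 : n1 \oc n2 = fmap F (in1 P L) \oc (x \oc y) \oc fmap F (pr1 P L).
  rewrite /n1 /n2 -!compA (compA (fmap F (pr2 P L))) -fmapM pr2in2 fmap1 comp1m.
  by rewrite (compA x') xy' !compA.
have [i1 b1] := bcl_elem1 x'; have [i2 b2] := bcl_elem2 y'.
have [j1 c1] := bcl_elem1 (- x'); have [j2 c2] := bcl_elem2 (- y').
rewrite -/n1 in i1 b1; rewrite -/n2 in i2 b2.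
rewrite compmN compNm -/n1 in j1 c1; rewrite compmN compNm -/n2 in j2 c2.
pose E1 := idm (F (bip P L)) + n1; pose E2 := idm (F (bip P L)) + n2.
pose G1 := idm (F (bip P L)) - n1; pose G2 := idm (F (bip P L)) - n2.
(* [G1] and [G2] are the inverses of [E1] and [E2]. Since [n1^2], [n2^2] and [n2 n1] vanish, the
   commutator is [1 + n1 n2], which is block diagonal with entries [1 + x y] and [1]. *)
have comm : E1 \oc (E2 \oc (G1 \oc G2)) = idm _ + n1 \oc n2.
  have -> : G1 \oc G2 = idm _ - n1 - n2 + n1 \oc n2.
    rewrite /G1 /G2 compBl compBr !comp1m compBr compm1 opprB.
    by rewrite addrA [LHS]addrAC [_ - n2 - n1]addrAC.
  have -> : E2 \oc (idm _ - n1 - n2 + n1 \oc n2) = idm _ - n1 + n1 \oc n2.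
    rewrite /E2 compmDl comp1m compmDr !compBr compm1 n21 n22 !subr0 (compA n2).
    by rewrite n21 comp0m addr0 addrAC subrK.
  rewrite /E1 compmDl comp1m compmDr compBr compm1 n11 subr0 (compA n1) n11.
  by rewrite comp0m addr0 addrAC subrK.
have b0 : bcl (E1 \oc (E2 \oc (G1 \oc G2))) = 0.
  rewrite !bcl_comp //; try by do ?[exact: isomM | apply: isomM].
  by rewrite b1 b2 c1 c2 !addr0.
have ic : isom (idm _ + n1 \oc n2) by rewrite -comm; do ![apply: isomM => //].
rewrite -b0 comm (bcl_triangular ic iu (isom1 _)) ?bcl1 ?addr0 // n12.
  rewrite compmDl compmDr comp1m compm1 -!compA -fmapM pr1in1 fmap1.
  by rewrite compm1.
by rewrite compmDr compm1 comp1m !compA -fmapM pr2in1 fmap0 !comp0m addr0.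
Qed.

End BassClasses.

Definition inverses (C : category) (A B : C) (a : hom A B) (a' : hom B A) : Prop :=
  a' \oc a = idm A /\ a \oc a' = idm B.

Lemma inverses_isom (C : category) (A B : C) (a : hom A B) (a' : hom B A) :
  inverses a a' -> isom a.
Proof. by move=> h; exists a'. Qed.

Lemma inverses_comp (C : category) (A B D : C) (a : hom A B) (a' : hom B A)
    (b : hom B D) (b' : hom D B) :
  inverses a a' -> inverses b b' -> inverses (b \oc a) (a' \oc b').
Proof.
move=> [a'a aa'] [b'b bb']; split.
  by rewrite -compA (compA b') b'b comp1m.
by rewrite -compA (compA a) aa' comp1m.
Qed.

Lemma inverses_nat (C : category) (A B A' B' : C) (a : hom A B) (a' : hom B A)
    (b : hom A' B') (b' : hom B' A') (f : hom A A') (g : hom B B') :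
  inverses a a' -> inverses b b' -> g \oc a = b \oc f -> f \oc a' = b' \oc g.
Proof.
move=> [_ aa'] [b'b _] e; rewrite -[LHS]comp1m -b'b -compA (compA b) -e.
by rewrite -compA aa' compm1.
Qed.

(** * Differences of two isomorphisms with a common summand in [N] *)

Section Delta.
Variables (M N : exactCategory) (F : exactFunctor M N).

(* The "difference" [b^-1 a : F P (+) F Q' -> F P' (+) F Q] of two isomorphisms
   [a : F P -> F Q (+) B] and [b : F P' -> F Q' (+) B], with [b'] inverse to [b]. *)
Definition hdiff P Q P' Q' (B : N) (a : hom (F P) (bip (F Q) B))
    (b' : hom (bip (F Q') B) (F P')) : hom (F (bip P Q')) (F (bip P' Q)) :=
  fbip_in (b' \oc bip_in (fmap F (pr2 P Q')) (pr2 _ _ \oc a \oc fmap F (pr1 P Q')))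
          (pr1 _ _ \oc a \oc fmap F (pr1 P Q')).

(** In terms of elements, [hdiff a b'] sends [(p, q')] to [(p', q)] exactly when [a p = (q, z)] and
    [b p' = (q', z)] for a common [z] in [B]. Exchanging [a] and [b] inverts this relation. *)
Lemma hdiffK P Q P' Q' (B : N) (a : hom (F P) (bip (F Q) B)) a'
    (b : hom (F P') (bip (F Q') B)) b' :
  inverses a a' -> inverses b b' -> hdiff b a' \oc hdiff a b' = idm _.
Proof.
move=> [a'a aa'] [b'b bb'].
rewrite {1}/hdiff fbip_in_comp -!compA bip_in_comp -!compA fpr2_in fpr1_in.
rewrite (compA b) bb' comp1m pr1_bip_in pr2_bip_in -!compA.
by rewrite bip_in_eta (compA a') a'a comp1m -[RHS]fbip_in_eta !compm1.
Qed.

Lemma hdiff_inverses P Q P' Q' (B : N) (a : hom (F P) (bip (F Q) B)) a'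
    (b : hom (F P') (bip (F Q') B)) b' :
  inverses a a' -> inverses b b' -> inverses (hdiff a b') (hdiff b a').
Proof. by move=> ia ib; split; exact: hdiffK. Qed.

Lemma hdiff_nat P Q P' Q' (B : N) P1 Q1 P1' Q1' (B1 : N)
    (a : hom (F P) (bip (F Q) B)) (b' : hom (bip (F Q') B) (F P'))
    (a1 : hom (F P1) (bip (F Q1) B1)) (b1' : hom (bip (F Q1') B1) (F P1'))
    (p : hom (F P1) (F P)) (q : hom (F Q1) (F Q)) (p' : hom (F P1') (F P'))
    (q' : hom (F Q1') (F Q')) (f : hom B1 B) :
  bip_map q f \oc a1 = a \oc p -> p' \oc b1' = b' \oc bip_map q' f ->
  fsum p' q \oc hdiff a1 b1' = hdiff a b' \oc fsum p q'.
Proof.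
move=> ea eb; rewrite /hdiff fsum_in fbip_in_comp /fsum -!compA.
rewrite bip_in_comp -!compA !fpr1_in fpr2_in (compA p') eb -!compA bip_map_in.
congr (fbip_in (_ \oc bip_in _ _) _); rewrite !(compA a) -ea !compA.
  by rewrite pr2_map.
by rewrite pr1_map.
Qed.

Lemma elem1_in P Q T (x : hom (F Q) (F P)) (a : hom T (F P)) (b : hom T (F Q)) :
  (idm _ + fmap F (in1 P Q) \oc x \oc fmap F (pr2 P Q)) \oc fbip_in a b
  = fbip_in (a + x \oc b) b.
Proof.
rewrite compmDl comp1m -!compA fpr2_in /fbip_in compmDr.
by rewrite -!addrA; congr (_ + _); rewrite addrC.
Qed.

Lemma elem2_in P Q T (y : hom (F P) (F Q)) (a : hom T (F P)) (b : hom T (F Q)) :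
  (idm _ + fmap F (in2 P Q) \oc y \oc fmap F (pr1 P Q)) \oc fbip_in a b
  = fbip_in a (b + y \oc a).
Proof. by rewrite compmDl comp1m -!compA fpr1_in /fbip_in compmDr addrA. Qed.

Definition delta P Q P' Q' (B : N) (a : hom (F P) (bip (F Q) B))
    (b' : hom (bip (F Q') B) (F P')) : K0Bass F := bcl (hdiff a b').

Lemma delta_sym P Q P' Q' (B : N) (a : hom (F P) (bip (F Q) B)) a'
    (b : hom (F P') (bip (F Q') B)) b' :
  inverses a a' -> inverses b b' -> delta b a' = - delta a b'.
Proof. by move=> ia ib; case: (hdiff_inverses ia ib); exact: bcl_inv. Qed.

(** The square [hdiff_nat] read on classes. The map [f] on the common summand leaves no term behind,
    since that summand is cancelled in the difference. *)
Lemma delta_nat P Q P' Q' (B : N) P1 Q1 P1' Q1' (B1 : N)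
    (a : hom (F P) (bip (F Q) B)) a' (b : hom (F P') (bip (F Q') B)) b'
    (a1 : hom (F P1) (bip (F Q1) B1)) a1' (b1 : hom (F P1') (bip (F Q1') B1)) b1'
    (p : hom (F P1) (F P)) (q : hom (F Q1) (F Q)) (p' : hom (F P1') (F P'))
    (q' : hom (F Q1') (F Q')) (f : hom B1 B) :
  inverses a a' -> inverses b b' -> inverses a1 a1' -> inverses b1 b1' ->
  isom p -> isom q -> isom p' -> isom q' ->
  bip_map q f \oc a1 = a \oc p -> bip_map q' f \oc b1 = b \oc p' ->
  delta a1 b1' + bcl p' + bcl q = delta a b' + bcl p + bcl q'.
Proof.
move=> ia ib ia1 ib1 ip iq ip' iq' ea eb.
have eb' : p' \oc b1' = b' \oc bip_map q' f by exact: inverses_nat ib1 ib eb.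
have i1 := inverses_isom (hdiff_inverses ia1 ib1).
have i2 := inverses_isom (hdiff_inverses ia ib).
rewrite /delta -!addrA -bcl_fsum // -(bcl_fsum ip iq').
rewrite -bcl_comp ?(hdiff_nat ea eb') ?bcl_comp //; try exact: fsum_isom.
exact: addrC.
Qed.

Lemma delta_precomp P Q P' Q' (B : N) (a : hom (F P) (bip (F Q) B)) a'
    (b : hom (F P') (bip (F Q') B)) b' (u : hom (F P) (F P)) :
  inverses a a' -> inverses b b' -> isom u ->
  delta (a \oc u) b' = delta a b' + bcl u.
Proof.
move=> ia ib iu; have [u' iu'] := iu.
have := @delta_nat _ _ _ _ _ _ _ _ _ _ a a' b b' (a \oc u) (u' \oc a') b b' u (idm _)
  (idm _) (idm _) (idm _) ia ib (inverses_comp iu' ia) ib iu (isom1 _) (isom1 _)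
  (isom1 _).
by rewrite !bcl1 !addr0 !bip_map1 !comp1m compm1; apply.
Qed.

(** The map [hdiff a a'] is not an identity: it sends [(p, q)] to [(p - x (y p - q), y p)] with
    [y x = 1], and so behaves like a swap of two copies of [F Q]. It is
    [D : (p, q) |-> (p, y p - q)] followed by two elementary matrices. The diagonal entries of [D]
    are [1] and [-1 = F (-1)], both of class zero. *)
Lemma delta_same P Q (B : N) (a : hom (F P) (bip (F Q) B)) a' :
  inverses a a' -> delta a a' = 0.
Proof.
move=> [a'a aa'].
pose x := a' \oc in1 (F Q) B; pose y := pr1 (F Q) B \oc a.
have yx : y \oc x = idm (F Q) by rewrite /x /y -compA (compA a) aa' comp1m pr1in1.
have [i1 b1] := bcl_elem1 (- x); have [i2 b2] := bcl_elem2 y.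
pose D := fbip_in (fmap F (pr1 P Q)) (y \oc fmap F (pr1 P Q) - fmap F (pr2 P Q)).
have iD : isom D.
  suff DD : D \oc D = idm _ by exists D.
  rewrite /D fbip_in_comp compBl -!compA fpr1_in fpr2_in opprB addrCA subrr addr0.
  by rewrite -[RHS]fbip_in_eta !compm1.
have iN : isom (- idm (F Q)).
  by exists (- idm (F Q)); rewrite compNm compmN opprK comp1m.
have bD : bcl D = 0.
  rewrite (bcl_triangular' iD (isom1 _) iN).
  - have -> : - idm (F Q) = fmap F (- idm Q) by rewrite fmapN fmap1.
    rewrite bcl1 add0r bcl_fmap //.
    by exists (- idm Q); rewrite compNm compmN opprK comp1m.
  - apply: fbip_ext.
      rewrite compA -fmapM pr1in2 fmap0 comp0m compA fpr1_in -fmapM pr1in2 fmap0 //.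
    rewrite compA -fmapM pr2in2 fmap1 comp1m compA fpr2_in compBl -compA -!fmapM.
    by rewrite pr1in2 pr2in2 fmap0 fmap1 compm0 sub0r.
  - by rewrite comp1m fpr1_in.
suff -> : delta a a' = bcl ((idm _ + fmap F (in2 P Q) \oc y \oc fmap F (pr1 P Q)) \oc
   ((idm _ + fmap F (in1 P Q) \oc (- x) \oc fmap F (pr2 P Q)) \oc D)).
  by rewrite !bcl_comp ?b1 ?b2 ?bD ?addr0 //; exact: isomM.
congr bcl; rewrite /D elem1_in elem2_in /hdiff; congr fbip_in.
  have e2 : a' \oc in2 (F Q) B \oc (pr2 (F Q) B \oc a) = idm _ - x \oc y.
    apply/eqP; rewrite eq_sym subr_eq addrC; apply/eqP.
    by rewrite -a'a -{1}[a]comp1m -bipE compmDl compmDr /x /y !compA.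
  rewrite /bip_in compmDr !(compA a') (compA (a' \oc in2 _ _)) e2 -/x -/y compBl comp1m.
  rewrite compBr !compNm opprK.
  by rewrite [LHS]addrC -addrA -compA.
rewrite compmDr compNm compmN (compA y) yx comp1m opprB.
by rewrite [_ + (_ - _)]addrC !subrK.
Qed.

End Delta.

Lemma bip_conflation (E : exactCategory) (spl : split_exact E)
    (A B D A' B' D' : E) (i : hom A B) (p : hom B D) (i' : hom A' B') (p' : hom B' D') :
  conflation i p -> conflation i' p' -> conflation (bip_map i i') (bip_map p p').
Proof.
move=> /spl[r [s [ri ps rs]]] /spl[r' [s' [ri' ps' rs']]].
apply: (split_conflation (r := bip_map r r') (s := bip_map s s'));
  rewrite !bip_map_comp ?ri ?ri' ?ps ?ps' ?bip_map1 //.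
by rewrite bip_mapD rs rs' bip_map1.
Qed.

Definition bassoc (A : addCategory) (X Y Z : A) :
    hom (bip (bip X Y) Z) (bip X (bip Y Z)) :=
  bip_in (pr1 X Y \oc pr1 _ Z) (bip_map (pr2 X Y) (idm Z)).

Definition bassoc' (A : addCategory) (X Y Z : A) :
    hom (bip X (bip Y Z)) (bip (bip X Y) Z) :=
  bip_in (bip_map (idm X) (pr1 Y Z)) (pr2 Y Z \oc pr2 X _).

Lemma bassoc_inverses (A : addCategory) (X Y Z : A) :
  inverses (bassoc X Y Z) (bassoc' X Y Z).
Proof.
rewrite /bassoc /bassoc' /bip_map; split.
  rewrite bip_in_comp -!compA !bip_in_comp !comp1m -!compA !pr2_bip_in !pr1_bip_in.
  by rewrite bip_in_eta bip_in_pr.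
rewrite bip_in_comp -!compA !bip_in_comp !comp1m -!compA !pr1_bip_in !pr2_bip_in.
by rewrite bip_in_eta bip_in_pr.
Qed.

Lemma bassoc_nat (A : addCategory) (X Y Z X' Y' Z' : A) (f : hom X X') (g : hom Y Y')
    (h : hom Z Z') :
  bip_map f (bip_map g h) \oc bassoc X Y Z
  = bassoc X' Y' Z' \oc bip_map (bip_map f g) h.
Proof.
rewrite /bassoc bip_map_in bip_map_comp compm1 bip_in_comp -!compA pr1_map.
by rewrite bip_map_comp comp1m pr2_map (compA (pr1 _ _)) pr1_map -!compA.
Qed.

(** * Isomorphisms [F P (+) A -> F Q (+) B], with [A] completed to an image of [F] *)

Section Completion.
Variables (M N : exactCategory) (F : exactFunctor M N).

Record complement (A : N) := Complement {
  comp_A : N;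
  comp_L : M;
  comp_c : hom (bip A comp_A) (F comp_L);
  comp_c' : hom (F comp_L) (bip A comp_A);
  comp_cP : inverses comp_c comp_c'
}.

Section Hat.
Variables (A : N) (k : complement A).
Local Notation A' := (comp_A k).
Local Notation L := (comp_L k).

(* With [F L = A (+) A'], the isomorphism [hat a] is [a (+) 1_A']. *)
Definition jhat P : hom (F (bip P L)) (bip (bip (F P) A) A') :=
  bip_in (bip_in (fmap F (pr1 P L)) (pr1 A A' \oc comp_c' k \oc fmap F (pr2 P L)))
         (pr2 A A' \oc comp_c' k \oc fmap F (pr2 P L)).

Definition jhat' P : hom (bip (bip (F P) A) A') (F (bip P L)) :=
  fbip_in (pr1 (F P) A \oc pr1 _ A') (comp_c k \oc bip_map (pr2 (F P) A) (idm A')).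

Lemma jhat_inverses P : inverses (jhat P) (jhat' P).
Proof.
have [c'c cc'] := comp_cP k; rewrite /jhat /jhat' /bip_map; split.
  rewrite fbip_in_comp -!compA !bip_in_comp !comp1m -!compA !pr1_bip_in !pr2_bip_in.
  rewrite bip_in_eta (compA _ (comp_c' k)) cc' comp1m.
  by rewrite -[RHS]fbip_in_eta !compm1.
rewrite !bip_in_comp -!compA fpr1_in fpr2_in !(compA (comp_c' k)) c'c comp1m.
rewrite pr1_bip_in pr2_bip_in comp1m bip_in_eta; exact: bip_in_pr.
Qed.

Definition hat P Q (B : N) (a : hom (bip (F P) A) (bip (F Q) B)) :
    hom (F (bip P L)) (bip (F Q) (bip B A')) :=
  bassoc (F Q) B A' \oc (bip_map a (idm A') \oc jhat P).

Definition hat' P Q (B : N) (a : hom (bip (F Q) B) (bip (F P) A)) :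
    hom (bip (F Q) (bip B A')) (F (bip P L)) :=
  jhat' P \oc bip_map a (idm A') \oc bassoc' (F Q) B A'.

Lemma hat_inverses P Q (B : N) (a : hom (bip (F P) A) (bip (F Q) B)) a' :
  inverses a a' -> inverses (hat a) (hat' a').
Proof.
move=> [a'a aa']; apply: inverses_comp (bassoc_inverses _ _ _).
apply: inverses_comp (jhat_inverses P) _.
by split; rewrite bip_map_comp ?a'a ?aa' comp1m bip_map1.
Qed.

End Hat.

Lemma jhat_nat (A A1 : N) (k : complement A) (k1 : complement A1) P P1
    (p : hom (F P1) (F P)) (f : hom A1 A) (f' : hom (comp_A k1) (comp_A k))
    (l : hom (F (comp_L k1)) (F (comp_L k))) :
  l \oc comp_c k1 = comp_c k \oc bip_map f f' ->
  bip_map (bip_map p f) f' \oc jhat k1 P1 = jhat k P \oc fsum p l.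
Proof.
move=> e; have e' := inverses_nat (comp_cP k1) (comp_cP k) e.
have e1 : f \oc (pr1 _ _ \oc comp_c' k1) = pr1 _ _ \oc comp_c' k \oc l.
  by rewrite -(compA _ _ l) -e' !compA pr1_map.
have e2 : f' \oc (pr2 _ _ \oc comp_c' k1) = pr2 _ _ \oc comp_c' k \oc l.
  by rewrite -(compA _ _ l) -e' !compA pr2_map.
rewrite /jhat !bip_map_in !bip_in_comp /fsum fpr1_in -!(compA _ (fmap F (pr2 _ _))).
by rewrite !fpr2_in (compA f) e1 (compA f') e2 -!(compA _ l).
Qed.

Lemma hat_nat (A A1 : N) (k : complement A) (k1 : complement A1) P Q (B : N) P1 Q1
    (B1 : N) (a : hom (bip (F P) A) (bip (F Q) B))
    (a1 : hom (bip (F P1) A1) (bip (F Q1) B1)) (p : hom (F P1) (F P))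
    (q : hom (F Q1) (F Q)) (f : hom A1 A) (g : hom B1 B)
    (f' : hom (comp_A k1) (comp_A k)) (l : hom (F (comp_L k1)) (F (comp_L k))) :
  l \oc comp_c k1 = comp_c k \oc bip_map f f' ->
  bip_map q g \oc a1 = a \oc bip_map p f ->
  bip_map q (bip_map g f') \oc hat k1 a1 = hat k a \oc fsum p l.
Proof.
move=> el ea; rewrite /hat compA bassoc_nat -!compA; congr (_ \oc _).
rewrite compA bip_map_comp ea compm1 -(jhat_nat _ el) compA bip_map_comp.
by rewrite comp1m.
Qed.

Definition cdelta (A : N) (k : complement A) P Q P' Q' (B : N)
    (a : hom (bip (F P) A) (bip (F Q) B)) (b' : hom (bip (F Q') B) (bip (F P') A)) :=
  delta (hat k a) (hat' k b').

Lemma cdelta_sym (A : N) (k : complement A) P Q P' Q' (B : N)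
    (a : hom (bip (F P) A) (bip (F Q) B)) a'
    (b : hom (bip (F P') A) (bip (F Q') B)) b' :
  inverses a a' -> inverses b b' -> cdelta k b a' = - cdelta k a b'.
Proof. by move=> ia ib; apply: delta_sym; exact: hat_inverses. Qed.

Lemma cdelta_same (A : N) (k : complement A) P Q (B : N)
    (a : hom (bip (F P) A) (bip (F Q) B)) a' :
  inverses a a' -> cdelta k a a' = 0.
Proof. by move=> ia; apply: delta_same; exact: hat_inverses. Qed.

(** The isomorphism [l] need not be the image of a map of [M]: its class enters once with [P] and
    once with [P'], on opposite sides, and cancels. *)
Lemma cdelta_isom (A : N) (k k1 : complement A) P Q P' Q' (B : N)
    (a : hom (bip (F P) A) (bip (F Q) B)) a'
    (b : hom (bip (F P') A) (bip (F Q') B)) b'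
    (f : hom (comp_A k1) (comp_A k)) (l : hom (F (comp_L k1)) (F (comp_L k))) :
  inverses a a' -> inverses b b' -> isom l ->
  l \oc comp_c k1 = comp_c k \oc bip_map (idm A) f ->
  cdelta k1 a b' = cdelta k a b'.
Proof.
move=> ia ib il el.
have := delta_nat (hat_inverses k ia) (hat_inverses k ib) (hat_inverses k1 ia)
  (hat_inverses k1 ib) (fsum_isom (isom1 (F P)) il) (isom1 (F Q))
  (fsum_isom (isom1 (F P')) il) (isom1 (F Q')) (hat_nat el _) (hat_nat el _).
move=> /(_ (idm B)); rewrite !bip_map1 !comp1m !compm1 => /(_ erefl erefl).
rewrite !bcl_fsum ?bcl1 //; try exact: isom1.
by rewrite !addr0 add0r; exact: addIr.
Qed.

Hypotheses (splM : split_exact M) (cofF : cofinal F).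

Lemma delta_ses P Q P' Q' (B : N) P1 Q1 P1' Q1' (B1 : N) P2 Q2 P2' Q2' (B2 : N)
    (a : hom (F P) (bip (F Q) B)) a' (b : hom (F P') (bip (F Q') B)) b'
    (a1 : hom (F P1) (bip (F Q1) B1)) a1' (b1 : hom (F P1') (bip (F Q1') B1)) b1'
    (a2 : hom (F P2) (bip (F Q2) B2)) a2' (b2 : hom (F P2') (bip (F Q2') B2)) b2'
    (iP : hom P1 P) (iQ : hom Q1 Q) (iP' : hom P1' P') (iQ' : hom Q1' Q')
    (pP : hom P P2) (pQ : hom Q Q2) (pP' : hom P' P2') (pQ' : hom Q' Q2')
    (f : hom B1 B) (g : hom B B2) :
  inverses a a' -> inverses b b' -> inverses a1 a1' -> inverses b1 b1' ->
  inverses a2 a2' -> inverses b2 b2' ->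
  conflation iP pP -> conflation iQ pQ -> conflation iP' pP' -> conflation iQ' pQ' ->
  bip_map (fmap F iQ) f \oc a1 = a \oc fmap F iP ->
  bip_map (fmap F iQ') f \oc b1 = b \oc fmap F iP' ->
  bip_map (fmap F pQ) g \oc a = a2 \oc fmap F pP ->
  bip_map (fmap F pQ') g \oc b = b2 \oc fmap F pP' ->
  delta a b' = delta a1 b1' + delta a2 b2'.
Proof.
move=> ia ib ia1 ib1 ia2 ib2 cP cQ cP' cQ' e1 e1' e2 e2'.
have f1 := inverses_nat ib1 ib e1'; have f2 := inverses_nat ib ib2 e2'.
apply: (bcl_ses (bip_conflation splM cP cQ') (bip_conflation splM cP' cQ)).
- exact: inverses_isom (hdiff_inverses ia1 ib1).
- exact: inverses_isom (hdiff_inverses ia ib).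
- exact: inverses_isom (hdiff_inverses ia2 ib2).
- by rewrite -!fsum_fmap; exact: hdiff_nat e1 f1.
- by rewrite -!fsum_fmap; exact: hdiff_nat e2 f2.
Qed.

Lemma cdelta_ses (A A1 A2 : N) (k : complement A) (k1 : complement A1)
    (k2 : complement A2) P Q P' Q' (B : N) P1 Q1 P1' Q1' (B1 : N) P2 Q2 P2' Q2' (B2 : N)
    (a : hom (bip (F P) A) (bip (F Q) B)) a' (b : hom (bip (F P') A) (bip (F Q') B)) b'
    (a1 : hom (bip (F P1) A1) (bip (F Q1) B1)) a1'
    (b1 : hom (bip (F P1') A1) (bip (F Q1') B1)) b1'
    (a2 : hom (bip (F P2) A2) (bip (F Q2) B2)) a2'
    (b2 : hom (bip (F P2') A2) (bip (F Q2') B2)) b2'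
    (iP : hom P1 P) (iQ : hom Q1 Q) (iP' : hom P1' P') (iQ' : hom Q1' Q')
    (pP : hom P P2) (pQ : hom Q Q2) (pP' : hom P' P2') (pQ' : hom Q' Q2')
    (iA : hom A1 A) (pA : hom A A2) (iB : hom B1 B) (pB : hom B B2)
    (iA' : hom (comp_A k1) (comp_A k)) (pA' : hom (comp_A k) (comp_A k2))
    (iL : hom (comp_L k1) (comp_L k)) (pL : hom (comp_L k) (comp_L k2)) :
  inverses a a' -> inverses b b' -> inverses a1 a1' -> inverses b1 b1' ->
  inverses a2 a2' -> inverses b2 b2' ->
  conflation iP pP -> conflation iQ pQ -> conflation iP' pP' -> conflation iQ' pQ' ->
  conflation iL pL ->
  fmap F iL \oc comp_c k1 = comp_c k \oc bip_map iA iA' ->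
  fmap F pL \oc comp_c k = comp_c k2 \oc bip_map pA pA' ->
  bip_map (fmap F iQ) iB \oc a1 = a \oc bip_map (fmap F iP) iA ->
  bip_map (fmap F iQ') iB \oc b1 = b \oc bip_map (fmap F iP') iA ->
  bip_map (fmap F pQ) pB \oc a = a2 \oc bip_map (fmap F pP) pA ->
  bip_map (fmap F pQ') pB \oc b = b2 \oc bip_map (fmap F pP') pA ->
  cdelta k a b' = cdelta k1 a1 b1' + cdelta k2 a2 b2'.
Proof.
move=> ia ib ia1 ib1 ia2 ib2 cP cQ cP' cQ' cL eL1 eL2 e1 e1' e2 e2'.
apply: (delta_ses (hat_inverses k ia) (hat_inverses k ib) (hat_inverses k1 ia1)
  (hat_inverses k1 ib1) (hat_inverses k2 ia2) (hat_inverses k2 ib2)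
  (bip_conflation splM cP cL) cQ (bip_conflation splM cP' cL) cQ'
  (f := bip_map iB iA') (g := bip_map pB pA')); rewrite -fsum_fmap.
- exact: hat_nat eL1 e1.
- exact: hat_nat eL1 e1'.
- exact: hat_nat eL2 e2.
- exact: hat_nat eL2 e2'.
Qed.

(** The automorphism [1 + x y] lives on [F P (+) A], where Bass's group assigns it no class. After
    completion it becomes [1 + x1 y1] on [F (P (+) L)], still with [y1 x1 = 0], and [bcl_unipotent]
    applies. *)
Lemma cdelta_precomp (A : N) (k : complement A) P Q P' Q' (B : N)
    (a : hom (bip (F P) A) (bip (F Q) B)) a'
    (b : hom (bip (F P') A) (bip (F Q') B)) b'
    (C : N) (x : hom C (bip (F P) A)) (y : hom (bip (F P) A) C) :
  inverses a a' -> inverses b b' -> y \oc x = 0 ->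
  cdelta k (a \oc (idm _ + x \oc y)) b' = cdelta k a b'.
Proof.
move=> ia ib yx.
pose x1 := jhat' k P \oc in1 _ _ \oc x; pose y1 := y \oc pr1 _ _ \oc jhat k P.
have [j'j jj'] := jhat_inverses k P.
have yx1 : y1 \oc x1 = 0.
  rewrite /y1 /x1 -!compA (compA (jhat k P)) jj' comp1m (compA (pr1 _ _)) pr1in1.
  by rewrite comp1m.
have [iu u0] := bcl_unipotent cofF yx1.
have -> : cdelta k (a \oc (idm _ + x \oc y)) b'
    = delta (hat k a \oc (idm _ + x1 \oc y1)) (hat' k b').
  congr delta; rewrite /hat -!compA; congr (_ \oc _).
  have -> : bip_map (a \oc (idm _ + x \oc y)) (idm (comp_A k))
      = bip_map a (idm _) \oc bip_map (idm _ + x \oc y) (idm (comp_A k)).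
    by rewrite bip_map_comp comp1m.
  rewrite -compA; congr (_ \oc _).
  rewrite compmDr compm1 /x1 !(compA (jhat k P)) jj' comp1m.
  have -> : bip_map (idm _ + x \oc y) (idm (comp_A k))
      = idm _ + in1 _ _ \oc x \oc y \oc pr1 _ _.
    rewrite /bip_map -[idm (bip _ (comp_A k))]bip_in_pr comp1m compmDl comp1m.
    rewrite in1E !bip_in_comp !comp0m comp1m bip_inD addr0 //.
  by rewrite compmDl comp1m /y1 -!compA.
by rewrite (delta_precomp (hat_inverses k ia) (hat_inverses k ib) iu) u0 addr0.
Qed.

End Completion.

(** * Independence of the complement *)

Section ComplementIndependence.
Variables (M N : exactCategory) (F : exactFunctor M N).
Variable A : N.

(** Two complements [A1'] and [A2'] of [A] are compared through [A1' (+) (A (+) A2')], that is, the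
    first one enlarged by all of [F L2]. *)
Definition comp_add_c (k1 k2 : complement F A) :
    hom (bip A (bip (comp_A k1) (bip A (comp_A k2))))
        (F (bip (comp_L k1) (comp_L k2))) :=
  fbip_in (comp_c k1 \oc bip_map (idm A) (pr1 _ _))
          (comp_c k2 \oc (pr2 _ _ \oc pr2 _ _)).

Definition comp_add_c' (k1 k2 : complement F A) :
    hom (F (bip (comp_L k1) (comp_L k2)))
        (bip A (bip (comp_A k1) (bip A (comp_A k2)))) :=
  bip_in (pr1 _ _ \oc comp_c' k1 \oc fmap F (pr1 _ _))
    (bip_in (pr2 _ _ \oc comp_c' k1 \oc fmap F (pr1 _ _))
            (comp_c' k2 \oc fmap F (pr2 _ _))).

Lemma comp_add_inverses k1 k2 : inverses (comp_add_c k1 k2) (comp_add_c' k1 k2).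
Proof.
have [c1 d1] := comp_cP k1; have [c2 d2] := comp_cP k2.
rewrite /comp_add_c /comp_add_c' /bip_map; split.
  rewrite !bip_in_comp -!compA !fpr1_in !fpr2_in !(compA (comp_c' _)) c1 c2.
  by rewrite !comp1m pr1_bip_in pr2_bip_in !bip_in_eta bip_in_pr.
rewrite fbip_in_comp -!compA bip_in_comp -!compA !comp1m !pr1_bip_in !pr2_bip_in.
rewrite pr1_bip_in bip_in_eta !(compA (comp_c _)) d1 d2 !comp1m.
by rewrite -[RHS]fbip_in_eta !compm1.
Qed.

Definition comp_add (k1 k2 : complement F A) : complement F A :=
  Complement (comp_add_inverses k1 k2).

Lemma pr2_pr2_hat (k : complement F A) P Q (B : N)
    (a : hom (bip (F P) A) (bip (F Q) B)) :
  pr2 _ _ \oc (pr2 _ _ \oc hat k a) = pr2 _ _ \oc comp_c' k \oc fmap F (pr2 _ _).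
Proof.
rewrite /hat /bassoc (compA (pr2 _ (bip B _))) pr2_bip_in compA pr2_map -compA.
by rewrite (compA _ (bip_map a _)) pr2_map comp1m comp1m /jhat pr2_bip_in.
Qed.

Hypotheses (splM : split_exact M).

Section Fixed.
Variables (P Q P' Q' : M) (B : N).
Variables (a : hom (bip (F P) A) (bip (F Q) B)) (a' : hom (bip (F Q) B) (bip (F P) A)).
Variables (b : hom (bip (F P') A) (bip (F Q') B)) (b' : hom (bip (F Q') B) (bip (F P') A)).
Hypotheses (ia : inverses a a') (ib : inverses b b').

(** Completing with [comp_add k1 k2] extends the completion with [k1] by the isomorphism
    [F L2 -> 0 (+) (A (+) A2')]. This quotient is the same for [a] and for [b], so its contribution
    vanishes by [delta_same]. *)
Lemma cdelta_add (k1 k2 : complement F A) :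
  cdelta (comp_add k1 k2) a b' = cdelta k1 a b'.
Proof.
have [c2 d2] := comp_cP k2.
pose a2 : hom (F (comp_L k2)) (bip (F zob) (bip A (comp_A k2))) :=
  in2 _ _ \oc comp_c' k2.
pose a2' : hom (bip (F zob) (bip A (comp_A k2))) (F (comp_L k2)) :=
  comp_c k2 \oc pr2 _ _.
have i2 : inverses a2 a2'.
  split; first by rewrite /a2 /a2' -compA (compA (pr2 _ _)) pr2in2 comp1m.
  rewrite /a2 /a2' -compA (compA (comp_c' k2)) c2 comp1m -[RHS]bipE.
  have Fz : zero_object (F zob) by apply: (@fmap_zero_object M N F zob); exact: zobP.
  by rewrite (zero_object_in (pr1 _ _) 0 Fz) compm0 add0r.
have cP R : conflation (bip_map (idm R) (in1 (comp_L k1) (comp_L k2)))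
    (pr2 (comp_L k1) (comp_L k2) \oc pr2 R _).
  apply: (split_conflation (r := bip_map (idm R) (pr1 _ _)) (s := in2 _ _ \oc in2 _ _)).
  - by rewrite bip_map_comp pr1in1 comp1m bip_map1.
  - by rewrite -compA (compA (pr2 R _)) pr2in2 comp1m pr2in2.
  - rewrite bip_map_comp comp1m -!compA (compA (in2 (comp_L _) _)).
    rewrite -[RHS]bip_map1 -[idm (bip (comp_L _) _)]bipE /bip_map in2E.
    by rewrite bip_in_comp bip_inD comp0m addr0 !comp1m compmDl.
have cQ (R : M) : conflation (idm R) (0 : hom R zob).
  by apply: conflation_isom_l; [exact: isom1 | exact: zobP].
have e1 R R' (c : hom (bip (F R) A) (bip (F R') B)) :
    bip_map (fmap F (idm R')) (bip_map (idm B) (in1 _ _)) \oc hat k1 c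
    = hat (comp_add k1 k2) c \oc fmap F (bip_map (idm R) (in1 _ _)).
  rewrite -fsum_fmap !fmap1; apply: (@hat_nat _ _ _ _ _ (comp_add k1 k2) k1 _ _ _ _ _ _ _ _ _ _ (idm A)); last first.
    by rewrite !bip_map1 comp1m compm1.
  rewrite /= /comp_add_c fbip_in_comp -!compA pr2_map (compA _ (in1 _ _)) pr2in1.
  rewrite comp0m compm0 bip_map_comp pr1in1 comp1m bip_map1 compm1 /fbip_in.
  by rewrite compm0 addr0.
have e2 R R' (c : hom (bip (F R) A) (bip (F R') B)) :
    bip_map (fmap F (0 : hom R' zob)) (pr2 _ _ \oc pr2 _ _) \oc hat (comp_add k1 k2) c
    = a2 \oc fmap F (pr2 _ _ \oc pr2 _ _).
  rewrite /bip_map bip_in_comp fmap0 !comp0m -!compA pr2_pr2_hat /a2 in2E.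
  rewrite bip_in_comp comp0m comp1m fmapM; congr bip_in.
  by rewrite /= /comp_add_c' pr2_bip_in (compA (pr2 _ _)) pr2_bip_in -!compA.
rewrite /cdelta (delta_ses splM (hat_inverses (comp_add k1 k2) ia)
  (hat_inverses (comp_add k1 k2) ib)
  (hat_inverses k1 ia) (hat_inverses k1 ib) i2 i2 (cP P) (cQ Q) (cP P') (cQ Q')
  (e1 _ _ a) (e1 _ _ b) (e2 _ _ a) (e2 _ _ b)).
by rewrite (delta_same i2) addr0.
Qed.

(** Up to exchanging the outer summands of [A1' (+) (A (+) A2')], the two enlarged complements
    coincide. The isomorphism [l] that this forces on the images of [F] may be arbitrary in
    [cdelta_isom]. *)
Lemma cdelta_indep (k1 k2 : complement F A) : cdelta k1 a b' = cdelta k2 a b'.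
Proof.
rewrite -(cdelta_add k1 k2) -(cdelta_add k2 k1).
pose f (X Y : N) : hom (bip X (bip A Y)) (bip Y (bip A X)) :=
  bip_in (pr2 _ _ \oc pr2 _ _) (bip_in (pr1 _ _ \oc pr2 _ _) (pr1 _ _)).
have ff X Y : f Y X \oc f X Y = idm _.
  rewrite /f !bip_in_comp -!compA pr1_bip_in !pr2_bip_in pr1_bip_in.
  by rewrite bip_in_eta bip_in_pr.
have [c12 d12] := comp_add_inverses k1 k2; have i21 := comp_add_inverses k2 k1.
pose g : hom (comp_A (comp_add k1 k2)) (comp_A (comp_add k2 k1)) := f _ _.
have ig : isom g by exists (f (comp_A k2) (comp_A k1)); split; exact: ff.
pose l := comp_c (comp_add k2 k1) \oc (bip_map (idm A) g \oc comp_c' (comp_add k1 k2)).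
apply: (cdelta_isom (f := g) (l := l) ia ib).
- apply: isomM; last exact: inverses_isom i21.
  apply: isomM; last exact: bip_map_isom (isom1 _) ig.
  by exists (comp_c (comp_add k1 k2)).
- by rewrite /l -!compA c12 compm1.
Qed.

End Fixed.
End ComplementIndependence.

(** * Total complexes of the cones *)

Section Periodic.
Variable A : addCategory.

(* 2-periodic complexes [E1 <-> E0] with a contraction of square zero. *)
Record pcontraction (E0 E1 : A) (d1 : hom E1 E0) (d0 : hom E0 E1)
    (s1 : hom E1 E0) (s0 : hom E0 E1) : Prop := PContraction {
  pd10 : d1 \oc d0 = 0;
  pd01 : d0 \oc d1 = 0;
  ps10 : s1 \oc s0 = 0;
  ps01 : s0 \oc s1 = 0;
  pc0 : d1 \oc s0 + s1 \oc d0 = idm E0;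
  pc1 : d0 \oc s1 + s0 \oc d1 = idm E1
}.

Lemma pcontraction_sym (E0 E1 : A) (d1 : hom E1 E0) d0 s1 s0 :
  pcontraction d1 d0 s1 s0 -> pcontraction d0 d1 s0 s1.
Proof. by case=> *; split. Qed.

Section OneContraction.
Variables (E0 E1 : A) (d1 : hom E1 E0) (d0 : hom E0 E1).
Variables (s1 : hom E1 E0) (s0 : hom E0 E1).
Hypothesis h : pcontraction d1 d0 s1 s0.

Lemma pcontraction_inverses : inverses (d1 + s1) (d0 + s0).
Proof.
case: h => d10 d01 s10 s01 c0 c1; split; rewrite compmDl !compmDr.
  by rewrite d01 s01 add0r addr0.
by rewrite d10 s10 add0r addr0.
Qed.

Lemma pcontraction_dsd : d1 \oc (s0 \oc d1) = d1.
Proof.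
case: h => d10 d01 _ _ _ c1; rewrite -[RHS]compm1 -c1 compmDr !compA d10 comp0m.
by rewrite add0r.
Qed.

Lemma pcontraction_sds : s1 \oc (d0 \oc s1) = s1.
Proof.
case: h => _ _ s10 s01 _ c1; rewrite -[RHS]compm1 -c1 compmDr !compA s10 comp0m.
by rewrite addr0.
Qed.

End OneContraction.

(* Two contractions of the same complex are conjugate under the unipotent
   automorphism [1 + (t - s) d]. *)
Lemma pcontraction_conj (E0 E1 : A) (d1 : hom E1 E0) (d0 : hom E0 E1)
    (s1 t1 : hom E1 E0) (s0 t0 : hom E0 E1) :
  pcontraction d1 d0 s1 s0 -> pcontraction d1 d0 t1 t0 ->
  exists (x : hom E0 E1) (y : hom E1 E0) (x' : hom E1 E1) (y' : hom E1 E1),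
    [/\ y \oc x = 0, y' \oc x' = 0
      & d1 + t1 = (d1 + s1) \oc (idm _ + x' \oc y') \oc (idm _ + x \oc y)].
Proof.
move=> hs ht; have [a'a aa'] := pcontraction_inverses hs.
pose w1 := t1 - s1; pose w0 := t0 - s0.
have [d10 d01 s10 s01 c0 c1] := hs; have [_ _ t10 t01 e0 e1] := ht.
have w10 : d1 \oc w0 + w1 \oc d0 = 0.
  by rewrite /w1 /w0 compBr compBl addrACA e0 -opprD c0 subrr.
have w01 : d0 \oc w1 + w0 \oc d1 = 0.
  by rewrite /w1 /w0 compBr compBl addrACA e1 -opprD c1 subrr.
have dwd : d1 \oc (w0 \oc d1) = 0.
  have -> : d1 \oc (w0 \oc d1) = (d1 \oc w0 + w1 \oc d0) \oc d1.
    by rewrite compmDl -!compA d01 compm0 addr0.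
  by rewrite w10 comp0m.
have dwd' : d0 \oc (w1 \oc d0) = 0.
  have -> : d0 \oc (w1 \oc d0) = (d0 \oc w1 + w0 \oc d1) \oc d0.
    by rewrite compmDl -!compA d10 compm0 addr0.
  by rewrite w01 comp0m.
pose p0 := idm E0 + w1 \oc d0; pose p1 := idm E1 + w0 \oc d1.
(* [p0] and [p1] are the two components of [1 + w d] with [w = t - s]; they commute with [d] because
   [d w + w d = 0]. *)
have conj : (d1 + t1) \oc p1 = p0 \oc (d1 + s1).
  have cancel (x y z : hom E1 E0) : x + y + (z - y) = x + z.
    by rewrite -addrA [y + _]addrC subrK.
  have -> : (d1 + t1) \oc p1 = d1 + t1 \oc (d0 \oc s1).
    rewrite /p1 compmDr compm1 compmDl dwd add0r /w0 compBl compBr (compA t1 t0) t10.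
    rewrite comp0m sub0r.
    have -> : s0 \oc d1 = idm _ - d0 \oc s1 by rewrite -c1 addrAC subrr add0r.
    by rewrite compBr compm1 opprB cancel.
  rewrite /p0 compmDl comp1m compmDr -!compA d01 compm0 add0r /w1 compBl.
  by rewrite (pcontraction_sds hs) cancel.
(* Here [1 + x y] is the inverse of [p1], and [1 + x' y'] is [p0] carried across [d1 + s1]. The
   inner factors [d1 s0] and [d0 s1] force [y x = 0] and [y' x' = 0]; they disappear from the
   products because [d s d = d]. *)
exists (- (w0 \oc (d1 \oc s0))), d1.
exists ((d0 + s0) \oc (w1 \oc (d0 \oc s1))), (d0 \oc (d1 + s1)).
split.
- by rewrite compmN (compA w0) (compA d1) dwd comp0m oppr0.
- rewrite -!compA (compA (d1 + s1)) aa' comp1m.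
  by rewrite (compA w1) (compA d0) dwd' comp0m.
have q1 : p1 \oc (idm _ + - (w0 \oc (d1 \oc s0)) \oc d1) = idm _.
  rewrite compNm -!compA (pcontraction_dsd hs) /p1 compmDl comp1m compBr compm1.
  by rewrite -!compA dwd compm0 subr0 subrK.
have q0 : (d1 + s1) \oc (idm _ + (d0 + s0) \oc (w1 \oc (d0 \oc s1))
    \oc (d0 \oc (d1 + s1))) = p0 \oc (d1 + s1).
  rewrite compmDr compm1 -!compA (compA (d1 + s1)) aa' comp1m /p0 compmDl comp1m.
  by rewrite (compA s1) (compA d0) (pcontraction_dsd (pcontraction_sym hs)) -!compA.
by rewrite q0 -conj -compA q1 compm1.
Qed.

(* The homotopy [g = i s' r + j s'' p] has a defect [n = d g + g d - 1] of square
   zero that commutes with [d]; [t = g (1 - n)] is a contraction, and [t d t] is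
   one of square zero. *)
Lemma pcontraction_extend (E0 E1 E0' E1' E0'' E1'' : A)
    (d1 : hom E1 E0) (d0 : hom E0 E1)
    (d1' : hom E1' E0') (d0' : hom E0' E1') (s1' : hom E1' E0') (s0' : hom E0' E1')
    (d1'' : hom E1'' E0'') (d0'' : hom E0'' E1'')
    (s1'' : hom E1'' E0'') (s0'' : hom E0'' E1'')
    (i0 : hom E0' E0) (i1 : hom E1' E1) (p0 : hom E0 E0'') (p1 : hom E1 E1'')
    (r0 : hom E0 E0') (r1 : hom E1 E1') (j0 : hom E0'' E0) (j1 : hom E1'' E1) :
  d1 \oc d0 = 0 -> d0 \oc d1 = 0 ->
  pcontraction d1' d0' s1' s0' -> pcontraction d1'' d0'' s1'' s0'' ->
  i0 \oc d1' = d1 \oc i1 -> i1 \oc d0' = d0 \oc i0 ->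
  p0 \oc d1 = d1'' \oc p1 -> p1 \oc d0 = d0'' \oc p0 ->
  r0 \oc i0 = idm _ -> r1 \oc i1 = idm _ -> p0 \oc j0 = idm _ -> p1 \oc j1 = idm _ ->
  i0 \oc r0 + j0 \oc p0 = idm _ -> i1 \oc r1 + j1 \oc p1 = idm _ ->
  p0 \oc i0 = 0 -> p1 \oc i1 = 0 ->
  exists (s1 : hom E1 E0) (s0 : hom E0 E1),
    [/\ pcontraction d1 d0 s1 s0, i0 \oc s1' = s1 \oc i1, i1 \oc s0' = s0 \oc i0,
        p0 \oc s1 = s1'' \oc p1 & p1 \oc s0 = s0'' \oc p0].
Proof.
move=> d10 d01 h' h'' id1 id0 pd1 pd0 ri0 ri1 pj0 pj1 irjp0 irjp1 pi0 pi1.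
pose g1 := i0 \oc (s1' \oc r1) + j0 \oc (s1'' \oc p1).
pose g0 := i1 \oc (s0' \oc r0) + j1 \oc (s0'' \oc p0).
have gi1 : g1 \oc i1 = i0 \oc s1'.
  by rewrite /g1 compmDl -!compA ri1 pi1 !compm0 addr0 compm1.
have gi0 : g0 \oc i0 = i1 \oc s0'.
  by rewrite /g0 compmDl -!compA ri0 pi0 !compm0 addr0 compm1.
have pg1 : p0 \oc g1 = s1'' \oc p1.
  by rewrite /g1 compmDr !compA pi0 pj0 !comp0m add0r comp1m.
have pg0 : p1 \oc g0 = s0'' \oc p0.
  by rewrite /g0 compmDr !compA pi1 pj1 !comp0m add0r comp1m.
pose n0 := d1 \oc g0 + g1 \oc d0 - idm _; pose n1 := d0 \oc g1 + g0 \oc d1 - idm _.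
have ni0 : n0 \oc i0 = 0.
  rewrite /n0 compBl compmDl -!compA gi0 -id0 (compA d1) -id1 (compA g1) gi1 -!compA.
  by rewrite -compmDr (pc0 h') comp1m compm1 subrr.
have ni1 : n1 \oc i1 = 0.
  rewrite /n1 compBl compmDl -!compA gi1 -id1 (compA d0) -id0 (compA g0) gi0 -!compA.
  by rewrite -compmDr (pc1 h') comp1m compm1 subrr.
have pn0 : p0 \oc n0 = 0.
  rewrite /n0 compBr compmDr !compA pd1 pg1 -!compA pg0 pd0 !compA -compmDl.
  by rewrite (pc0 h'') comp1m compm1 subrr.
have pn1 : p1 \oc n1 = 0.
  rewrite /n1 compBr compmDr !compA pd0 pg0 -!compA pg1 pd1 !compA -compmDl.
  by rewrite (pc1 h'') comp1m compm1 subrr.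
have nn1 : n1 \oc n1 = 0.
  rewrite -{1}[n1]compm1 -irjp1 compmDr !compA ni1 comp0m add0r -compA pn1.
  exact: compm0.
have nn0 : n0 \oc n0 = 0.
  rewrite -{1}[n0]compm1 -irjp0 compmDr !compA ni0 comp0m add0r -compA pn0.
  exact: compm0.
have nd1 : n0 \oc d1 = d1 \oc n1.
  rewrite /n0 /n1 compBl compBr compmDl compmDr comp1m compm1 -!compA d01 compm0.
  by rewrite (compA d1 d0) d10 comp0m addr0 add0r.
have nd0 : n1 \oc d0 = d0 \oc n0.
  rewrite /n0 /n1 compBl compBr compmDl compmDr comp1m compm1 -!compA d10 compm0.
  by rewrite (compA d0 d1) d01 comp0m addr0 add0r.
pose t1 := g1 - g1 \oc n1; pose t0 := g0 - g0 \oc n0.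
have tc1 : d0 \oc t1 + t0 \oc d1 = idm _.
  rewrite /t1 /t0 compBr compBl -(compA g0) nd1 addrACA -opprD !compA -compmDl.
  have -> : d0 \oc g1 + g0 \oc d1 = idm _ + n1 by rewrite /n1 [RHS]addrC subrK.
  by rewrite compmDl comp1m nn1 addr0 addrK.
have tc0 : d1 \oc t0 + t1 \oc d0 = idm _.
  rewrite /t1 /t0 compBr compBl -(compA g1) nd0 addrACA -opprD !compA -compmDl.
  have -> : d1 \oc g0 + g1 \oc d0 = idm _ + n0 by rewrite /n0 [RHS]addrC subrK.
  by rewrite compmDl comp1m nn0 addr0 addrK.
have ti1 : t1 \oc i1 = i0 \oc s1' by rewrite /t1 compBl -compA ni1 compm0 subr0.
have ti0 : t0 \oc i0 = i1 \oc s0' by rewrite /t0 compBl -compA ni0 compm0 subr0.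
have pt1 : p0 \oc t1 = s1'' \oc p1.
  by rewrite /t1 compBr compA pg1 -compA pn1 compm0 subr0.
have pt0 : p1 \oc t0 = s0'' \oc p0.
  by rewrite /t0 compBr compA pg0 -compA pn0 compm0 subr0.
have dtd1 : d1 \oc (t0 \oc d1) = d1.
  by rewrite -[RHS]compm1 -tc1 compmDr !compA d10 comp0m add0r.
have dtd0 : d0 \oc (t1 \oc d0) = d0.
  by rewrite -[RHS]compm1 -tc0 compmDr !compA d01 comp0m add0r.
(* From [d t = 1 - t d] it follows that [d] commutes with [t^2]; moving it across, the square of
   [t d t] acquires a factor [d^2]. *)
have tt1 : d1 \oc (t0 \oc t1) = t1 \oc (t0 \oc d1).
  have e1 : d1 \oc t0 = idm _ - t1 \oc d0 by rewrite -tc0 addrK.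
  have e2 : t0 \oc d1 = idm _ - d0 \oc t1 by rewrite -tc1 addrAC subrr add0r.
  by rewrite compA e1 e2 compBl compBr comp1m compm1 !compA.
have tt0 : d0 \oc (t1 \oc t0) = t0 \oc (t1 \oc d0).
  have e1 : d0 \oc t1 = idm _ - t0 \oc d1 by rewrite -tc1 addrK.
  have e2 : t1 \oc d0 = idm _ - d1 \oc t0 by rewrite -tc0 addrAC subrr add0r.
  by rewrite compA e1 e2 compBl compBr comp1m compm1 !compA.
exists (t1 \oc (d0 \oc t1)), (t0 \oc (d1 \oc t0)); split.
- split=> //.
  + rewrite -!compA (compA t1 t0) (compA d0 (t1 \oc t0)) tt0 -!compA (compA d0 d1).
    by rewrite d01 comp0m !compm0.
  + rewrite -!compA (compA t0 t1) (compA d1 (t0 \oc t1)) tt1 -!compA (compA d1 d0).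
    by rewrite d10 comp0m !compm0.
  + rewrite (compA t0 d1 t0) (compA d1 (t0 \oc d1)) dtd1.
    by rewrite -(compA t1 _ d0) -(compA d0 t1) dtd0.
  + rewrite (compA t1 d0 t1) (compA d0 (t1 \oc d0)) dtd0.
    by rewrite -(compA t0 _ d1) -(compA d1 t0) dtd1.
- by rewrite -!compA ti1 (compA d0) -id0 !compA ti1 -!compA (pcontraction_sds h').
- by rewrite -!compA ti0 (compA d1) -id1 !compA ti0 -!compA
    (pcontraction_sds (pcontraction_sym h')).
- by rewrite compA pt1 -compA (compA p1) pd0 -!compA pt1 !compA
    -(compA s1'') -!compA (compA d0'') (compA s1'') (pcontraction_sds h'').
- by rewrite compA pt0 -compA (compA p0) pd1 -!compA pt0 !compA
    -(compA s0'') -!compA (compA d1'') (compA s0'') (pcontraction_sds (pcontraction_sym h'')).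
Qed.

End Periodic.

(** * Additivity for short exact sequences of contracted complexes *)

Section Sides.
Variables (M N : exactCategory) (F : exactFunctor M N).
Hypotheses (splM : split_exact M) (splN : split_exact N) (cofF : cofinal F).

(* The odd part [F P (+) A] and even part [F Q (+) B] of the total complex of
   a mapping cone, with a contraction. *)
Record side (A B : N) := Side {
  sP : M;
  sQ : M;
  sd1 : hom (bip (F sP) A) (bip (F sQ) B);
  sd0 : hom (bip (F sQ) B) (bip (F sP) A);
  ss1 : hom (bip (F sP) A) (bip (F sQ) B);
  ss0 : hom (bip (F sQ) B) (bip (F sP) A);
  sideP : pcontraction sd1 sd0 ss1 ss0
}.

Definition sdelta (A B : N) (k : complement F A) (X Y : side A B) : K0Bass F :=
  cdelta k (sd1 X + ss1 X) (sd0 Y + ss0 Y).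

Lemma complement_exists A : exists k : complement F A, True.
Proof.
have [A' [L [c [c' cP]]]] := cofF A.
by exists (Complement (cP : inverses c c')).
Qed.

Lemma cdelta_conj (A B : N) (k : complement F A) P Q P' Q'
    (d1 s1 t1 : hom (bip (F P) A) (bip (F Q) B)) d0 s0 t0
    (b : hom (bip (F P') A) (bip (F Q') B)) b' :
  pcontraction d1 d0 s1 s0 -> pcontraction d1 d0 t1 t0 -> inverses b b' ->
  cdelta k (d1 + t1) b' = cdelta k (d1 + s1) b'.
Proof.
move=> hs ht ib; have [x [y [x' [y' [yx yx' ->]]]]] := pcontraction_conj hs ht.
have ia := pcontraction_inverses hs.
have [v vP] : isom ((d1 + s1) \oc (idm _ + x' \oc y')).
  apply: isomM; last exact: inverses_isom ia.
  by apply: unipotent_isom; rewrite -compA (compA y') yx' comp0m compm0.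
by rewrite (cdelta_precomp cofF k vP ib yx) (cdelta_precomp cofF k ia ib yx').
Qed.

(** [f] and [g] are parameters rather than fields because the top and the bottom of a map of binary
    complexes share them. *)
Record smap (A B A' B' : N) (f : hom A A') (g : hom B B') (X : side A B)
    (Y : side A' B') := SMap {
  mP : hom (sP X) (sP Y);
  mQ : hom (sQ X) (sQ Y);
  mP1 : bip_map (fmap F mQ) g \oc sd1 X = sd1 Y \oc bip_map (fmap F mP) f;
  mP0 : bip_map (fmap F mP) f \oc sd0 X = sd0 Y \oc bip_map (fmap F mQ) g
}.

Definition sses (A1 B1 A B A2 B2 : N) (f : hom A1 A) (g : hom B1 B)
    (f' : hom A A2) (g' : hom B B2) (X1 : side A1 B1) (X : side A B)
    (X2 : side A2 B2) (m : smap f g X1 X) (m' : smap f' g' X X2) : Prop :=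
  conflation (mP m) (mP m') /\ conflation (mQ m) (mQ m').

Record splitting (C : addCategory) (A B D : C) (i : hom A B) (p : hom B D)
    (r : hom B A) (s : hom D B) : Prop := Splitting {
  spl_ri : r \oc i = idm A;
  spl_ps : p \oc s = idm D;
  spl_sum : i \oc r + s \oc p = idm B;
  spl_pi : p \oc i = 0;
  spl_rs : r \oc s = 0
}.

Lemma split_splitting (E : exactCategory) (A B D : E) (i : hom A B) (p : hom B D) :
  split_exact E -> conflation i p -> exists r s, splitting i p r s.
Proof.
move=> spl ip; have [r [s [ri ps irsp]]] := spl _ _ _ _ _ ip; exists r, s.
by have [rs pi] := splitting_orthogonal ri ps irsp; split.
Qed.

Lemma splitting_bip (C : addCategory) (A B D A' B' D' : C) (i : hom A B) (p : hom B D)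
    r s (i' : hom A' B') (p' : hom B' D') r' s' :
  splitting i p r s -> splitting i' p' r' s' ->
  splitting (bip_map i i') (bip_map p p') (bip_map r r') (bip_map s s').
Proof.
case=> a b c d e [a' b' c' d' e']; split; rewrite !bip_map_comp.
- by rewrite a a' bip_map1.
- by rewrite b b' bip_map1.
- by rewrite bip_mapD c c' bip_map1.
- by rewrite d d' /bip_map !comp0m bip_in0.
- by rewrite e e' /bip_map !comp0m bip_in0.
Qed.

Lemma splitting_fmap (A B D : M) (i : hom A B) (p : hom B D) r s :
  splitting i p r s -> splitting (fmap F i) (fmap F p) (fmap F r) (fmap F s).
Proof.
case=> a b c d e; split; rewrite -?fmapM ?a ?b ?d ?e ?fmap1 ?fmap0 //.
by rewrite -fmapD c fmap1.
Qed.

Section ComplementExtension.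
Variables (A1 A A2 : N) (f : hom A1 A) (f' : hom A A2).
Variables (r : hom A A1) (s : hom A2 A).
Hypothesis fP : splitting f f' r s.
Variables (k1 : complement F A1) (k2 : complement F A2).

(** A splitting of [A] into [A1] and [A2] makes the sum of the two complements a complement of [A],
    with the compatibility that [cdelta_ses] asks for. *)
Definition comp_ext_c :
    hom (bip A (bip (comp_A k1) (comp_A k2))) (F (bip (comp_L k1) (comp_L k2))) :=
  fbip_in (comp_c k1 \oc bip_map r (pr1 _ _)) (comp_c k2 \oc bip_map f' (pr2 _ _)).

Definition comp_ext_c' :
    hom (F (bip (comp_L k1) (comp_L k2))) (bip A (bip (comp_A k1) (comp_A k2))) :=
  bip_map f (in1 _ _) \oc (comp_c' k1 \oc fmap F (pr1 _ _))
  + bip_map s (in2 _ _) \oc (comp_c' k2 \oc fmap F (pr2 _ _)).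

Lemma comp_ext_inverses : inverses comp_ext_c comp_ext_c'.
Proof.
have [c1 d1] := comp_cP k1; have [c2 d2] := comp_cP k2.
have [ri ps irsp pi rs] := fP; rewrite /comp_ext_c /comp_ext_c'; split.
  rewrite compmDl -!compA fpr1_in fpr2_in !(compA (comp_c' _)) c1 c2 !comp1m.
  by rewrite !bip_map_comp bip_mapD irsp bipE bip_map1.
have z0 (X Y X' Y' : N) : bip_map (0 : hom X Y) (0 : hom X' Y') = 0.
  by rewrite /bip_map !comp0m bip_in0.
rewrite fbip_in_comp -!(compA (comp_c _)) !(compmDr (bip_map _ _)).
rewrite !(compA (bip_map _ _) (bip_map _ _)) !bip_map_comp ri ps pi rs pr1in1 pr2in2 pr1in2 pr2in1 !z0 !bip_map1.
rewrite !comp0m !comp1m addr0 add0r !(compA (comp_c _)) d1 d2 !comp1m.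
by rewrite -[RHS]fbip_in_eta !compm1.
Qed.

Definition comp_ext : complement F A := Complement comp_ext_inverses.

Lemma comp_ext_in :
  fmap F (in1 _ _) \oc comp_c k1 = comp_c comp_ext \oc bip_map f (in1 _ _).
Proof.
have [ri ps irsp pi rs] := fP.
rewrite /= /comp_ext_c fbip_in_comp -!compA !bip_map_comp ri pi pr1in1 pr2in1 bip_map1.
by rewrite /bip_map !comp0m bip_in0 compm0 compm1 /fbip_in compm0 addr0.
Qed.

Lemma comp_ext_pr :
  fmap F (pr2 _ _) \oc comp_c comp_ext = comp_c k2 \oc bip_map f' (pr2 _ _).
Proof. exact: fpr2_in. Qed.

End ComplementExtension.

Lemma sside_extend (A1 B1 A B A2 B2 : N) (f : hom A1 A) (g : hom B1 B)
    (f' : hom A A2) (g' : hom B B2) (X1 : side A1 B1) (X : side A B)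
    (X2 : side A2 B2) (m : smap f g X1 X) (m' : smap f' g' X X2) :
  conflation f f' -> conflation g g' -> sses m m' ->
  exists t1 t0, [/\ pcontraction (sd1 X) (sd0 X) t1 t0,
    bip_map (fmap F (mQ m)) g \oc (sd1 X1 + ss1 X1)
      = (sd1 X + t1) \oc bip_map (fmap F (mP m)) f
    & bip_map (fmap F (mQ m')) g' \oc (sd1 X + t1)
      = (sd1 X2 + ss1 X2) \oc bip_map (fmap F (mP m')) f'].
Proof.
move=> /(split_splitting splN)[rA [sA fS]] /(split_splitting splN)[rB [sB gS]].
move=> [/(split_splitting splM)[rP [s_P PS]] /(split_splitting splM)[rQ [s_Q QS]]].
have [e1 e2 e3 e4 e5] := splitting_bip (splitting_fmap PS) fS.
have [h1 h2 h3 h4 h5] := splitting_bip (splitting_fmap QS) gS.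
have := pcontraction_extend (pd10 (sideP X)) (pd01 (sideP X)) (sideP X1) (sideP X2)
  (mP1 m) (mP0 m) (mP1 m') (mP0 m') h1 e1 h2 e2 h3 e3 h4 e4.
move=> [t1 [t0 [tP i1 i0 p1 p0]]]; exists t1, t0; split=> //.
  by rewrite compmDr compmDl (mP1 m) i1.
by rewrite compmDr compmDl (mP1 m') p1.
Qed.

(** The contractions and complements carried by the three terms are unrelated. Those of the middle
    term are exchanged, without changing the class, for ones that restrict to the subobject and
    induce those of the quotient. *)
Lemma sdelta_ses (A1 B1 A B A2 B2 : N) (f : hom A1 A) (g : hom B1 B)
    (f' : hom A A2) (g' : hom B B2)
    (X1 Y1 : side A1 B1) (X Y : side A B) (X2 Y2 : side A2 B2)
    (m : smap f g X1 X) (m' : smap f' g' X X2)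
    (n : smap f g Y1 Y) (n' : smap f' g' Y Y2) k k1 k2 :
  conflation f f' -> conflation g g' -> sses m m' -> sses n n' ->
  sdelta k X Y = sdelta k1 X1 Y1 + sdelta k2 X2 Y2.
Proof.
move=> cf cg cm cn.
have [t1 [t0 [tP ti tp]]] := sside_extend cf cg cm.
have [u1 [u0 [uP ui up]]] := sside_extend cf cg cn.
have iX1 := pcontraction_inverses (sideP X1); have iX2 := pcontraction_inverses (sideP X2).
have iY1 := pcontraction_inverses (sideP Y1); have iY2 := pcontraction_inverses (sideP Y2).
have iX := pcontraction_inverses (sideP X); have iY := pcontraction_inverses (sideP Y).
have it := pcontraction_inverses tP; have iu := pcontraction_inverses uP.
have [r [s fS]] := split_splitting splN cf.
(* [cdelta_conj] changes the contraction in the first argument only; antisymmetry brings the second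
   one there. *)
rewrite /sdelta -(cdelta_conj k (sideP X) tP iY) -[LHS]opprK -(cdelta_sym k it iY).
rewrite -(cdelta_conj k (sideP Y) uP it) (cdelta_sym k it iu) opprK.
rewrite (cdelta_indep splM it iu k (comp_ext fS k1 k2)).
case: cm cn => cP cQ [cP' cQ'].
exact: (cdelta_ses (k := comp_ext fS k1 k2) splM it iu iX1 iY1 iX2 iY2 cP cQ cP' cQ'
  (conflation_in1_pr2 (comp_L k1) (comp_L k2)) (comp_ext_in fS k1 k2) (comp_ext_pr fS k1 k2) ti ui tp up).
Qed.

End Sides.

(** Doubling that computes: [dbl k.+1] reduces to [(dbl k).+2], so that differentials between even
    and odd degrees are well typed without casts. *)
Fixpoint dbl k : nat := if k is m.+1 then (dbl m).+2 else 0.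

Lemma leq_dbl k : (k <= dbl k)%N.
Proof. by elim: k => [//|k IH] /=; rewrite ltnS leqW. Qed.

(** * Finite biproducts of bounded families *)

Section BoundedSums.
Variable C : addCategory.

(** The family is indexed by all of [nat]; [bsum1] forces [X k] to be zero from [bbnd_] on. The sum
    is data and not a fixed construction, so that for a complex in degree 0 it can be the object
    itself. *)
Record bsum (X : nat -> C) := BSum {
  bT : C;
  binj : forall k, hom (X k) bT;
  bproj : forall k, hom bT (X k);
  bbnd_ : nat;
  bproj_inj : forall k, bproj k \oc binj k = idm (X k);
  bproj_inj0 : forall k l, k != l -> bproj k \oc binj l = 0;
  bsum1 : \sum_(k < bbnd_) (binj k \oc bproj k) = idm bT
}.

Lemma comp_sumr (A B D : C) n (g : hom B D) (f : 'I_n -> hom A B) :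
  g \oc (\sum_i f i) = \sum_i (g \oc f i).
Proof.
by elim/big_ind2: _ => [|x1 x2 y1 y2 <- <-|//]; rewrite ?compm0 ?compmDr.
Qed.

Lemma comp_suml (A B D : C) n (g : 'I_n -> hom B D) (f : hom A B) :
  (\sum_i g i) \oc f = \sum_i (g i \oc f).
Proof.
by elim/big_ind2: _ => [|x1 x2 y1 y2 <- <-|//]; rewrite ?comp0m ?compmDl.
Qed.

Lemma bsum_exists (X : nat -> C) b :
  (forall n, (b <= n)%N -> zero_object (X n)) -> exists S : bsum X, True.
Proof.
elim: b X => [|b IH] X X0.
  have p k : (0 : hom (zob : C) (X k)) \oc (0 : hom (X k) zob) = idm (X k).
    by apply: zero_object_in; exact: X0.
  unshelve eexists (@BSum X zob (fun k => 0) (fun k => 0) 0 p _ _) => //.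
    by move=> k l _; exact: comp0m.
  by rewrite big_ord0; apply: zero_object_in; exact: zobP.
have [S _] := IH (fun n => X n.+1) (fun n => X0 n.+1).
pose i k : hom (X k) (bip (X 0) (bT S)) :=
  match k return hom (X k) (bip (X 0) (bT S)) with
  | 0 => in1 _ _ | m.+1 => in2 _ _ \oc binj S m end.
pose p k : hom (bip (X 0) (bT S)) (X k) :=
  match k return hom (bip (X 0) (bT S)) (X k) with
  | 0 => pr1 _ _ | m.+1 => bproj S m \oc pr2 _ _ end.
unshelve eexists (@BSum X (bip (X 0) (bT S)) i p (bbnd_ S).+1 _ _ _) => //.
- case=> [|k] /=; first exact: pr1in1.
  by rewrite -compA (compA (pr2 _ _)) pr2in2 comp1m bproj_inj.
- case=> [|k] [|l] //= kl.
  + by rewrite compA pr1in2 comp0m.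
  + by rewrite -compA pr2in1 compm0.
  + by rewrite -compA (compA (pr2 _ _)) pr2in2 comp1m bproj_inj0.
- rewrite big_ord_recl /= -[RHS]bipE; congr (_ + _).
  rewrite -[pr2 _ _ in RHS]comp1m -(bsum1 S) comp_suml comp_sumr.
  by apply: eq_bigr => k _; rewrite !compA.
Qed.

Section OneSum.
Variables (X : nat -> C) (S : bsum X).

Definition bdesc Y (g : forall k, hom (X k) Y) : hom (bT S) Y :=
  \sum_(k < bbnd_ S) (g k \oc bproj S k).

Lemma bdescE Y (g : forall k, hom (X k) Y) k : bdesc g \oc binj S k = g k.
Proof.
rewrite /bdesc comp_suml; case: (ltnP k (bbnd_ S)) => [kb|bk].
  rewrite (bigD1 (Ordinal kb)) //= -compA bproj_inj compm1 big1 ?addr0 // => l lk.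
  by rewrite -compA bproj_inj0 ?compm0 //; apply: contra_neq lk => lk; exact: val_inj.
have i0 : binj S k = 0.
  rewrite -[binj S k]comp1m -(bsum1 S) comp_suml big1 // => l _.
  rewrite -compA bproj_inj0 ?compm0 //; apply: contraTneq bk => <-.
  by rewrite -ltnNge.
have k0 : zero_object (X k).
  by apply/zero_objectP; rewrite -(bproj_inj S k) i0 compm0.
exact: zero_object_out.
Qed.

Lemma bsum_ext Y (f g : hom (bT S) Y) :
  (forall k, f \oc binj S k = g \oc binj S k) -> f = g.
Proof.
move=> fg; rewrite -[f]compm1 -[g]compm1 -(bsum1 S) !comp_sumr.
by apply: eq_bigr => k _; rewrite !compA fg.
Qed.

End OneSum.

Definition bmapsum (X Y : nat -> C) (S : bsum X) (T : bsum Y)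
    (f : forall k, hom (X k) (Y k)) : hom (bT S) (bT T) :=
  bdesc S (fun k => binj T k \oc f k).

Lemma bmapsumE (X Y : nat -> C) (S : bsum X) (T : bsum Y)
    (f : forall k, hom (X k) (Y k)) k :
  bmapsum S T f \oc binj S k = binj T k \oc f k.
Proof. exact: bdescE. Qed.

Definition bsum_bip (X Y : nat -> C) (S : bsum X) (T : bsum Y) :
  bsum (fun k => bip (X k) (Y k)).
Proof.
exists (bip (bT S) (bT T)) (fun k => bip_map (binj S k) (binj T k))
  (fun k => bip_map (bproj S k) (bproj T k)) (maxn (bbnd_ S) (bbnd_ T)).
- by move=> k; rewrite bip_map_comp !bproj_inj bip_map1.
- by move=> k l kl; rewrite bip_map_comp !bproj_inj0 // /bip_map !comp0m bip_in0.
have widen (Z : nat -> C) (U : bsum Z) m : (bbnd_ U <= m)%N ->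
    \sum_(k < m) (binj U k \oc bproj U k) = idm (bT U).
  move=> bm; rewrite -(bsum1 U) [RHS](big_ord_widen _ (fun k => binj U k \oc bproj U k) bm).
  rewrite [RHS]big_mkcond; apply: eq_bigr => k _; case: ltnP => // bk.
  have -> : binj U k = 0.
    rewrite -[binj U k]comp1m -(bsum1 U) comp_suml big1 // => l _.
    rewrite -compA bproj_inj0 ?compm0 //; apply: contraTneq bk => <-.
    by rewrite -ltnNge.
  exact: comp0m.
rewrite -bip_map1 -(widen _ S _ (leq_maxl _ (bbnd_ T))).
rewrite -(widen _ T _ (leq_maxr (bbnd_ S) _)).
rewrite (eq_bigr (fun k : 'I__ => bip_map (binj S k \oc bproj S k) (binj T k \oc bproj T k))); last first.
  by move=> k _; rewrite bip_map_comp.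
elim/big_rec3: _ => [|k x y z _ ->]; last by rewrite bip_mapD.
by rewrite /bip_map !comp0m bip_in0.
Defined.

End BoundedSums.

Definition fbsum (C D : addCategory) (F : addFunctor C D) (X : nat -> C) (S : bsum X) :
  bsum (fun k => F (X k)).
Proof.
exists (F (bT S)) (fun k => fmap F (binj S k)) (fun k => fmap F (bproj S k)) (bbnd_ S).
- by move=> k; rewrite -fmapM bproj_inj fmap1.
- by move=> k l kl; rewrite -fmapM bproj_inj0 // fmap0.
- rewrite -fmap1 -(bsum1 S).
  elim: (bbnd_ S) => [|n IH]; first by rewrite !big_ord0 fmap0.
  by rewrite !big_ord_recr /= fmapD fmapM IH.
Defined.

Lemma bmapsum_conflation (E : exactCategory) (X Y Z : nat -> E) (S : bsum X)
    (T : bsum Y) (U : bsum Z) (f : forall k, hom (X k) (Y k))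
    (g : forall k, hom (Y k) (Z k)) :
  split_exact E -> (forall k, conflation (f k) (g k)) ->
  conflation (bmapsum S T f) (bmapsum T U g).
Proof.
move=> spl fg.
have /dep_choice[r /dep_choice[s rsP]] k : exists r s, splitting (f k) (g k) r s.
  exact: split_splitting.
apply: (split_conflation (r := bmapsum T S r) (s := bmapsum U T s)).
- apply: bsum_ext => k; have [ri _ _ _ _] := rsP k.
  by rewrite -compA bmapsumE compA bmapsumE -compA ri compm1 comp1m.
- apply: bsum_ext => k; have [_ ps _ _ _] := rsP k.
  by rewrite -compA bmapsumE compA bmapsumE -compA ps compm1 comp1m.
- apply: bsum_ext => k; have [_ _ h _ _] := rsP k.
  rewrite compmDl -!compA !bmapsumE !(compA (bmapsum _ _ _)) !bmapsumE -!compA.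
  by rewrite -compmDr h compm1 comp1m.
Qed.

(** * The even and odd parts of a mapping cone *)

Section TotalSide.
Variables (M N : exactCategory) (F : exactFunctor M N).

Section OneCone.
Variables (X : cplx M) (Y : cplx N) (u : chmap (map_cplx F X) Y).
Variables (SP : bsum (fun k => X (dbl k))) (SQ : bsum (fun k => X (dbl k).+1)).
Variables (SB : bsum (fun k => Y (dbl k))) (SA : bsum (fun k => Y (dbl k).+1)).

Definition bsum1_cone : bsum (fun k => cone u (dbl k).+1) :=
  @bsum_bip N (fun k => F (X (dbl k))) (fun k => Y (dbl k).+1)
    (@fbsum M N F _ SP) SA.

(** Degree 0 of the cone is [Y 0] alone, and degree [dbl m.+1] pairs [X] in degree [(dbl m).+1] with
    [Y] in degree [dbl m.+1]. The indices of [SQ] and [SB] are thus off by one, and the even part is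
    no instance of [bsum_bip]. *)
Definition inj0_cone k : hom (cone u (dbl k)) (bip (F (bT SQ)) (bT SB)) :=
  match k return hom (cone u (dbl k)) (bip (F (bT SQ)) (bT SB)) with
  | 0 => in2 _ _ \oc binj SB 0
  | m.+1 => bip_map (fmap F (binj SQ m)) (binj SB m.+1)
  end.

Lemma ext0_cone Z (f g : hom (bip (F (bT SQ)) (bT SB)) Z) :
  (forall k, f \oc inj0_cone k = g \oc inj0_cone k) -> f = g.
Proof.
move=> fg; apply: bip_ext_out.
  apply: (@bsum_ext _ _ (@fbsum M N F _ SQ)) => k /=.
  have := congr1 (fun h => h \oc in1 _ _) (fg k.+1); rewrite /= -!compA.
  rewrite bip_map_in1.
  by rewrite !compA.
apply: (@bsum_ext _ _ SB) => -[|k]; first by rewrite -!compA; exact: (fg 0).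
have := congr1 (fun h => h \oc in2 _ _) (fg k.+1); rewrite /= -!compA.
rewrite bip_map_in2.
by [].
Qed.

Definition desc0_cone Z (g : forall k, hom (cone u (dbl k)) Z) :
    hom (bip (F (bT SQ)) (bT SB)) Z :=
  bip_out (bdesc (@fbsum M N F _ SQ) (fun k => g k.+1 \oc in1 _ _))
    (bdesc SB (fun k => match k return hom (Y (dbl k)) Z with
       | 0 => g 0 | m.+1 => g m.+1 \oc in2 _ _ end)).

Lemma desc0_coneE Z (g : forall k, hom (cone u (dbl k)) Z) k :
  desc0_cone g \oc inj0_cone k = g k.
Proof.
case: k => [|k] /=; first by rewrite compA bip_out_in2; exact: (bdescE SB _ 0).
apply: bip_ext_out; rewrite -compA.
  rewrite bip_map_in1.
  by rewrite compA bip_out_in1; exact: (bdescE (fbsum F SQ)).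
rewrite bip_map_in2.
by rewrite compA bip_out_in2; exact: (bdescE SB _ k.+1).
Qed.

Definition tot_d1 : hom (bip (F (bT SP)) (bT SA)) (bip (F (bT SQ)) (bT SB)) :=
  bdesc bsum1_cone (fun k => inj0_cone k \oc cd (cone u) (dbl k)).

Definition tot_d0 : hom (bip (F (bT SQ)) (bT SB)) (bip (F (bT SP)) (bT SA)) :=
  desc0_cone (fun k => match k
    return hom (cone u (dbl k)) (bip (F (bT SP)) (bT SA)) with
    | 0 => 0 | m.+1 => binj bsum1_cone m \oc cd (cone u) (dbl m).+1 end).

Variable s : forall n, hom (cone u n) (cone u n.+1).
Hypothesis sc : contraction s.

Definition tot_s1 : hom (bip (F (bT SP)) (bT SA)) (bip (F (bT SQ)) (bT SB)) :=
  bdesc bsum1_cone (fun k => inj0_cone k.+1 \oc s (dbl k).+1).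

Definition tot_s0 : hom (bip (F (bT SQ)) (bT SB)) (bip (F (bT SP)) (bT SA)) :=
  desc0_cone (fun k => binj bsum1_cone k \oc s (dbl k)).

Lemma tot_d1E k : tot_d1 \oc binj bsum1_cone k = inj0_cone k \oc cd (cone u) (dbl k).
Proof. exact: (bdescE bsum1_cone (fun k => inj0_cone k \oc cd (cone u) (dbl k)) k). Qed.

Lemma tot_d0E k : tot_d0 \oc inj0_cone k.+1 = binj bsum1_cone k \oc cd (cone u) (dbl k).+1.
Proof. exact: (desc0_coneE _ k.+1). Qed.

Lemma tot_d00 : tot_d0 \oc inj0_cone 0 = 0.
Proof. exact: (desc0_coneE _ 0). Qed.

Lemma tot_s1E k : tot_s1 \oc binj bsum1_cone k = inj0_cone k.+1 \oc s (dbl k).+1.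
Proof. exact: (bdescE bsum1_cone (fun k => inj0_cone k.+1 \oc s (dbl k).+1) k). Qed.

Lemma tot_s0E k : tot_s0 \oc inj0_cone k = binj bsum1_cone k \oc s (dbl k).
Proof. exact: desc0_coneE. Qed.

Lemma tot_pcontraction : pcontraction tot_d1 tot_d0 tot_s1 tot_s0.
Proof.
have [sc0 scS scq] := sc; split.
- apply: ext0_cone => -[|k]; rewrite comp0m -compA ?tot_d00 ?compm0 //.
  by rewrite tot_d0E compA tot_d1E -compA (cdd (cone u)) compm0.
- apply: (@bsum_ext _ _ bsum1_cone) => -[|k]; rewrite comp0m -compA tot_d1E compA.
    by rewrite tot_d00 comp0m.
  by rewrite tot_d0E -compA (cdd (cone u)) compm0.
- apply: ext0_cone => k; rewrite comp0m -compA tot_s0E compA tot_s1E -compA.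
  by rewrite scq compm0.
- apply: (@bsum_ext _ _ bsum1_cone) => k; rewrite comp0m -compA tot_s1E compA.
  by rewrite tot_s0E -compA scq compm0.
- apply: ext0_cone => -[|k]; rewrite compmDl comp1m -!compA tot_s0E (compA tot_d1) tot_d1E.
    by rewrite tot_d00 compm0 addr0 -compA sc0 compm1.
  by rewrite tot_d0E (compA tot_s1) tot_s1E -!compA -compmDr (scS (dbl k).+1) compm1.
- apply: (@bsum_ext _ _ bsum1_cone) => k; rewrite compmDl comp1m -!compA tot_s1E tot_d1E.
  rewrite (compA tot_d0) tot_d0E (compA tot_s0) tot_s0E -!compA -compmDr.
  by rewrite (scS (dbl k)) compm1.
Qed.

Definition side_of : side F (bT SA) (bT SB) :=
  @Side _ _ F (bT SA) (bT SB) (bT SP) (bT SQ) _ _ _ _ tot_pcontraction.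

End OneCone.

Section ConeMap.
Variables (X X' : cplx M) (Y Y' : cplx N).
Variables (u : chmap (map_cplx F X) Y) (u' : chmap (map_cplx F X') Y').
Variables (f : chmap X X') (g : chmap Y Y').
Hypothesis gu : forall n, g n \oc u n = u' n \oc fmap F (f n).
Variables (SP : bsum (fun k => X (dbl k))) (SQ : bsum (fun k => X (dbl k).+1)).
Variables (SB : bsum (fun k => Y (dbl k))) (SA : bsum (fun k => Y (dbl k).+1)).
Variables (SP' : bsum (fun k => X' (dbl k))) (SQ' : bsum (fun k => X' (dbl k).+1)).
Variables (SB' : bsum (fun k => Y' (dbl k))) (SA' : bsum (fun k => Y' (dbl k).+1)).

Definition cone_fun n : hom (cone u n) (cone u' n) :=
  match n return hom (cone u n) (cone u' n) with
  | 0 => g 0 | m.+1 => bip_map (fmap F (f m)) (g m.+1) end.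

Lemma cone_funP n : cone_fun n \oc cd (cone u) n = cd (cone u') n \oc cone_fun n.+1.
Proof.
have key m : g m \oc bip_out (u m) (cd Y m)
    = bip_out (u' m) (cd Y' m) \oc bip_map (fmap F (f m)) (g m.+1).
  by rewrite comp_bip_out gu cmapP /bip_map bip_out_in /bip_out !compA.
case: n => [|n] /=; first exact: key.
rewrite bip_map_in key bip_in_comp; congr bip_in.
rewrite comp_bip_out /bip_map bip_out_in compm0 comp0m addr0 /bip_out comp0m addr0.
by rewrite compmN !compNm -!fmapM cmapP fmapM !compA.
Qed.

Definition tot_P := bmapsum SP SP' (fun k => f (dbl k)).
Definition tot_Q := bmapsum SQ SQ' (fun k => f (dbl k).+1).
Definition tot_B := bmapsum SB SB' (fun k => g (dbl k)).
Definition tot_A := bmapsum SA SA' (fun k => g (dbl k).+1).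

Lemma tot_PE k : tot_P \oc binj SP k = binj SP' k \oc f (dbl k).
Proof. exact: (bmapsumE SP SP' (fun k => f (dbl k))). Qed.

Lemma tot_QE k : tot_Q \oc binj SQ k = binj SQ' k \oc f (dbl k).+1.
Proof. exact: (bmapsumE SQ SQ' (fun k => f (dbl k).+1)). Qed.

Lemma tot_BE k : tot_B \oc binj SB k = binj SB' k \oc g (dbl k).
Proof. exact: (bmapsumE SB SB' (fun k => g (dbl k))). Qed.

Lemma tot_AE k : tot_A \oc binj SA k = binj SA' k \oc g (dbl k).+1.
Proof. exact: (bmapsumE SA SA' (fun k => g (dbl k).+1)). Qed.

Lemma tot_map1 k :
  bip_map (fmap F tot_P) tot_A \oc binj (bsum1_cone u SP SA) k
  = binj (bsum1_cone u' SP' SA') k \oc cone_fun (dbl k).+1.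
Proof. by rewrite /= !bip_map_comp -!fmapM tot_PE tot_AE. Qed.

Lemma tot_map0 k :
  bip_map (fmap F tot_Q) tot_B \oc inj0_cone u SQ SB k
  = inj0_cone u' SQ' SB' k \oc cone_fun (dbl k).
Proof.
case: k => [|k] /=; last by rewrite !bip_map_comp -!fmapM tot_QE (tot_BE k.+1).
rewrite compA !in2E bip_map_in !bip_in_comp compm0 compm1 !comp0m !comp1m.
by rewrite (tot_BE 0).
Qed.

Variables (s : forall n, hom (cone u n) (cone u n.+1)).
Variables (s' : forall n, hom (cone u' n) (cone u' n.+1)).
Hypotheses (sc : contraction s) (sc' : contraction s').

Definition tot_smap :
  smap tot_A tot_B (side_of SP SQ SB SA sc) (side_of SP' SQ' SB' SA' sc').
Proof.
exists tot_P tot_Q.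
- apply: (@bsum_ext _ _ (bsum1_cone u SP SA)) => k.
  rewrite -[LHS]compA tot_d1E compA tot_map0 -compA cone_funP.
  by rewrite -[RHS]compA tot_map1 (compA (tot_d1 _ _ _ _ _)) tot_d1E -compA.
- apply: (@ext0_cone _ _ u SQ SB) => -[|k].
    by rewrite -[LHS]compA tot_d00 compm0 -[RHS]compA tot_map0 compA tot_d00 comp0m.
  rewrite -[LHS]compA tot_d0E compA tot_map1 -compA cone_funP.
  by rewrite -[RHS]compA tot_map0 (compA (tot_d0 _ _ _ _ _)) tot_d0E -compA.
Defined.

End ConeMap.
End TotalSide.

(** * From Grayson's group to Bass's group *)

Definition bmap0 (A : addCategory) (X Y : bcplx A) : bmap X Y.
Proof. by exists (fun _ => 0) => n; rewrite compm0 comp0m. Defined.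

Section Theta.
Variables (M N : exactCategory) (F : exactFunctor M N).
Hypotheses (splM : split_exact M) (splN : split_exact N) (cofF : cofinal F).

(** All choices are quantified here. The sums [SB] and [SA] and the complement are common to top and
    bottom; the sums in [M] and the contractions are not. *)
Definition theta_rel (X : BF F) (v : K0Bass F) : Prop :=
  exists (SP : bsum (fun k => BF_Mtop X (dbl k)))
    (SQ : bsum (fun k => BF_Mtop X (dbl k).+1))
    (SP' : bsum (fun k => BF_Mbot X (dbl k)))
    (SQ' : bsum (fun k => BF_Mbot X (dbl k).+1))
    (SB : bsum (fun k => BF_N X (dbl k))) (SA : bsum (fun k => BF_N X (dbl k).+1))
    (s : forall n, hom (cone (BF_utop X) n) (cone (BF_utop X) n.+1))
    (s' : forall n, hom (cone (BF_ubot X) n) (cone (BF_ubot X) n.+1))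
    (sc : contraction s) (sc' : contraction s') (k : complement F (bT SA)),
  v = sdelta k (@side_of _ _ _ _ (top (BF_N X)) _ SP SQ SB SA _ sc)
               (@side_of _ _ _ _ (bot (BF_N X)) _ SP' SQ' SB SA _ sc').

Lemma bsum_even_odd (C : addCategory) (X : nat -> C) :
  (exists b : nat, forall n, (b <= n)%N -> zero_object (X n)) ->
  exists (S : bsum (fun k => X (dbl k))) (S' : bsum (fun k => X (dbl k).+1)), True.
Proof.
move=> [b X0].
have [S _] := @bsum_exists C (fun k => X (dbl k)) b
  (fun n bn => X0 _ (leq_trans bn (leq_dbl n))).
have [S' _] := @bsum_exists C (fun k => X (dbl k).+1) b
  (fun n bn => X0 _ (leq_trans bn (leqW (leq_dbl n)))).
by exists S, S'.
Qed.

Lemma theta_exists X : exists v, theta_rel X v.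
Proof.
have [SP [SQ _]] := bsum_even_odd (cbnd (BF_Mtop X)).
have [SP' [SQ' _]] := bsum_even_odd (cbnd (BF_Mbot X)).
have [SB [SA _]] := bsum_even_odd (bbnd (BF_N X)).
have [s sc] := acyclic_contraction splN (BF_utopP X).
have [s' sc'] := acyclic_contraction splN (BF_ubotP X).
have [k _] := complement_exists cofF (bT SA).
by eexists; exists SP, SQ, SP', SQ', SB, SA, s, s', sc, sc', k.
Qed.

Lemma theta_rel_ses (X Y Z : BF F) (f : hom X Y) (g : hom Y Z) x y z :
  ses f g -> theta_rel X x -> theta_rel Y y -> theta_rel Z z -> y = x + z.
Proof.
move=> [ct cb cp].
move=> [SP1 [SQ1 [TP1 [TQ1 [SB1 [SA1 [s1 [t1 [sc1 [tc1 [k1 ->]]]]]]]]]]].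
move=> [SP [SQ [TP [TQ [SB [SA [s [t [sc [tc [k ->]]]]]]]]]]].
move=> [SP2 [SQ2 [TP2 [TQ2 [SB2 [SA2 [s2 [t2 [sc2 [tc2 [k2 ->]]]]]]]]]]].
apply: (sdelta_ses splM splN cofF
  (m := @tot_smap _ _ F _ _ (top (BF_N X)) (top (BF_N Y)) _ _ (BF_phitop f)
     (top_map (BF_psi f)) (BF_mortopP f) SP1 SQ1 SB1 SA1 SP SQ SB SA _ _ sc1 sc)
  (m' := @tot_smap _ _ F _ _ (top (BF_N Y)) (top (BF_N Z)) _ _ (BF_phitop g)
     (top_map (BF_psi g)) (BF_mortopP g) SP SQ SB SA SP2 SQ2 SB2 SA2 _ _ sc sc2)
  (n := @tot_smap _ _ F _ _ (bot (BF_N X)) (bot (BF_N Y)) _ _ (BF_phibot f)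
     (bot_map (BF_psi f)) (BF_morbotP f) TP1 TQ1 SB1 SA1 TP TQ SB SA _ _ tc1 tc)
  (n' := @tot_smap _ _ F _ _ (bot (BF_N Y)) (bot (BF_N Z)) _ _ (BF_phibot g)
     (bot_map (BF_psi g)) (BF_morbotP g) TP TQ SB SA TP2 TQ2 SB2 SA2 _ _ tc tc2)).
- by apply: bmapsum_conflation => // n; exact: cp.
- by apply: bmapsum_conflation => // n; exact: cp.
- by split; apply: bmapsum_conflation => // n; exact: ct.
- by split; apply: bmapsum_conflation => // n; exact: cb.
Qed.

Definition zeroBF : BF F := deg0 (isom1 (F zob)) (isom1 (F zob)).

(** In the sequence [X = X -> 0] the two copies of [X] may carry different choices, so additivity
    compares [x] with [y] up to a value on the zero object. The sequence [0 -> 0 -> 0] shows that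
    this value is zero. *)
Lemma theta_rel_unique X x y : theta_rel X x -> theta_rel X y -> x = y.
Proof.
have F0 : zero_object (F (zob : M)) by apply: (@fmap_zero_object M N F); exact: zobP.
have z0 n : zero_object (conc_ob (zob : M) n) by case: n => *; exact: zobP.
have F0n n : zero_object (conc_ob (F zob) n) by case: n => [//|n]; exact: zobP.
have [f [g fg]] : exists (f : hom X X) (g : hom X zeroBF), ses f g.
  unshelve eexists (@BFMor _ _ F X X (chmap_id _) (chmap_id _) (bmap_id _) _ _),
    (@BFMor _ _ F X zeroBF (chmap0 _ _) (chmap0 _ _) (bmap0 _ _) _ _).
  - by move=> n; rewrite /= fmap1 comp1m compm1.
  - by move=> n; rewrite /= fmap1 comp1m compm1.
  - by move=> n; rewrite /= comp0m fmap0 compm0.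
  - by move=> n; rewrite /= comp0m fmap0 compm0.
  - split=> n; apply: conflation_isom_l; try exact: isom1.
    + exact: z0.
    + exact: z0.
    + exact: F0n.
have [z zP] := theta_exists zeroBF.
have z1 : z = 0.
  have [h [k hk]] : exists (h : hom zeroBF zeroBF) (k : hom zeroBF zeroBF), ses h k.
    exists (idm (zeroBF : BF F)), (idm (zeroBF : BF F)).
    by split=> n; apply: conflation_zero; do ?[exact: z0 | exact: F0n].
  by apply: (addrI z); rewrite addr0; apply/esym; exact: (theta_rel_ses hk zP zP zP).
by move=> xP yP; rewrite (theta_rel_ses fg xP yP zP) z1 addr0.
Qed.

Definition theta (X : BF F) : K0Bass F := projT1 (cid (theta_exists X)).

Lemma thetaP X : theta_rel X (theta X).
Proof. by rewrite /theta; case: cid. Qed.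

Lemma thetaE X x : theta_rel X x -> theta X = x.
Proof. exact: (theta_rel_unique (thetaP X)). Qed.

Lemma theta_ses (X Y Z : BF F) (f : hom X Y) (g : hom Y Z) :
  ses f g -> theta Y = theta X + theta Z.
Proof. by move=> fg; exact: (theta_rel_ses fg (thetaP X) (thetaP Y) (thetaP Z)). Qed.

Lemma theta_Delta (X : CF F) : theta (Delta_ob X) = 0.
Proof.
have [SP [SQ _]] := bsum_even_odd (cbnd (CF_M X)).
have [SB [SA _]] := bsum_even_odd (cbnd (CF_N X)).
have [s sc] := acyclic_contraction splN (BF_utopP (Delta_ob X)).
have [k _] := complement_exists cofF (bT SA).
apply: thetaE; exists SP, SQ, SP, SQ, SB, SA, s, s, sc, sc, k.
apply/esym; apply: cdelta_same.
by apply: pcontraction_inverses; exact: sideP.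
Qed.

End Theta.

(** * The composite on the generators of Bass's group *)

Section ThetaPsi.
Variables (M N : exactCategory) (F : exactFunctor M N).
Hypotheses (splM : split_exact M) (splN : split_exact N) (cofF : cofinal F).

(** Naturality in the source [P] compares the left side with the difference of [b] with itself,
    which is zero; the class of [c] is what remains. *)
Lemma cdelta_ratio (A : N) (k : complement F A) P P' Q (B : N)
    (b : hom (bip (F P') A) (bip (F Q) B)) b' (c : hom (F P) (F P')) :
  inverses b b' -> isom c -> cdelta k (b \oc bip_map c (idm A)) b' = bcl c.
Proof.
move=> ib ic; have [v vP] : isom (b \oc bip_map c (idm A)).
  by apply: isomM (bip_map_isom ic (isom1 _)) (inverses_isom ib).
have := delta_nat (hat_inverses k ib) (hat_inverses k ib) (hat_inverses k vP)
  (hat_inverses k ib) (fsum_isom ic (isom1 _)) (isom1 _) (isom1 _) (isom1 _)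
  (q := idm _) (q' := idm _) (f := bip_map (idm B) (idm _)) (p' := idm _)
  (hat_nat (f' := idm _) (f := idm A) (l := idm _) (p := c) (q := idm _) (g := idm B)
     _ _).
rewrite !bip_map1 !comp1m !compm1 => /(_ erefl erefl erefl).
rewrite bcl_fsum ?bcl1 ?addr0; last first. exact: isom1. exact: ic.
by rewrite [delta (hat k b) _](cdelta_same k ib) add0r.
Qed.

Definition bsum_conc0 (A : addCategory) (P : A) : bsum (fun k => conc_ob P (dbl k)).
Proof.
exists P
  (fun k => match k return hom (conc_ob P (dbl k)) P with 0 => idm P | _ => 0 end)
  (fun k => match k return hom P (conc_ob P (dbl k)) with 0 => idm P | _ => 0 end) 1.
- case=> [|k]; first exact: comp1m.
  by apply: zero_object_in; exact: zobP.
- by case=> [|k] [|l] //= _; rewrite ?compm0 ?comp0m.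
- by rewrite big_ord_recl big_ord0 addr0 /= comp1m.
Defined.

Definition bsum_conc1 (A : addCategory) (P : A) : bsum (fun k => conc_ob P (dbl k).+1).
Proof.
exists zob (fun k => 0) (fun k => 0) 0.
- by move=> k; apply: zero_object_in; exact: zobP.
- by move=> k l _; exact: comp0m.
- by rewrite big_ord0; apply: zero_object_in; exact: zobP.
Defined.

Lemma bip_map_zero_ext (X A Z B : N) (f g : hom (bip X A) (bip Z B)) :
  zero_object A -> zero_object Z ->
  pr2 Z B \oc f \oc in1 X A = pr2 Z B \oc g \oc in1 X A -> f = g.
Proof.
move=> A0 Z0 fg; apply: bip_ext; first exact: zero_object_in.
by apply: bip_ext_out => //; exact: zero_object_out.
Qed.

(** The contraction contributes nothing here: it maps degree 1 of the cone to degree 2, which is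
    zero. *)
Lemma tot_conc (P : M) (C : N) (a : hom (F P) C)
    (s : forall n, hom (cone (conc_u a) n) (cone (conc_u a) n.+1)) :
  pr2 _ _ \oc (tot_d1 (conc_u a) (bsum_conc0 P) (bsum_conc1 P) (bsum_conc0 C) (bsum_conc1 C)
    + @tot_s1 _ _ F _ _ (conc_u a) (bsum_conc0 P) (bsum_conc1 P) (bsum_conc0 C) (bsum_conc1 C) s)
    \oc in1 _ _ = a.
Proof.
have e : in1 (F P) zob = binj (bsum1_cone (conc_u a) (bsum_conc0 P) (bsum_conc1 C)) 0
    \oc in1 (F P) zob.
  by rewrite /= in1E bip_map_in fmap1 comp1m comp0m.
rewrite [in1 _ _]e compA -(compA (pr2 _ _)) compmDl tot_d1E tot_s1E.
have -> : inj0_cone (conc_u a) (bsum_conc1 P) (bsum_conc0 C) 1 = 0.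
  by rewrite /= fmap0 /bip_map !comp0m bip_in0.
by rewrite comp0m addr0 /= compm1 compA pr2in2 comp1m bip_out_in1.
Qed.

(** With the chosen sums, [N_odd] and [M_odd] are [zob]. The isomorphism of the top is then [a] and
    that of the bottom is [1], up to zero summands, so their ratio is [a]. *)
Lemma theta_Psi (X : co F) : theta splN cofF (Psi F X) = K0Bass_cls X.
Proof.
case: X => P Q a ia; rewrite -bclE.
have [s sc] := acyclic_contraction splN (BF_utopP (Psi_ob (CoOb ia))).
have [s' sc'] := acyclic_contraction splN (BF_ubotP (Psi_ob (CoOb ia))).
have [k _] := complement_exists cofF (zob : N).
apply: (thetaE splM).
exists (bsum_conc0 P), (bsum_conc1 P), (bsum_conc0 Q), (bsum_conc1 Q).
exists (bsum_conc0 (F Q)), (bsum_conc1 (F Q)), s, s', sc, sc', k.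
have ib := pcontraction_inverses (@tot_pcontraction _ _ F _ _ (conc_u (idm (F Q))) (bsum_conc0 Q) (bsum_conc1 Q)
  (bsum_conc0 (F Q)) (bsum_conc1 (F Q)) _ sc').
rewrite -(cdelta_ratio k ib ia); congr cdelta.
apply: bip_map_zero_ext.
- exact: zobP.
- by apply: (@fmap_zero_object M N F zob); exact: zobP.
transitivity a; last exact/esym/(@tot_conc P (F Q) a s).
rewrite (compA (pr2 _ _)) -[LHS]compA bip_map_in1 compA.
by rewrite [X in X \oc _](@tot_conc Q (F Q) (idm _) s') comp1m.
Qed.

End ThetaPsi.

(** * Padding the complexes in [M] by contractible ones *)

Lemma in1_pr1 (C : addCategory) (A B A' B' : C) (f : hom A A') :
  in1 A' B' \oc f \oc pr1 A B = bip_map f 0.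
Proof. by rewrite /bip_map /bip_in comp0m compm0 addr0 compA. Qed.

Section ComplexSum.
Variable A : addCategory.

Definition cs_d (X Y : nat -> A) (dX : forall n, hom (X n.+1) (X n))
    (dY : forall n, hom (Y n.+1) (Y n)) n :
  hom (bip (X n.+1) (Y n.+1)) (bip (X n) (Y n)) := bip_map (dX n) (dY n).

Lemma cs_dd (X Y : nat -> A) (dX : forall n, hom (X n.+1) (X n))
    (dY : forall n, hom (Y n.+1) (Y n)) :
  (forall n, dX n \oc dX n.+1 = 0) -> (forall n, dY n \oc dY n.+1 = 0) ->
  forall n, cs_d dX dY n \oc cs_d dX dY n.+1 = 0.
Proof.
by move=> x0 y0 n; rewrite /cs_d bip_map_comp x0 y0 /bip_map !comp0m bip_in0.
Qed.

Lemma cs_bnd (X Y : nat -> A) :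
  (exists b : nat, forall n, (b <= n)%N -> zero_object (X n)) ->
  (exists b : nat, forall n, (b <= n)%N -> zero_object (Y n)) ->
  exists b : nat, forall n, (b <= n)%N -> zero_object (bip (X n) (Y n)).
Proof.
move=> [b bX] [c cY]; exists (maxn b c) => n; rewrite geq_max => /andP[bn cn].
by apply: zero_object_bip; [exact: bX | exact: cY].
Qed.

Definition cplx_sum (X Y : cplx A) : cplx A :=
  Cplx (cs_dd (@cdd A X) (@cdd A Y)) (cs_bnd (@cbnd A X) (@cbnd A Y)).

Definition bcplx_sum (X Y : bcplx A) : bcplx A :=
  BCplx (cs_dd (@bdd A X) (@bdd A Y)) (cs_dd (@bdd' A X) (@bdd' A Y))
    (cs_bnd (@bbnd A X) (@bbnd A Y)).

Definition cs_in1 (X Y : cplx A) : chmap X (cplx_sum X Y).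
Proof. by exists (fun n => in1 _ _) => n; rewrite /= /cs_d bip_map_in1. Defined.

Definition cs_pr1 (X Y : cplx A) : chmap (cplx_sum X Y) X.
Proof. by exists (fun n => pr1 _ _) => n; rewrite /= /cs_d pr1_map. Defined.

End ComplexSum.

Section Padding.
Variables (M N : exactCategory) (F : exactFunctor M N).
Hypotheses (splN : split_exact N) (hN : supports_long_exact_sequences N).

Definition pad_u (X C : cplx M) (Y : cplx N) (u : chmap (map_cplx F X) Y) :
  chmap (map_cplx F (cplx_sum X C)) Y.
Proof.
exists (fun n => u n \oc fmap F (pr1 (X n) (C n))) => n /=.
have h : u n \oc fmap F (cd X n) = cd Y n \oc u n.+1 := cmapP u n.
by rewrite -compA -fmapM /= /cs_d pr1_map fmapM !compA h.
Defined.

(** The cone of [u] is a retract of the new cone through [j] and [q], and [1 - j q = e] is the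
    projection to the summand [F C]. There [T], which is [- F k], is a null homotopy; the sign is
    that of the cone differential. So [j s q + T] contracts the new cone. *)
Lemma pad_u_quasi_iso (X C : cplx M) (Y : cplx N) (u : chmap (map_cplx F X) Y)
    (k : forall n, hom (C n) (C n.+1)) :
  contraction k -> quasi_iso u -> quasi_iso (pad_u C u).
Proof.
move=> [k0 kS _] /(acyclic_contraction splN)[s [s0 sS _]].
pose v := pad_u C u.
have ju n : chmap_id Y n \oc u n = v n \oc fmap F (cs_in1 X C n).
  by rewrite /= -compA -fmapM pr1in1 fmap1 comp1m compm1.
have qu n : chmap_id Y n \oc v n = u n \oc fmap F (cs_pr1 X C n).
  by rewrite /= comp1m.
pose j := cone_fun u v (cs_in1 X C) (chmap_id Y).
pose q := cone_fun v u (cs_pr1 X C) (chmap_id Y).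
have jP n : j n \oc cd (cone u) n = cd (cone v) n \oc j n.+1 := cone_funP ju n.
have qP n : q n \oc cd (cone v) n = cd (cone u) n \oc q n.+1 := cone_funP qu n.
pose T n : hom (cone v n) (cone v n.+1) :=
  match n return hom (cone v n) (cone v n.+1) with
  | 0 => 0
  | m.+1 => - (in1 _ _ \oc fmap F (in2 (X m.+1) (C m.+1) \oc (k m \oc pr2 (X m) (C m)))
               \oc pr1 _ _)
  end.
pose e n : hom (cone v n) (cone v n) :=
  match n return hom (cone v n) (cone v n) with
  | 0 => 0
  | m.+1 => in1 _ _ \oc fmap F (in2 (X m) (C m) \oc pr2 (X m) (C m)) \oc pr1 _ _
  end.
have jq n : j n \oc q n + e n = idm (cone v n).
  case: n => [|n] /=; first by rewrite comp1m addr0.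
  rewrite bip_map_comp comp1m -fmapM.
  rewrite in1_pr1.
  by rewrite bip_mapD addr0 -fmapD bipE fmap1 bip_map1.
have DT n : cd (cone v) n.+1 \oc T n.+1
    = in1 _ _ \oc fmap F (in2 (X n) (C n) \oc ((cd C n \oc k n) \oc pr2 (X n) (C n)))
      \oc pr1 _ _.
  rewrite /= compmN -!compA (compA _ (in1 _ _)).
  rewrite (bip_in_comp _ _ (in1 _ _)) !bip_out_in1 bip_in_comp -!compA.
  rewrite !(compA (fmap F (pr1 _ _))) -!fmapM (compA (pr1 _ _)) pr1in2.
  rewrite comp0m fmap0 comp0m compm0 compNm bip_inN opprK oppr0.
  rewrite (compA (fmap F (cs_d _ _ _))) -fmapM (compA (cs_d _ _ _)) /cs_d bip_map_in2.
  by rewrite in1E bip_in_comp comp1m comp0m -!compA.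
have TD n : T n.+1 \oc cd (cone v) n.+1
    = in1 _ _ \oc fmap F (in2 (X n.+1) (C n.+1) \oc ((k n \oc cd C n) \oc
        pr2 (X n.+1) (C n.+1))) \oc pr1 _ _.
  rewrite /= compNm -(compA _ (pr1 _ _)) pr1_bip_in /bip_out comp0m addr0 compNm.
  rewrite compmN opprK -!compA; congr (_ \oc _); rewrite !compA; congr (_ \oc _).
  by rewrite -fmapM /cs_d -!compA pr2_map.
have Te n : cd (cone v) n.+1 \oc T n.+1 + T n \oc cd (cone v) n = e n.+1.
  rewrite DT; case: n => [|n]; first by rewrite k0 comp1m comp0m addr0.
  by rewrite TD -compmDl -compmDr -fmapD -compmDr -compmDl kS comp1m.
pose S n := j n.+1 \oc (s n \oc q n) + T n.
have S0 : cd (cone v) 0 \oc S 0 = idm _.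
  rewrite /S compmDr [X in _ + X]compm0 addr0 (compA _ (j 1)) -(jP 0) -!compA.
  by rewrite (compA _ (s 0)) s0 comp1m -(jq 0) [e 0]/(0 : hom _ _) addr0.
have SS n : cd (cone v) n.+1 \oc S n.+1 + S n \oc cd (cone v) n = idm _.
  rewrite /S compmDl compmDr addrACA Te (compA _ (j n.+2)) -(jP n.+1) -!compA (qP n).
  by rewrite (compA (cd _ _)) (compA (s n)) -compmDr -compmDl sS comp1m jq.
exact: (contractible_acyclic hN S0 SS).
Qed.

End Padding.

Section TotalIsomorphism.
Variables (A : addCategory) (X : cplx A) (t : forall n, hom (X n) (X n.+1)).
Hypothesis tc : contraction t.
Variables (S0 : bsum (fun k => X (dbl k))) (S1 : bsum (fun k => X (dbl k).+1)).

Definition tot_iso : hom (bT S0) (bT S1) :=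
  bdesc S0 (fun k => match k return hom (X (dbl k)) (bT S1) with
    | 0 => binj S1 0 \oc t 0
    | m.+1 => binj S1 m \oc cd X (dbl m).+1 + binj S1 m.+1 \oc t (dbl m).+2 end).

Definition tot_iso' : hom (bT S1) (bT S0) :=
  bdesc S1 (fun k => binj S0 k \oc cd X (dbl k) + binj S0 k.+1 \oc t (dbl k).+1).

Lemma tot_iso0 : tot_iso \oc binj S0 0 = binj S1 0 \oc t 0.
Proof. exact: (bdescE S0 _ 0). Qed.

Lemma tot_isoS m : tot_iso \oc binj S0 m.+1
  = binj S1 m \oc cd X (dbl m).+1 + binj S1 m.+1 \oc t (dbl m).+2.
Proof. exact: (bdescE S0 _ m.+1). Qed.

Lemma tot_iso'E k : tot_iso' \oc binj S1 k
  = binj S0 k \oc cd X (dbl k) + binj S0 k.+1 \oc t (dbl k).+1.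
Proof. exact: (bdescE S1 _ k). Qed.

(** [tot_iso] and [tot_iso'] are the two halves of [d + t], whose square is [d t + t d = 1]. *)
Lemma tot_iso_isom : isom tot_iso.
Proof.
have [t0 tS tt] := tc; exists tot_iso'; split; apply: bsum_ext => k.
  rewrite comp1m -compA; case: k => [|k].
    rewrite tot_iso0 compA tot_iso'E compmDl -!compA t0 tt compm1 compm0.
    by rewrite addr0.
  rewrite tot_isoS compmDr !(compA tot_iso') !tot_iso'E !compmDl -!compA.
  rewrite (cdd X) (tt (dbl k).+2) !compm0 add0r addr0 -compmDr addrC.
  by rewrite (tS (dbl k).+1) compm1.
rewrite comp1m -compA tot_iso'E compmDr !(compA tot_iso) tot_isoS !compmDl -!compA.
rewrite (tt (dbl k).+1) compm0 addr0.
case: k => [|k]; rewrite (compA tot_iso).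
  by rewrite tot_iso0 -compA -compmDr addrC tS compm1.
rewrite tot_isoS compmDl -!compA (cdd X) compm0 add0r -compmDr addrC.
by rewrite (tS (dbl k).+2) compm1.
Qed.

End TotalIsomorphism.

Lemma zero_bip_ext (C : addCategory) (A B A' B' : C) (f g : hom (bip A B) (bip A' B')) :
  zero_object B -> zero_object B' ->
  pr1 _ _ \oc f \oc in1 _ _ = pr1 _ _ \oc g \oc in1 _ _ -> f = g.
Proof.
move=> B0 B'0 fg; apply: bip_ext; last exact: zero_object_in.
by apply: bip_ext_out => //; exact: zero_object_out.
Qed.

Lemma bsum_zero (C : addCategory) (X : nat -> C) (S : bsum X) :
  (forall k, zero_object (X k)) -> zero_object (bT S).
Proof.
move=> X0; apply/zero_objectP; apply: bsum_ext => k.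
by apply: zero_object_out; exact: X0.
Qed.

(** * Vanishing on objects that are zero in [N] and contractible in [M] *)

Section VanishingTheta.
Variables (M N : exactCategory) (F : exactFunctor M N).
Hypotheses (splM : split_exact M) (splN : split_exact N) (cofF : cofinal F).

Lemma pr1_hat (A : N) (k : complement F A) P Q (B : N)
    (a : hom (bip (F P) A) (bip (F Q) B)) :
  pr1 _ _ \oc hat k a
  = pr1 _ _ \oc a \oc bip_in (fmap F (pr1 _ _)) (pr1 _ _ \oc comp_c' k \oc fmap F (pr2 _ _)).
Proof.
rewrite /hat /bassoc (compA (pr1 _ _)) pr1_bip_in -(compA (pr1 (F Q) B)).
by rewrite (compA _ (bip_map a _)) pr1_map -!compA /jhat pr1_bip_in -!compA.
Qed.

(** As [A] is zero, the complement can be replaced by a zero one. Then [hdiff] is the image under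
    [F] of the isomorphism [sg] of [M], built from [p] and the inverse of [p'], and [bcl_fmap]
    applies. *)
Lemma cdelta_fmap (A B : N) (k : complement F A) P Q P' Q' (p : hom P Q) (p' : hom P' Q')
    (x : hom A B) (x' : hom A B) b' :
  zero_object A -> isom p -> isom p' -> zero_object B ->
  inverses (bip_map (fmap F p') x') b' ->
  cdelta k (bip_map (fmap F p) x) b' = 0.
Proof.
move=> A0 [q [qp pq]] [q' [q'p' p'q']] B0 ib.
have ia : inverses (bip_map (fmap F p) x) (bip_map (fmap F q) 0).
  by split; apply: zero_bip_ext => //; rewrite bip_map_comp -fmapM ?qp ?pq fmap1;
    rewrite pr1_map compm1 -compA pr1in1 comp1m.
have F0 : zero_object (F (zob : M)) by apply: (@fmap_zero_object M N F); exact: zobP.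
have z0 : zero_object (bip A (zob : N)) by apply: zero_object_bip => //; exact: zobP.
have c0 : inverses (0 : hom (bip A zob) (F zob)) (0 : hom (F zob) (bip A zob)).
  by split; [exact: zero_object_in | exact: zero_object_in].
pose k0 := Complement c0; rewrite (cdelta_indep splM ia ib k k0).
pose sg : hom (bip (bip P zob) Q') (bip (bip P' zob) Q) :=
  bip_in (bip_in (q' \oc pr2 _ _) (pr2 _ _ \oc pr1 _ _)) (p \oc (pr1 _ _ \oc pr1 _ _)).
pose sg' : hom (bip (bip P' zob) Q) (bip (bip P zob) Q') :=
  bip_in (bip_in (q \oc pr2 _ _) (pr2 _ _ \oc pr1 _ _)) (p' \oc (pr1 _ _ \oc pr1 _ _)).
have isg : isom sg.
  exists sg'; rewrite /sg /sg'; split; rewrite !bip_in_comp -!compA ?pr1_bip_in ?pr2_bip_in.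
    by rewrite (compA q) qp (compA p') p'q' !comp1m bip_in_eta bip_in_pr.
  by rewrite (compA q') q'p' (compA p) pq !comp1m bip_in_eta bip_in_pr.
rewrite /cdelta /delta -(bcl_fmap F isg); congr bcl.
have [_ hb] := hat_inverses k0 ib.
have e : fmap F (pr1 _ _) \oc hat' k0 b' = fmap F q' \oc pr1 _ _.
  rewrite -[pr1 _ _ in RHS]compm1 -hb (compA (pr1 _ _)) pr1_hat pr1_map.
  rewrite -(compA (fmap F p')) pr1_bip_in -(compA (fmap F p')) (compA (fmap F q')).
  by rewrite -fmapM q'p' fmap1 comp1m.
apply: fbip_ext; rewrite -fmapM /sg ?pr1_bip_in ?pr2_bip_in.
  apply: fbip_ext; last exact: zero_object_in.
  by rewrite -fmapM pr1_bip_in fmapM fpr1_in compA e -compA pr1_bip_in.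
by rewrite fpr2_in pr1_hat pr1_map -(compA (fmap F p)) pr1_bip_in -compA -!fmapM.
Qed.

(** When [Y] is zero the cone is [F X] shifted up by one with differential [- F d], so [- F t]
    contracts it. *)
Lemma zero_cone_contraction (X : cplx M) (Y : cplx N) (u : chmap (map_cplx F X) Y)
    (t : forall n, hom (X n) (X n.+1)) :
  (forall n, zero_object (Y n)) -> contraction t ->
  exists s : forall n, hom (cone u n) (cone u n.+1), contraction s /\
    forall n, s n.+1 = bip_map (- fmap F (t n)) 0.
Proof.
move=> Y0 [t0 tS tt].
exists (fun n => match n return hom (cone u n) (cone u n.+1) with
  | 0 => 0 | m.+1 => bip_map (- fmap F (t m)) 0 end); split=> //; split.
- by apply: zero_object_in; exact: Y0.
- move=> n; apply: (@zero_bip_ext N (F (X n)) (Y n.+1) (F (X n)) (Y n.+1)) => //.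
  rewrite compmDr compmDl compm1 pr1in1.
  have -> : pr1 (F (X n)) (Y n.+1) \oc (cd (cone u) n.+1 \oc bip_map (- fmap F (t n)) 0)
      \oc in1 (F (X n)) (Y n.+1) = fmap F (cd X n \oc t n).
    rewrite -!compA bip_map_in1 /= (compA (pr1 _ _)) pr1_bip_in compA bip_out_in1.
    by rewrite compNm compmN opprK fmapM.
  case: n => [|n]; first by rewrite comp0m compm0 comp0m addr0 t0 fmap1.
  rewrite (compA (pr1 _ _)) pr1_map -!compA /= (compA (pr1 _ _)) pr1_bip_in bip_out_in1.
  by rewrite compNm compmN opprK -fmapM -fmapD tS fmap1.
- case=> [|n]; first exact: compm0.
  by rewrite bip_map_comp compNm compmN opprK -fmapM tt fmap0 compm0 /bip_map !comp0m bip_in0.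
Qed.

Lemma tot_zero_cone (X : cplx M) (Y : cplx N) (u : chmap (map_cplx F X) Y)
    (t : forall n, hom (X n) (X n.+1)) (s : forall n, hom (cone u n) (cone u n.+1)) 
    (SP : bsum (fun k => X (dbl k))) (SQ : bsum (fun k => X (dbl k).+1))
    (SB : bsum (fun k => Y (dbl k))) (SA : bsum (fun k => Y (dbl k).+1)) :
  (forall n, zero_object (Y n)) -> 
  (forall n, s n.+1 = bip_map (- fmap F (t n)) 0) ->
  tot_d1 u SP SQ SB SA + tot_s1 SP SQ SB SA s
  = bip_map (fmap F (- tot_iso t SP SQ)) 0.
Proof.
move=> Y0 sE; have A0 : zero_object (bT SA) by apply: bsum_zero => k; exact: Y0.
have B0 : zero_object (bT SB) by apply: bsum_zero => k; exact: Y0.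
apply: (@bsum_ext _ _ (bsum1_cone u SP SA)) => k.
apply: (@zero_bip_ext N (F (X (dbl k))) (Y (dbl k).+1) _ _ _ _) => //.
rewrite compmDl tot_d1E tot_s1E sE.
rewrite [in RHS](compA (pr1 _ _)) pr1_map -[RHS]compA /= bip_map_in1 -!compA.
rewrite (compA (pr1 _ _) (in1 _ _)) pr1in1 comp1m -fmapM compNm.
have e2 : pr1 (F (bT SQ)) (bT SB) \oc (bip_map (fmap F (binj SQ k)) (binj SB k.+1) \oc
    bip_map (- fmap F (t (dbl k))) 0 \oc in1 (F (X (dbl k))) (Y (dbl k).+1))
    = - fmap F (binj SQ k \oc t (dbl k)).
  by rewrite bip_map_comp bip_map_in1 compA pr1in1 comp1m compmN -fmapM.
rewrite compmDl compmDr e2 {e2}.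
case: k => [|k]; rewrite /=.
  by rewrite tot_iso0 -!compA (compA (pr1 _ _)) pr1in2 comp0m add0r fmapN.
rewrite tot_isoS opprD fmapD !fmapN bip_map_in bip_in_comp pr1_bip_in -compA.
by rewrite bip_out_in1 compmN -fmapM.
Qed.

(** The contractions of the cones are taken from [M]; both isomorphisms [d + s] are then images of
    isomorphisms of [M]. *)
Lemma theta_zeroN (X : BF F) (t : forall n, hom (BF_Mtop X n) (BF_Mtop X n.+1))
    (t' : forall n, hom (BF_Mbot X n) (BF_Mbot X n.+1)) :
  (forall n, zero_object (BF_N X n)) -> contraction t -> contraction t' ->
  theta splN cofF X = 0.
Proof.
move=> X0 tc tc'.
have [SP [SQ _]] := bsum_even_odd (cbnd (BF_Mtop X)).
have [SP' [SQ' _]] := bsum_even_odd (cbnd (BF_Mbot X)).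
have [SB [SA _]] := bsum_even_odd (bbnd (BF_N X)).
have [s [sc sE]] := zero_cone_contraction (BF_utop X) X0 tc.
have [s' [sc' sE']] := zero_cone_contraction (BF_ubot X) X0 tc'.
have [k _] := complement_exists cofF (bT SA).
apply: (thetaE splM); exists SP, SQ, SP', SQ', SB, SA, s, s', sc, sc', k.
have ib := pcontraction_inverses (@tot_pcontraction _ _ F _ (bot (BF_N X)) (BF_ubot X)
  SP' SQ' SB SA _ sc').
rewrite [X in inverses X](@tot_zero_cone _ (bot (BF_N X)) _ _ _ SP' SQ' SB SA X0 sE') in ib.
apply/esym; rewrite /sdelta.
have isoN (C : addCategory) (U V : C) (f : hom U V) : isom f -> isom (- f).
  by move=> [g [gf fg]]; exists (- g); rewrite !compNm !compmN !opprK.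
rewrite [X in cdelta _ X](@tot_zero_cone _ (top (BF_N X)) _ _ _ SP SQ SB SA X0 sE).
apply: cdelta_fmap ib; try by apply: bsum_zero => n; exact: X0.
- by apply: isoN; exact: tot_iso_isom.
- by apply: isoN; exact: tot_iso_isom.
Qed.

End VanishingTheta.

(* [X -> Z (+) cone 1 -> cone f] is a degreewise split extension. *)
Section ConeExtension.
Variables (A : addCategory) (X Z : cplx A) (f : chmap X Z).

Definition ce_in_fun n : hom (X n) (cone (chmap_id X) n) :=
  match n return hom (X n) (cone (chmap_id X) n) with
  | 0 => idm _ | m.+1 => in2 _ _ end.

Definition ce_in : chmap X (cplx_sum Z (cone (chmap_id X))).
Proof.
exists (fun n => bip_in (f n) (ce_in_fun n)) => n /=.
rewrite bip_in_comp /cs_d bip_map_in cmapP; congr bip_in.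
case: n => [|n] /=; first by rewrite comp1m bip_out_in2.
by rewrite bip_in_comp !bip_out_in2 !in2E bip_in_comp comp0m comp1m.
Defined.

Definition ce_out_fun n : hom (bip (Z n) (cone (chmap_id X) n)) (cone f n) :=
  match n return hom (bip (Z n) (cone (chmap_id X) n)) (cone f n) with
  | 0 => bip_out (idm _) (- f 0)
  | m.+1 => bip_out (in2 _ _) (bip_map (- idm _) (- f m.+1)) end.

Lemma ce_outP n :
  ce_out_fun n \oc cd (cplx_sum Z (cone (chmap_id X))) n
  = cd (cone f) n \oc ce_out_fun n.+1.
Proof.
have key m : bip_out (f m) (cd Z m) \oc bip_map (- idm (X m)) (- f m.+1)
    = - f m \oc bip_out (idm (X m)) (cd X m).
  rewrite /bip_map bip_out_in /bip_out compmDr !compNm !compmN !comp1m !compA.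
  by rewrite -cmapP.
case: n => [|n] /=; apply: bip_ext_out; rewrite -!compA /cs_d ?bip_map_in1 ?bip_map_in2.
- by rewrite bip_out_in1 compA bip_out_in1 bip_out_in2 comp1m.
- by rewrite compA !bip_out_in2 -key.
- rewrite bip_out_in1 compA bip_out_in1 bip_in_comp !bip_out_in2 in2E bip_in_comp.
  by rewrite comp0m comp1m.
- rewrite compA !bip_out_in2 bip_map_in bip_in_comp -key; congr bip_in.
  rewrite /bip_map bip_out_in /bip_out !comp0m !addr0.
  by rewrite !compNm ?compmN !comp1m.
Qed.

Definition ce_out : chmap (cplx_sum Z (cone (chmap_id X))) (cone f) :=
  @ChMap _ (cplx_sum Z (cone (chmap_id X))) (cone f) ce_out_fun ce_outP.

Definition ce_retr n : hom (bip (Z n) (cone (chmap_id X) n)) (X n) :=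
  match n return hom (bip (Z n) (cone (chmap_id X) n)) (X n) with
  | 0 => pr2 _ _ | m.+1 => pr2 _ _ \oc pr2 _ _ end.

Definition ce_sect n : hom (cone f n) (bip (Z n) (cone (chmap_id X) n)) :=
  match n return hom (cone f n) (bip (Z n) (cone (chmap_id X) n)) with
  | 0 => in1 _ _ | m.+1 => bip_in (pr2 _ _) (- (in1 _ _ \oc pr1 _ _)) end.

Lemma ce_retr_in n : ce_retr n \oc ce_in n = idm (X n).
Proof. by case: n => [|m] /=; rewrite ?pr2_bip_in // -compA pr2_bip_in pr2in2. Qed.

Lemma ce_out_sect n : ce_out_fun n \oc ce_sect n = idm (cone f n).
Proof.
case: n => [|m] /=; first exact: bip_out_in1.
rewrite bip_out_in compmN compA bip_map_in1 compmN compm1 compNm opprK.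
by rewrite addrC bipE.
Qed.

Lemma ce_split n : ce_in n \oc ce_retr n + ce_sect n \oc ce_out_fun n = idm _.
Proof.
case: n => [|m] /=.
  apply: bip_ext_out; rewrite compmDl -!compA ?pr2in1 ?pr2in2 ?bip_out_in1 ?bip_out_in2.
    by rewrite compm0 add0r compm1 comp1m.
  rewrite compm1 compmN in1E in2E bip_in_comp !comp1m comp0m bip_inN bip_inD subrr.
  by rewrite oppr0 addr0.
apply: bip_ext_out; rewrite compmDl -!compA ?pr2in1 ?pr2in2 ?bip_out_in1 ?bip_out_in2.
  rewrite !compm0 add0r comp1m bip_in_comp pr2in2 compNm -compA pr1in2 compm0 oppr0.
  by rewrite in1E.
rewrite compm1 !bip_in_comp pr2_map !compNm -(compA (in1 _ _)) pr1_map.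
by rewrite !compNm compmN opprK !comp1m bip_inD subrr addrC bipE in2E.
Qed.

End ConeExtension.

(** * Invariance under the morphisms of [pB] *)

Section ThetaP.
Variables (M N : exactCategory) (F : exactFunctor M N).
Hypotheses (splM : split_exact M) (splN : split_exact N) (cofF : cofinal F).
Hypotheses (hM : supports_long_exact_sequences M) (hN : supports_long_exact_sequences N).

Section Pad.
Variables (X : BF F) (C C' : cplx M).
Variables (k : forall n, hom (C n) (C n.+1)) (k' : forall n, hom (C' n) (C' n.+1)).
Hypotheses (kc : contraction k) (kc' : contraction k').

Definition pad : BF F :=
  @BFOb _ _ F (cplx_sum (BF_Mtop X) C) (cplx_sum (BF_Mbot X) C') (BF_N X)
    (pad_u C (BF_utop X)) (pad_u C' (BF_ubot X))
    (pad_u_quasi_iso splN hN kc (BF_utopP X)) (pad_u_quasi_iso splN hN kc' (BF_ubotP X)).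

Lemma pad_inP (U D : cplx M) (Y : cplx N) (u : chmap (map_cplx F U) Y) n :
  idm (Y n) \oc u n = pad_u D u n \oc fmap F (cs_in1 U D n).
Proof. by rewrite /= -compA -fmapM pr1in1 fmap1 comp1m compm1. Qed.

Definition pad_in : hom X pad :=
  @BFMor _ _ F X pad (cs_in1 _ _) (cs_in1 _ _) (bmap_id _)
    (pad_inP C (BF_utop X)) (pad_inP C' (BF_ubot X)).

End Pad.

Lemma zeroBF_M n : zero_object (conc_ob (zob : M) n).
Proof. by case: n => *; exact: zobP. Qed.

Lemma zeroBF_N n : zero_object (BF_N (zeroBF F) n).
Proof. by case: n => [|n]; [apply: (@fmap_zero_object M N F)|]; exact: zobP. Qed.

Lemma sum_contraction (X C : cplx M) (k : forall n, hom (C n) (C n.+1)) :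
  (forall n, zero_object (X n)) -> contraction k ->
  exists t : forall n, hom (cplx_sum X C n) (cplx_sum X C n.+1), contraction t.
Proof.
move=> X0 [k0 kS kk]; exists (fun n => bip_map 0 (k n)); split.
- rewrite /= /cs_d bip_map_comp k0 compm0 -bip_map1; congr bip_map.
  exact: zero_object_in.
- move=> n; rewrite /= /cs_d !bip_map_comp bip_mapD kS -bip_map1; congr bip_map.
  exact: zero_object_in.
- by move=> n; rewrite bip_map_comp kk comp0m /bip_map !comp0m bip_in0.
Qed.

Lemma theta_pad0 C C' k k' (kc : @contraction M C k) (kc' : @contraction M C' k') :
  theta splN cofF (pad (zeroBF F) kc kc') = 0.
Proof.
have [t tc] := sum_contraction (X := conc zob) zeroBF_M kc.
have [t' tc'] := sum_contraction (X := conc zob) zeroBF_M kc'.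
exact: (theta_zeroN splM splN cofF (X := pad (zeroBF F) kc kc') zeroBF_N tc tc').
Qed.

Definition cs_pr2 (X Z C : cplx M) : chmap (cplx_sum X C) (cplx_sum Z C).
Proof.
exists (fun n => bip_map 0 (idm (C n))) => n.
by rewrite /= /cs_d !bip_map_comp comp0m compm0 comp1m compm1.
Defined.

(** [X -> pad X -> pad 0] is a short exact sequence, and the value on [pad 0] is zero. *)
Lemma theta_pad X C C' k k' (kc : @contraction M C k) (kc' : @contraction M C' k') :
  theta splN cofF (pad X kc kc') = theta splN cofF X.
Proof.
pose Z := pad (zeroBF F) kc kc'; pose Y := pad X kc kc'.
have e1 n : bmap0 (BF_N X) (BF_N (zeroBF F)) n \oc BF_utop Y n
    = BF_utop Z n \oc fmap F (cs_pr2 (BF_Mtop X) (conc zob) C n).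
  by rewrite /= comp0m -compA -fmapM pr1_map comp0m fmap0 compm0.
have e2 n : bmap0 (BF_N X) (BF_N (zeroBF F)) n \oc BF_ubot Y n
    = BF_ubot Z n \oc fmap F (cs_pr2 (BF_Mbot X) (conc zob) C' n).
  by rewrite /= comp0m -compA -fmapM pr1_map comp0m fmap0 compm0.
pose g := @BFMor _ _ F Y Z (cs_pr2 _ _ _) (cs_pr2 _ _ _) (bmap0 _ _) e1 e2.
have cf (U : cplx M) (D : cplx M) n :
    conflation (cs_in1 U D n) (cs_pr2 U (conc zob) D n).
  apply: (split_conflation (r := pr1 _ _) (s := in2 _ _ \oc pr2 _ _)) => /=.
  - exact: pr1in1.
  - rewrite compA bip_map_in2 compm1 -[RHS]bipE.
    by rewrite (zero_object_in (pr1 _ _) 0 (zeroBF_M n)) compm0 add0r.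
  - by rewrite -compA pr2_map comp1m bipE.
rewrite (@theta_ses _ _ _ splM splN cofF _ _ _ (pad_in X kc kc') g).
  by rewrite [theta _ _ Z]theta_pad0 addr0.
split=> n; try exact: cf.
by apply: conflation_isom_l; [exact: isom1 | exact: zeroBF_N].
Qed.

Section ThetaCone.
Variables (X Z : cplx M) (f : chmap X Z).

Definition ce_zout : chmap (cplx_sum Z (cone (chmap_id X)))
    (cplx_sum (conc zob) (cone f)).
Proof.
exists (fun n => in2 _ _ \oc ce_out f n) => n.
by rewrite -compA cmapP !compA /= /cs_d bip_map_in2.
Defined.

Lemma ce_conflation n : conflation (ce_in f n) (ce_zout n).
Proof.
apply: (split_conflation (r := ce_retr X Z n) (s := ce_sect f n \oc pr2 _ _)).
- exact: ce_retr_in.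
- rewrite /= -(compA _ (ce_out_fun f n)) (compA _ (ce_sect f n)) ce_out_sect comp1m.
  rewrite -[RHS]bipE.
  by rewrite (zero_object_in (pr1 _ _) 0 (zeroBF_M n)) compm0 add0r.
rewrite /= -(compA _ (pr2 _ _)) (compA (pr2 _ _)) pr2in2 comp1m.
exact: ce_split.
Qed.

End ThetaCone.

(* The quotient of [X -> pad Y] is the zero object padded by the acyclic cones of
   the two components of [f] in [M]. *)
Lemma theta_p (X Y : BF F) (f : hom X Y) : pB f -> theta splN cofF X = theta splN cofF Y.
Proof.
move=> [qt qb [psi' [ppsi psip]]].
have cone1 (U : cplx M) : exists k : forall n, hom (cone (chmap_id U) n)
    (cone (chmap_id U) n.+1), contraction k.
  apply: (acyclic_contraction splM); apply: (iso_quasi_iso hM) => n; exact: isom1.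
have [k kc] := cone1 (BF_Mtop X); have [k' kc'] := cone1 (BF_Mbot X).
have [l lc] := acyclic_contraction splM qt; have [l' lc'] := acyclic_contraction splM qb.
pose P := pad Y kc kc'; pose Z := pad (zeroBF F) lc lc'.
rewrite -(theta_pad Y kc kc').
have e1 n : BF_psi f n \oc BF_utop X n
    = BF_utop P n \oc fmap F (ce_in (BF_phitop f) n).
  by rewrite /= -compA -fmapM pr1_bip_in BF_mortopP.
have e2 n : BF_psi f n \oc BF_ubot X n
    = BF_ubot P n \oc fmap F (ce_in (BF_phibot f) n).
  by rewrite /= -compA -fmapM pr1_bip_in BF_morbotP.
have e3 n : bmap0 (BF_N Y) (BF_N (zeroBF F)) n \oc BF_utop P n
    = BF_utop Z n \oc fmap F (ce_zout (BF_phitop f) n).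
  by rewrite /= comp0m -compA -fmapM compA pr1in2 comp0m fmap0 compm0.
have e4 n : bmap0 (BF_N Y) (BF_N (zeroBF F)) n \oc BF_ubot P n
    = BF_ubot Z n \oc fmap F (ce_zout (BF_phibot f) n).
  by rewrite /= comp0m -compA -fmapM compA pr1in2 comp0m fmap0 compm0.
pose i := @BFMor _ _ F X P (ce_in _) (ce_in _) (BF_psi f) e1 e2.
pose p := @BFMor _ _ F P Z (ce_zout _) (ce_zout _) (bmap0 _ _) e3 e4.
rewrite (@theta_ses _ _ _ splM splN cofF _ _ _ i p).
  by rewrite [theta _ _ Z]theta_pad0 addr0.
split=> n; try exact: ce_conflation.
apply: conflation_isom_l; last exact: zeroBF_N.
exists (psi' n); split.
  by move/(congr1 (fun h => bmap_fun h n)): ppsi.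
by move/(congr1 (fun h => bmap_fun h n)): psip.
Qed.

Lemma Grayson_to_Bass : exists Th : {additive K0Grayson F -> K0Bass F},
  forall X, Th (K0Grayson_cls (Psi F X)) = K0Bass_cls X.
Proof.
have [Th ThE] := K0Grayson_lift (@theta_ses _ _ _ splM splN cofF) theta_p
  (theta_Delta splM splN cofF).
by exists Th => X; rewrite ThE; exact: theta_Psi.
Qed.

End ThetaP.

(** * Surjectivity *)

Section DegreewiseIso.
Variables (M N : exactCategory) (F : exactFunctor M N).
Hypotheses (hM : supports_long_exact_sequences M) (hN : supports_long_exact_sequences N).
Local Notation cls := (@K0Grayson_cls M N F).

(** Having the shift as an endomorphism of the whole group lets its effect on the image of [Phi] be
    read off from generators, where it is [-1]. Hence that image is stable under the shift. *)
Lemma Sh_endo : exists T : {additive K0Grayson F -> K0Grayson F},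
  forall X, T (cls X) = cls (Sh X).
Proof.
apply: (K0Grayson_lift (h := fun X => cls (Sh X))).
- move=> X Y Z f g [f1 f2 f3].
  apply: (@K0Grayson_ses _ _ _ _ _ _ (Sh_map f) (Sh_map g)).
  by split; apply: sh_ses.
- move=> X Y f [q1 q2 [g [gf fg]]]; apply: (@K0Grayson_p _ _ _ _ _ (Sh_map f)).
  split; try exact: sh_chmap_quasi_iso.
  exists (sh_bmap g); split; apply: bmap_eq => -[|n] /=; rewrite ?comp1m //.
    by move/(congr1 (fun h => bmap_fun h n)): gf.
  by move/(congr1 (fun h => bmap_fun h n)): fg.
move=> X; rewrite -(K0Grayson_Delta (CFOb (sh_u_quasi_iso (CF_uP X)))).
set Y := Sh _; set Z := Delta_ob _.
have kt n : idm (BF_N Y n) \oc BF_utop Y n = BF_utop Z n \oc fmap F (idm (BF_Mtop Y n)).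
  by rewrite fmap1 comp1m compm1.
have e (d d' : forall n, hom (BF_N Y n.+1) (BF_N Y n)) : (forall n, d n = d' n) ->
    forall n, idm (BF_N Y n) \oc d n = d' n \oc idm (BF_N Y n.+1).
  by move=> dd n; rewrite comp1m compm1 dd.
have ed n : bd (BF_N Y) n = bd (BF_N Z) n by case: n.
have ed' n : bd' (BF_N Y) n = bd' (BF_N Z) n by case: n.
pose p := @BMap _ (BF_N Y) (BF_N Z) (fun n => idm (BF_N Y n)) (e _ _ ed) (e _ _ ed').
apply: (@K0Grayson_isom _ _ F hM _ _ (@BFMor _ _ F Y Z (chmap_id _) (chmap_id _) p kt kt)) => n;
  exact: isom1.
Qed.

Section Image.
Variable Phi : {additive K0Bass F -> K0Grayson F}.
Hypothesis PhiE : forall X, Phi (K0Bass_cls X) = cls (Psi F X).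

Definition in_image z := exists w, Phi w = z.

(** Applying [b^-1] to the middle object turns the pair [[a, b]] into [[b^-1 a, 1]], which is a
    value of [Psi]. *)
Lemma in_image_deg0 P Q (C : N) (a : hom (F P) C) (b : hom (F Q) C) (ha : isom a)
  (hb : isom b) : in_image (cls (deg0 ha hb)).
Proof.
have [b' [b'b bb']] := hb; have hb' : isom b' by exists b.
exists (K0Bass_cls (CoOb (isomM ha hb'))); rewrite PhiE; apply/esym.
apply: (deg0_isom hM ha hb (isomM ha hb') (isom1 _) (isom1 P) (isom1 Q) hb').
  by rewrite fmap1 compm1.
by rewrite fmap1 compm1.
Qed.

Lemma in_image_Sh X : in_image (cls X) -> in_image (cls (Sh X)).
Proof.
have [T TE] := Sh_endo; move=> [w wX]; exists (- w); rewrite raddfN -TE -wX.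
move: w {wX X}; apply: K0Bass_ind.
- by rewrite !raddf0.
- by move=> X; rewrite PhiE TE [RHS](deg0_shift hM hN).
- by move=> y z Py Pz; rewrite (raddfB Phi) (raddfB T) -Py -Pz opprD.
Qed.

Section Tail.
Variable A : addCategory.

Lemma tail_bnd (X : nat -> A) :
  (exists b : nat, forall n, (b <= n)%N -> zero_object (X n)) ->
  exists b : nat, forall n, (b <= n)%N -> zero_object (X n.+1).
Proof. by move=> [b bX]; exists b => n bn; apply: bX; exact: leqW. Qed.

Definition tail_cplx (X : cplx A) : cplx A :=
  @Cplx A (fun n => X n.+1) (fun n => cd X n.+1) (fun n => cdd X n.+1)
    (tail_bnd (cbnd X)).

Definition tail_bcplx (X : bcplx A) : bcplx A :=
  @BCplx A (fun n => X n.+1) (fun n => bd X n.+1) (fun n => bd' X n.+1)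
    (fun n => bdd X n.+1) (fun n => bdd' X n.+1) (tail_bnd (bbnd X)).

Definition head_in (X : nat -> A) n : hom (conc_ob (X 0) n) (X n) :=
  match n return hom (conc_ob (X 0) n) (X n) with 0 => idm _ | _ => 0 end.

Definition tail_out (X : nat -> A) n : hom (X n) (sh_ob (fun n => X n.+1) n) :=
  match n return hom (X n) (sh_ob (fun n => X n.+1) n) with 0 => 0 | m.+1 => idm _ end.

Lemma head_inP (X : nat -> A) (d : forall n, hom (X n.+1) (X n)) n :
  head_in X n \oc 0 = d n \oc head_in X n.+1.
Proof. by rewrite !compm0. Qed.

Lemma tail_outP (X : nat -> A) (d : forall n, hom (X n.+1) (X n)) n :
  tail_out X n \oc d n
  = @sh_d _ (fun n => X n.+1) (fun n => d n.+1) n \oc tail_out X n.+1.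
Proof. by case: n => [|n] /=; rewrite ?comp0m ?comp1m ?compm1. Qed.

End Tail.

Lemma head_tail_conflation (E : exactCategory) (X : nat -> E) n :
  conflation (head_in X n) (tail_out X n).
Proof.
case: n => [|n] /=.
  by apply: conflation_isom_l; [exact: isom1 | exact: zobP].
by apply: conflation_isom_r; [exact: isom1 | exact: zobP].
Qed.

Definition tail_u (X : cplx M) (Y : cplx N) (u : chmap (map_cplx F X) Y) :
    chmap (map_cplx F (tail_cplx X)) (tail_cplx Y) :=
  @ChMap N (map_cplx F (tail_cplx X)) (tail_cplx Y) (fun n => u n.+1)
    (fun n => cmapP u n.+1).

Lemma cls_zero (X : BF F) : (forall n, zero_object (BF_Mtop X n)) ->
  (forall n, zero_object (BF_Mbot X n)) -> (forall n, zero_object (BF_N X n)) ->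
  cls X = 0.
Proof.
move=> Xt Xb Xn; apply: (addrI (cls X)); rewrite addr0.
rewrite -(@K0Grayson_ses _ _ _ _ _ _ (BF_id X) (BF_id X)) //.
by split=> n; exact: conflation_zero.
Qed.

(** Induction on the length: [X] is an extension of the shift of its tail by its degree 0 part. A
    quasi-isomorphism need not restrict to quasi-isomorphisms of such truncations, but a degreewise
    isomorphism does. *)
Lemma in_image_isom_bound b (X : BF F) :
  (forall n, (b <= n)%N -> [/\ zero_object (BF_Mtop X n), zero_object (BF_Mbot X n)
    & zero_object (BF_N X n)]) ->
  (forall n, isom (BF_utop X n)) -> (forall n, isom (BF_ubot X n)) ->
  in_image (cls X).
Proof.
elim: b X => [|b IH] X bX ut ub.
  exists 0; rewrite raddf0 cls_zero // => n; by have [] := bX n isT.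
have qt : quasi_iso (tail_u (BF_utop X)).
  by apply: (iso_quasi_iso hN) => n; exact: ut.
have qb : quasi_iso (@tail_u _ (bot (BF_N X)) (BF_ubot X)).
  by apply: (iso_quasi_iso hN) => n; exact: ub.
pose T := @BFOb _ _ F (tail_cplx (BF_Mtop X)) (tail_cplx (BF_Mbot X))
  (tail_bcplx (BF_N X)) (tail_u (BF_utop X)) (@tail_u _ (bot (BF_N X)) (BF_ubot X)) qt qb.
have [w wT] : in_image (cls (Sh T)).
  apply: in_image_Sh; apply: IH => [n bn|n|n]; [exact: bX | exact: ut | exact: ub].
have [v vH] := in_image_deg0 (ut 0) (ub 0).
exists (v + w); rewrite raddfD vH wT; apply/esym.
pose H := deg0 (ut 0) (ub 0).
pose ht := @ChMap _ (conc _) (BF_Mtop X) (head_in (BF_Mtop X)) (head_inP (cd (BF_Mtop X))).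
pose hb := @ChMap _ (conc _) (BF_Mbot X) (head_in (BF_Mbot X)) (head_inP (cd (BF_Mbot X))).
pose hn := @BMap _ (bconc _) (BF_N X) (head_in (BF_N X)) (head_inP (bd (BF_N X)))
  (head_inP (bd' (BF_N X))).
pose tt := @ChMap _ (BF_Mtop X) (sh_cplx (tail_cplx (BF_Mtop X))) (tail_out (BF_Mtop X))
  (tail_outP (cd (BF_Mtop X))).
pose tb := @ChMap _ (BF_Mbot X) (sh_cplx (tail_cplx (BF_Mbot X))) (tail_out (BF_Mbot X))
  (tail_outP (cd (BF_Mbot X))).
pose tn := @BMap _ (BF_N X) (sh_bcplx (tail_bcplx (BF_N X))) (tail_out (BF_N X))
  (tail_outP (bd (BF_N X))) (tail_outP (bd' (BF_N X))).
have e1 n : hn n \oc BF_utop H n = BF_utop X n \oc fmap F (ht n).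
  by case: n => [|n] /=; rewrite ?fmap1 ?compm1 ?comp1m // fmap0 !compm0.
have e2 n : hn n \oc BF_ubot H n = BF_ubot X n \oc fmap F (hb n).
  by case: n => [|n] /=; rewrite ?fmap1 ?compm1 ?comp1m // fmap0 !compm0.
have e3 n : tn n \oc BF_utop X n = BF_utop (Sh T) n \oc fmap F (tt n).
  by case: n => [|n] /=; rewrite ?comp0m // fmap1 compm1 comp1m.
have e4 n : tn n \oc BF_ubot X n = BF_ubot (Sh T) n \oc fmap F (tb n).
  by case: n => [|n] /=; rewrite ?comp0m // fmap1 compm1 comp1m.
apply: (@K0Grayson_ses _ _ _ _ _ _ (@BFMor _ _ F H X ht hb hn e1 e2)
  (@BFMor _ _ F X (Sh T) tt tb tn e3 e4)).
by split=> n; exact: head_tail_conflation.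
Qed.

Lemma in_image_isom (X : BF F) :
  (forall n, isom (BF_utop X n)) -> (forall n, isom (BF_ubot X n)) ->
  in_image (cls X).
Proof.
have [a aX] := cbnd (BF_Mtop X); have [b bX] := cbnd (BF_Mbot X).
have [c cX] := bbnd (BF_N X).
apply: (@in_image_isom_bound (maxn a (maxn b c))) => n.
by rewrite !geq_max => /and3P[an bn cn]; split; [exact: aX | exact: bX | exact: cX].
Qed.

End Image.
End DegreewiseIso.

(** * Split complexes and their objects of cycles *)

Section ElementaryComplexes.
Variable A : addCategory.
Implicit Types X Y : cplx A.

(** A split complex is determined by its cycles: [f] carries [i n] to [i' n] and [q n] to [q' n]. *)
Lemma elementary_isom X Y Z : elementary X Z -> elementary Y Z ->
  exists f : chmap X Y, forall n, isom (f n).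
Proof.
move=> [i [p [r [q [di ripq ir0 irqp rq0]]]]].
move=> [i' [p' [r' [q' [di' ripq' ir0' irqp' rq0']]]]].
pose f n : hom (X n) (Y n) :=
  match n return hom (X n) (Y n) with
  | 0 => i' 0 \oc r 0 | m.+1 => i' m.+1 \oc r m.+1 + q' m \oc p m end.
pose g n : hom (Y n) (X n) :=
  match n return hom (Y n) (X n) with
  | 0 => i 0 \oc r' 0 | m.+1 => i m.+1 \oc r' m.+1 + q m \oc p' m end.
have fi n : f n \oc i n = i' n.
  case: n => [|n] /=.
    by rewrite -compA (proj1 (ripq 0)) compm1.
  rewrite compmDl -!compA (proj1 (ripq n.+1)) (proj2 (rq0 n)).
  by rewrite compm1 compm0 addr0.
have fP n : f n \oc cd X n = cd Y n \oc f n.+1.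
  rewrite di compA fi di' /= compmDr -!compA (compA (p' n)) (proj2 (rq0' n)).
  by rewrite comp0m compm0 add0r (compA (p' n)) (proj2 (ripq' n)) comp1m.
exists (ChMap fP) => n /=; exists (g n).
case: n => [|n] /=.
  rewrite -!compA (compA (r' 0)) (proj1 (ripq' 0)) comp1m ir0; split=> //.
  by rewrite (compA (r 0)) (proj1 (ripq 0)) comp1m ir0'.
split.
  rewrite compmDr !compmDl -!compA !(compA (r' _)) !(compA (p' _)).
  rewrite (proj1 (ripq' n.+1)) (proj2 (ripq' n)) (proj1 (rq0' n)) (proj2 (rq0' n)).
  by rewrite !comp1m !comp0m !compm0 addr0 add0r irqp.
rewrite compmDr !compmDl -!compA !(compA (r _)) !(compA (p _)).
rewrite (proj1 (ripq n.+1)) (proj2 (ripq n)) (proj1 (rq0 n)) (proj2 (rq0 n)).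
by rewrite !comp1m !comp0m !compm0 addr0 add0r irqp'.
Qed.

Lemma elementary_cycles X Z Z' : (forall n, isomorphic (Z n) (Z' n)) ->
  elementary X Z -> elementary X Z'.
Proof.
move=> /dep_choice[g /dep_choice[g' gP]] [i [p [r [q [di ripq ir0 irqp rq0]]]]].
have gg n : g' n \oc g n = idm _ by have [] := gP n.
have gg' n : g n \oc g' n = idm _ by have [] := gP n.
exists (fun n => i n \oc g' n), (fun n => g n \oc p n), (fun n => g n \oc r n),
  (fun n => q n \oc g' n); split.
- by move=> n; rewrite -compA (compA (g' n)) gg comp1m.
- move=> n; rewrite -!compA (compA (r n)) (proj1 (ripq n)) (compA (p n)).
  by rewrite (proj2 (ripq n)) !comp1m.
- by rewrite -compA (compA (g' _)) gg comp1m.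
- by move=> n; rewrite -!compA !(compA (g' _)) !gg !comp1m.
- move=> n; rewrite -!compA (compA (r _)) (proj1 (rq0 n)) (compA (p n)).
  by rewrite (proj2 (rq0 n)) !comp0m !compm0.
Qed.

Lemma elementary_sum X Y Z V : elementary X Z -> elementary Y V ->
  elementary (cplx_sum X Y) (fun n => bip (Z n) (V n)).
Proof.
move=> [i [p [r [q [di ripq ir0 irqp rq0]]]]].
move=> [i' [p' [r' [q' [di' ripq' ir0' irqp' rq0']]]]].
exists (fun n => bip_map (i n) (i' n)), (fun n => bip_map (p n) (p' n)),
  (fun n => bip_map (r n) (r' n)), (fun n => bip_map (q n) (q' n)).
have z (P Q P' Q' : A) : bip_map (0 : hom P Q) (0 : hom P' Q') = 0.
  by rewrite /bip_map !comp0m bip_in0.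
split.
- by move=> n; rewrite bip_map_comp -di -di'.
- move=> n; rewrite !bip_map_comp (proj1 (ripq n)) (proj2 (ripq n)).
  by rewrite (proj1 (ripq' n)) (proj2 (ripq' n)) !bip_map1.
- by rewrite bip_map_comp ir0 ir0' bip_map1.
- by move=> n; rewrite !bip_map_comp bip_mapD irqp irqp' bip_map1.
- move=> n; rewrite !bip_map_comp (proj1 (rq0 n)) (proj2 (rq0 n)).
  by rewrite (proj1 (rq0' n)) (proj2 (rq0' n)) !z.
Qed.

(** The cycles of the cone of the identity are the pairs [(- d y, y)], a copy of [X]. *)
Lemma elementary_cone_id X : elementary (cone (chmap_id X)) X.
Proof.
exists (fun n => match n return hom (X n) (cone (chmap_id X) n) with
    | 0 => idm _ | m.+1 => bip_in (- cd X m) (idm _) end),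
  (fun n => bip_out (idm (X n)) (cd X n)),
  (fun n => match n return hom (cone (chmap_id X) n) (X n) with
    | 0 => idm _ | m.+1 => pr2 _ _ end),
  (fun n => in1 (X n) (X n.+1)).
split=> [[|n]|n||n|n] /=.
- by rewrite comp1m.
- rewrite bip_in_comp comp1m comp_bip_out compm1; congr bip_in; congr bip_out.
  by rewrite compNm cdd oppr0.
- by rewrite bip_out_in1; case: n => [|n]; rewrite ?comp1m ?pr2_bip_in.
- by rewrite comp1m.
- rewrite bip_in_comp comp1m compNm in1E bip_in_comp comp1m comp0m bip_inD addr0.
  by rewrite /bip_out comp1m addrC addrK bip_in_pr.
- by rewrite pr2in1 bip_out_in comp1m compm1 addNr.
Qed.

Section Disk.
Variable Z : nat -> A.
Hypothesis Z0 : exists b : nat, forall n, (b <= n)%N -> zero_object (Z n).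

(** The direct sum of the two-term complexes [Z n = Z n], placed in degrees [n + 1] and [n]. *)
Definition disk_ob n : A := bip (sh_ob Z n) (Z n).

Definition disk_d n : hom (disk_ob n.+1) (disk_ob n) :=
  in2 (sh_ob Z n) (Z n) \oc pr1 (Z n) (Z n.+1).

Lemma disk_dd n : disk_d n \oc disk_d n.+1 = 0.
Proof. by rewrite /disk_d -compA (compA (pr1 _ _)) pr1in2 comp0m compm0. Qed.

Definition disk : cplx A := Cplx disk_dd (cs_bnd (sh_bnd Z0) Z0).

Lemma elementary_disk : elementary disk Z.
Proof.
exists (fun n => in2 (sh_ob Z n) (Z n)), (fun n => pr1 (Z n) (Z n.+1)),
  (fun n => pr2 (sh_ob Z n) (Z n)), (fun n => in1 (Z n) (Z n.+1)); split=> //=.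
- by move=> n; rewrite pr2in2 pr1in1.
- rewrite -[RHS]bipE (zero_object_in (pr1 (zob : A) (Z 0)) 0 (@zobP A)).
  by rewrite compm0 add0r.
- by move=> n; rewrite addrC bipE.
- by move=> n; rewrite pr2in1 pr1in2.
Qed.

End Disk.

Definition cs_map X Y X' Y' (f : chmap X X') (g : chmap Y Y') :
  chmap (cplx_sum X Y) (cplx_sum X' Y').
Proof.
exists (fun n => bip_map (f n) (g n)) => n.
by rewrite /= /cs_d !bip_map_comp !cmapP.
Defined.

Lemma bassoc'_in1 (P Q R : A) : bassoc' P Q R \oc in1 P (bip Q R) = in1 _ _ \oc in1 _ _.
Proof.
rewrite /bassoc' bip_in_comp bip_map_in1 compm1 -compA pr2in1 compm0.
by rewrite [in1 (bip P Q) R]in1E bip_in_comp comp1m comp0m.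
Qed.

Definition cs_assoc X Y (Z : cplx A) :
  chmap (cplx_sum (cplx_sum X Y) Z) (cplx_sum X (cplx_sum Y Z)).
Proof.
by exists (fun n => bassoc (X n) (Y n) (Z n)) => n; rewrite /= /cs_d bassoc_nat.
Defined.

Definition cs_assoc' X Y (Z : cplx A) :
  chmap (cplx_sum X (cplx_sum Y Z)) (cplx_sum (cplx_sum X Y) Z).
Proof.
exists (fun n => bassoc' (X n) (Y n) (Z n)) => n; rewrite /= /cs_d; apply/esym.
exact: inverses_nat (bassoc_inverses _ _ _) (bassoc_inverses _ _ _) (bassoc_nat _ _ _).
Defined.

(* The chain map [d S + S d], with [S] the composite of the contraction and the
   degreewise section, is a section of [g] in the category of complexes. *)
Lemma contractible_quotient_isom X Y C (f : chmap X Y) (g : chmap Y C)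
    (r : forall n, hom (Y n) (X n)) (s : forall n, hom (C n) (Y n))
    (k : forall n, hom (C n) (C n.+1)) :
  (forall n, r n \oc f n = idm (X n)) -> (forall n, g n \oc s n = idm (C n)) ->
  (forall n, f n \oc r n + s n \oc g n = idm (Y n)) -> contraction k ->
  exists h : chmap (cplx_sum X C) Y,
    (forall n, isom (h n)) /\ forall n, h n \oc in1 (X n) (C n) = f n.
Proof.
move=> rf gs frsg [k0 kS kk].
have gf n : g n \oc f n = 0 by have [] := splitting_orthogonal (rf n) (gs n) (frsg n).
have [S gS] : exists S : forall n, hom (C n) (Y n.+1), forall n, g n.+1 \oc S n = k n.
  by exists (fun n => s n.+1 \oc k n) => n; rewrite compA gs comp1m.
pose sg n : hom (C n) (Y n) := match n return hom (C n) (Y n) with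
  | 0 => cd Y 0 \oc S 0 | m.+1 => cd Y m.+1 \oc S m.+1 + S m \oc cd C m end.
have sgP n : sg n \oc cd C n = cd Y n \oc sg n.+1.
  case: n => [|n] /=.
    by rewrite compmDr compA cdd comp0m add0r compA.
  rewrite compmDl compmDr -!compA (cdd C) !compm0 addr0.
  rewrite (compA (cd Y n.+1) (cd Y n.+2)) cdd.
  by rewrite comp0m add0r.
have gsg n : g n \oc sg n = idm (C n).
  have dS m : g m \oc (cd Y m \oc S m) = cd C m \oc k m.
    by rewrite compA cmapP -compA gS.
  case: n => [|n] /=; first by rewrite dS k0.
  by rewrite compmDr dS compA gS kS.
have hP n : bip_out (f n) (sg n) \oc cs_d (cd X) (cd C) n
    = cd Y n \oc bip_out (f n.+1) (sg n.+1).
  by rewrite /cs_d /bip_map bip_out_in comp_bip_out /bip_out !compA cmapP sgP.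
exists (@ChMap _ (cplx_sum X C) Y (fun n => bip_out (f n) (sg n)) hP).
split=> n /=; last exact: bip_out_in1.
exists (bip_in (r n \oc (idm _ - sg n \oc g n)) (g n)); split.
  rewrite bip_in_comp -compA compBl comp1m -compA comp_bip_out gf gsg.
  rewrite -[RHS]bip_in_pr; congr bip_in; last by rewrite /bip_out comp0m add0r comp1m.
  rewrite /bip_out !comp0m add0r comp1m -addrA.
  by rewrite subrr addr0 compA rf comp1m.
have gz : g n \oc (idm _ - sg n \oc g n) = 0.
  by rewrite compBr compm1 compA gsg comp1m subrr.
have e w : g n \oc w = 0 -> f n \oc (r n \oc w) = w :> hom (Y n) (Y n).
  move=> gw; rewrite -[RHS]comp1m -frsg compmDl -(compA (s n)) gw compm0 addr0.
  by rewrite compA.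
by rewrite bip_out_in e // subrK.
Qed.

End ElementaryComplexes.

Section ElementaryFunctor.
Variables (A B : addCategory) (F : addFunctor A B).

Lemma elementary_fmap X Z : elementary X Z -> elementary (map_cplx F X) (fun n => F (Z n)).
Proof.
move=> [i [p [r [q [di ripq ir0 irqp rq0]]]]].
exists (fun n => fmap F (i n)), (fun n => fmap F (p n)), (fun n => fmap F (r n)),
  (fun n => fmap F (q n)); split=> /=.
- by move=> n; rewrite di fmapM.
- by move=> n; rewrite -!fmapM (proj1 (ripq n)) (proj2 (ripq n)) !fmap1.
- by rewrite -fmapM ir0 fmap1.
- by move=> n; rewrite -!fmapM -fmapD irqp fmap1.
- by move=> n; rewrite -!fmapM (proj1 (rq0 n)) (proj2 (rq0 n)) !fmap0.
Qed.

Definition cs_fmap X Y : chmap (map_cplx F (cplx_sum X Y))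
  (cplx_sum (map_cplx F X) (map_cplx F Y)).
Proof.
exists (fun n => fbip_iso F (X n) (Y n)) => n.
rewrite /= /cs_d /fbip_iso bip_in_comp bip_map_in -!fmapM.
by rewrite pr1_map pr2_map.
Defined.

(** With [D] the disk on [V], the isomorphism is [F (X (+) H) = F X (+) F H = F X (+) (cone u (+) D)
    = (Y (+) cone 1) (+) D = Y (+) E]. The middle step splits the cone extension by the
    contractibility of [cone u]; the others compare split complexes with the same cycles. So all
    that is needed of [H] is that [F H] has the cycles [Z (+) V]. *)
Lemma cylinder_isom (X H : cplx A) (Y E : cplx B) (u : chmap (map_cplx F X) Y)
    (Z V : nat -> B) :
  (exists b : nat, forall n, (b <= n)%N -> zero_object (V n)) ->
  elementary (cone u) Z ->
  elementary (map_cplx F H) (fun n => bip (Z n) (V n)) ->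
  elementary E (fun n => bip (F (X n)) (V n)) ->
  exists U : chmap (map_cplx F (cplx_sum X H)) (cplx_sum Y E),
    (forall n, isom (U n)) /\
    forall n, pr1 _ _ \oc (U n \oc fmap F (in1 (X n) (H n))) = u n.
Proof.
move=> V0 uZ HZ EX; have [k kc] := elementary_contraction uZ.
have [h [ih hin]] := contractible_quotient_isom (ce_retr_in u) (g := ce_out u)
  (ce_out_sect u) (ce_split u) kc.
have [c ic] := elementary_isom HZ (elementary_sum uZ (elementary_disk V0)).
have [e ie] := elementary_isom
  (elementary_sum (elementary_cone_id (map_cplx F X)) (elementary_disk V0)) EX.
pose D := disk V0.
exists (chmap_comp (cs_map (chmap_id Y) e) (chmap_comp (cs_assoc _ _ D)
  (chmap_comp (cs_map h (chmap_id D)) (chmap_comp (cs_assoc' _ _ D)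
  (chmap_comp (cs_map (chmap_id _) c) (cs_fmap X H)))))); split=> n /=.
  apply: isomM; last by apply: bip_map_isom; [exact: isom1 | exact: ie].
  apply: isomM; last exact: inverses_isom (bassoc_inverses _ _ _).
  apply: isomM; last by apply: bip_map_isom; [exact: ih | exact: isom1].
  apply: isomM; last by exists (bassoc _ _ _); case: (bassoc_inverses (F (X n)) (cone u n) (D n)).
  apply: isomM; last by apply: bip_map_isom; [exact: isom1 | exact: ic].
  exact: fbip_iso_isom.
have fin : fbip_iso F (X n) (H n) \oc fmap F (in1 (X n) (H n)) = in1 _ _.
  by rewrite /fbip_iso bip_in_comp -!fmapM pr1in1 pr2in1 fmap1 fmap0 in1E.
rewrite -!(compA (bip_map (idm (Y n)) (e n))) (compA (pr1 _ _)) pr1_map comp1m.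
rewrite -!compA fin bip_map_in1 compm1.
rewrite (compA (pr1 _ _)) pr1_bip_in bassoc'_in1.
rewrite (compA (bip_map (h n) _)) bip_map_in1 -!compA (hin n).
by rewrite (compA (pr1 _ _) (in1 _ _)) pr1in1 comp1m /= pr1_bip_in.
Qed.

End ElementaryFunctor.

Section IsomorphicSums.
Variable C : category.
Implicit Types A B D : C.

Lemma isomorphic_refl A : isomorphic A A.
Proof. by exists (idm A); exact: isom1. Qed.

Lemma isomorphic_sym A B : isomorphic A B -> isomorphic B A.
Proof. by move=> [f [g [gf fg]]]; exists g, f. Qed.

Lemma isomorphic_trans B A D : isomorphic A B -> isomorphic B D -> isomorphic A D.
Proof. by move=> [f fi] [g gi]; exists (g \oc f); exact: isomM. Qed.

End IsomorphicSums.

(** * Complements of cycles in the essential image of [F] *)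

Section Summands.
Variables (M N : exactCategory) (F : exactFunctor M N).
Implicit Types (A B D : N) (P Q : M).
Local Notation "A ~= B" := (isomorphic A B) (at level 70).

Lemma bip_congr A B A' B' : A ~= A' -> B ~= B' -> bip A B ~= bip A' B'.
Proof. by move=> [f fi] [g gi]; exists (bip_map f g); exact: bip_map_isom. Qed.

Lemma bip_comm A B : bip A B ~= bip B A.
Proof. by exists (swap A B); exact: swap_isom. Qed.

Lemma bip_assoc A B D : bip A (bip B D) ~= bip (bip A B) D.
Proof.
by apply: isomorphic_sym; exists (bassoc A B D); exact: inverses_isom (bassoc_inverses _ _ _).
Qed.

Lemma bip_left_comm A B D : bip A (bip B D) ~= bip B (bip A D).
Proof.
apply: (isomorphic_trans (bip_assoc _ _ _)).
apply: (isomorphic_trans (bip_congr (bip_comm A B) (isomorphic_refl D))).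
exact: isomorphic_sym (bip_assoc _ _ _).
Qed.

Lemma bip_interchange A B A' B' : bip (bip A B) (bip A' B') ~= bip (bip A A') (bip B B').
Proof.
apply: (isomorphic_trans (isomorphic_sym (bip_assoc _ _ _))).
apply: (isomorphic_trans (bip_congr (isomorphic_refl A) (bip_left_comm B A' B'))).
exact: bip_assoc.
Qed.

Lemma fmap_bip P Q : F (bip P Q) ~= bip (F P) (F Q).
Proof. by exists (fbip_iso F P Q); exact: fbip_iso_isom. Qed.

Definition ess_image A := exists P, A ~= F P.

Lemma ess_image_isom A B : A ~= B -> ess_image B -> ess_image A.
Proof. by move=> AB [P BP]; exists P; exact: isomorphic_trans BP. Qed.

Lemma ess_image_bip A B : ess_image A -> ess_image B -> ess_image (bip A B).
Proof.
move=> [P AP] [Q BQ]; exists (bip P Q).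
apply: (isomorphic_trans (bip_congr AP BQ)).
exact: isomorphic_sym (fmap_bip P Q).
Qed.

(** The relation [Z1 (+) F G = Z1 (+) Z (+) Y = F P (+) B (+) Y] replaces [Z1] by [B] and [Y], which
    [Bc] and [V] complete. The extra summand [F G'] makes the complement symmetric in [G] and [G'],
    so that one object serves both cones. *)
Lemma ess_image_step (P G G' : M) (B Bc Z Z1 Y V : N) :
  bip Z1 Z ~= bip (F P) B -> bip Z Y ~= F G -> ess_image (bip Y V) ->
  ess_image (bip B Bc) -> ess_image (bip Z1 (bip (bip (F G) (F G')) (bip Bc V))).
Proof.
move=> Z1Z ZY YV BB.
have FI Q : ess_image (F Q) by exists Q; exact: isomorphic_refl.
suff h : bip Z1 (F G) ~= bip (F P) (bip B Y).
  apply: (@ess_image_isom _ (bip (bip (F P) (F G')) (bip (bip B Bc) (bip Y V)))).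
    apply: (isomorphic_trans (bip_assoc _ _ _)).
    apply: (isomorphic_trans (bip_congr (bip_assoc _ _ _) (isomorphic_refl _))).
    apply: (isomorphic_trans (isomorphic_sym (bip_assoc _ _ _))).
    apply: (isomorphic_trans (bip_congr h (isomorphic_refl _))).
    apply: (isomorphic_trans (isomorphic_sym (bip_assoc _ _ _))).
    apply: (isomorphic_trans _ (bip_assoc _ _ _)).
    apply: bip_congr; first exact: isomorphic_refl.
    apply: (isomorphic_trans (bip_left_comm _ _ _)).
    apply: bip_congr; first exact: isomorphic_refl.
    exact: bip_interchange.
  by apply: ess_image_bip; apply: ess_image_bip.
apply: (isomorphic_trans (bip_congr (isomorphic_refl _) (isomorphic_sym ZY))).
apply: (isomorphic_trans (bip_assoc _ _ _)).
apply: (isomorphic_trans (bip_congr Z1Z (isomorphic_refl _))).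
exact: isomorphic_sym (bip_assoc _ _ _).
Qed.

(* The cycles of both cones have the same class modulo the image of [F], as
   the two complexes have the same target in each degree. *)
Lemma common_complement (cofF : cofinal F) (X X' : nat -> M) (B Z Z' : nat -> N) :
  Z 0 ~= B 0 -> Z' 0 ~= B 0 ->
  (forall n, bip (Z n.+1) (Z n) ~= bip (F (X n)) (B n.+1)) ->
  (forall n, bip (Z' n.+1) (Z' n) ~= bip (F (X' n)) (B n.+1)) ->
  forall n, exists Y, ess_image (bip (Z n) Y) /\ ess_image (bip (Z' n) Y).
Proof.
move=> Z0 Z'0 ZS Z'S; elim=> [|n [Y [[G ZG] [G' ZG']]]].
  have [A [P AP]] := cofF (B 0); exists A; split; exists P.
    exact: isomorphic_trans (bip_congr Z0 (isomorphic_refl A)) AP.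
  exact: isomorphic_trans (bip_congr Z'0 (isomorphic_refl A)) AP.
have [V YV] := cofF Y; have [A BA] := cofF (B n.+1).
exists (bip (bip (F G) (F G')) (bip A V)); split.
  exact: ess_image_step (ZS n) ZG YV BA.
apply: (ess_image_isom _ (ess_image_step G (Z'S n) ZG' YV BA)).
apply: bip_congr; first exact: isomorphic_refl.
by apply: bip_congr; [exact: bip_comm | exact: isomorphic_refl].
Qed.

Lemma elementary_cycles_isom (X : cplx N) (Z : nat -> N) : elementary X Z ->
  Z 0 ~= X 0 /\ forall n, bip (Z n.+1) (Z n) ~= X n.+1.
Proof.
move=> [i [p [r [q [di ripq ir0 irqp rq0]]]]]; split.
  by exists (i 0), (r 0); rewrite ir0 (proj1 (ripq 0)).
move=> n; exists (bip_out (i n.+1) (q n)), (bip_in (r n.+1) (p n)); split.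
  apply: bip_ext_out; rewrite -compA ?bip_out_in1 ?bip_out_in2 bip_in_comp comp1m.
    by rewrite (proj1 (ripq n.+1)) (proj2 (rq0 n)) in1E.
  by rewrite (proj2 (ripq n)) (proj1 (rq0 n)) in2E.
by rewrite bip_out_in irqp.
Qed.

Lemma elementary_bnd (X : cplx N) (Z : nat -> N) : elementary X Z ->
  exists b : nat, forall n, (b <= n)%N -> zero_object (Z n).
Proof.
move=> [i [p [r [q [di ripq _ _ _]]]]]; have [b bX] := cbnd X.
exists b => n /bX Xn; apply/zero_objectP.
by rewrite -(proj1 (ripq n)) (zero_object_in (i n) 0 Xn) compm0.
Qed.

End Summands.

Lemma sdr_sum (A : addCategory) (X H : cplx A) (k : forall n, hom (H n) (H n.+1)) :
  contraction k -> sdr (cs_in1 X H) (cs_pr1 X H) (fun n => bip_map 0 (k n)).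
Proof.
move=> [k0 kS _]; split=> [n|n||n]; rewrite /= /cs_d.
- exact: pr1in1.
- by rewrite bip_map_in1 compm0.
- by rewrite bip_map_comp compm0 k0 -[in1 _ _]compm1 in1_pr1 bip_mapD add0r addr0 bip_map1.
- rewrite !bip_map_comp compm0 comp0m -[in1 _ _]compm1 in1_pr1 !bip_mapD !add0r addr0.
  by rewrite kS bip_map1.
Qed.

Lemma sdr_fmap (A B : addCategory) (F : addFunctor A B) (X Y : cplx A)
    (u : chmap X Y) (v : chmap Y X) k :
  sdr u v k -> sdr (map_chmap F u) (map_chmap F v) (fun n => fmap F (k n)).
Proof.
move=> [vu ku k0 kS]; split=> [n|n||n]; rewrite /= -!fmapM -?fmapD.
- by rewrite vu fmap1.
- by rewrite ku fmap0.
- by rewrite k0 fmap1.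
- by rewrite kS fmap1.
Qed.

Lemma sdr_isom (A : addCategory) (X Y Z : cplx A) (u : chmap X Y) (v : chmap Y X) k
    (f : chmap Y Z) (g : chmap Z Y) :
  (forall n, g n \oc f n = idm (Y n) /\ f n \oc g n = idm (Z n)) -> sdr u v k ->
  sdr (chmap_comp f u) (chmap_comp v g) (fun n => f n.+1 \oc (k n \oc g n)).
Proof.
move=> gf [vu ku k0 kS]; split=> [n|n||n] /=.
- by rewrite -compA (compA (g n)) (proj1 (gf n)) comp1m vu.
- by rewrite -!compA (compA (g n)) (proj1 (gf n)) comp1m ku compm0.
- rewrite (compA (cd Z 0)) -cmapP -!compA -compmDr !(compA _ _ (g _)) -compmDl k0.
  by rewrite comp1m; exact: (proj2 (gf 0)).
- rewrite (compA (cd Z _)) -cmapP -!compA (cmapP g) -!compmDr !(compA _ _ (g _)).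
  by rewrite -!compmDl kS comp1m; exact: (proj2 (gf n.+1)).
Qed.

(** * Reduction to degreewise isomorphisms *)

Section Surjectivity.
Variables (M N : exactCategory) (F : exactFunctor M N).
Hypotheses (hM : supports_long_exact_sequences M) (hN : supports_long_exact_sequences N).
Local Notation cls := (@K0Grayson_cls M N F).

(** The new object is an extension of [X] by the diagonal object with zero part in [M] and [E] in
    [N]. The projection onto [X] only involves the first components of [wt] and [wb], so their
    components in [E] are free. *)
Lemma cls_sum_bdup (X : BF F) (E : cplx N) k
    (wt : chmap (map_cplx F (BF_Mtop X)) (top (bcplx_sum (BF_N X) (bdup E))))
    (wb : chmap (map_cplx F (BF_Mbot X)) (bot (bcplx_sum (BF_N X) (bdup E))))
    (qt : quasi_iso wt) (qb : quasi_iso wb) :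
  @contraction N E k ->
  (forall n, pr1 _ _ \oc wt n = BF_utop X n) ->
  (forall n, pr1 _ _ \oc wb n = BF_ubot X n) -> cls (BFOb qt qb) = cls X.
Proof.
move=> kc et eb; pose Y : BF F := BFOb qt qb.
have F0 n : zero_object (map_cplx F (conc zob) n).
  by apply: (@fmap_zero_object M N F); exact: zeroBF_M.
pose D := Delta_ob (CFOb (zero_quasi_iso hN (chmap0 (map_cplx F (conc zob)) E) F0 kc)).
have e1 n : in2 (BF_N X n) (E n) \oc BF_utop D n
    = BF_utop Y n \oc fmap F (chmap0 (conc zob) (BF_Mtop X) n).
  by rewrite /= fmap0 !compm0.
have e2 n : in2 (BF_N X n) (E n) \oc BF_ubot D n
    = BF_ubot Y n \oc fmap F (chmap0 (conc zob) (BF_Mbot X) n).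
  by rewrite /= fmap0 !compm0.
have inP (d : forall n, hom (BF_N X n.+1) (BF_N X n)) n :
    in2 (BF_N X n) (E n) \oc cd E n = cs_d d (cd E) n \oc in2 _ _.
  by rewrite /cs_d bip_map_in2.
have prP (d : forall n, hom (BF_N X n.+1) (BF_N X n)) n :
    pr1 (BF_N X n) (E n) \oc cs_d d (cd E) n = d n \oc pr1 _ _.
  by rewrite /cs_d pr1_map.
pose i := @BMap _ (bdup E) (bcplx_sum (BF_N X) (bdup E)) _
  (inP (bd (BF_N X))) (inP (bd' (BF_N X))).
pose p := @BMap _ (bcplx_sum (BF_N X) (bdup E)) (BF_N X) _
  (prP (bd (BF_N X))) (prP (bd' (BF_N X))).
have e3 n : p n \oc BF_utop Y n = BF_utop X n \oc fmap F (chmap_id (BF_Mtop X) n).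
  by rewrite fmap1 compm1; exact: et.
have e4 n : p n \oc BF_ubot Y n = BF_ubot X n \oc fmap F (chmap_id (BF_Mbot X) n).
  by rewrite fmap1 compm1; exact: eb.
rewrite (@K0Grayson_ses _ _ _ _ _ _ (@BFMor _ _ F D Y (chmap0 _ _) (chmap0 _ _) i e1 e2)
  (@BFMor _ _ F Y X (chmap_id _) (chmap_id _) p e3 e4)).
  by rewrite K0Grayson_Delta add0r.
split=> n /=.
- by apply: conflation_isom_r; [exact: isom1 | exact: zeroBF_M].
- by apply: conflation_isom_r; [exact: isom1 | exact: zeroBF_M].
apply: (split_conflation (r := pr2 _ _) (s := in1 _ _)).
- exact: pr2in2.
- exact: pr1in1.
- by rewrite addrC bipE.
Qed.

Hypotheses (splN : split_exact N) (cofF : cofinal F).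
Variable Phi : {additive K0Bass F -> K0Grayson F}.
Hypothesis PhiE : forall X, Phi (K0Bass_cls X) = cls (Psi F X).

Lemma in_image_cls (X : BF F) : in_image Phi (cls X).
Proof.
have [Zt et] := acyclic_splitting splN (BF_utopP X).
have [Zb eb] := acyclic_splitting splN (BF_ubotP X).
have [Zt0 ZtS] := elementary_cycles_isom et.
have [Zb0 ZbS] := elementary_cycles_isom eb.
pose P := BF_Mtop X; pose Q := BF_Mbot X.
(* Where the cycles of both cones vanish, the complement is chosen to be zero; this keeps the disks
   below bounded. *)
have com n : exists YGG : N * M * M,
    [/\ isomorphic (bip (Zt n) YGG.1.1) (F YGG.1.2),
        isomorphic (bip (Zb n) YGG.1.1) (F YGG.2) &
        (zero_object (Zt n) /\ zero_object (Zb n)) -> 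
        [/\ zero_object YGG.1.1, zero_object YGG.1.2 & zero_object YGG.2]].
  have [[zt zb]|nz] := pselect (zero_object (Zt n) /\ zero_object (Zb n)).
    have Fz : zero_object (F (zob : M)) by apply: (@fmap_zero_object M N F); exact: zobP.
    have z (A : N) : zero_object A -> isomorphic (bip A zob) (F zob).
      move=> A0; exists 0; apply: zero_object_isom => //.
      by apply: zero_object_bip => //; exact: zobP.
    by exists (zob, zob, zob); split=> [||_]; [exact: z | exact: z | split; exact: zobP].
  have [Y [[G YG] [G' YG']]] := @common_complement _ _ F cofF P Q (BF_N X) Zt Zb Zt0 Zb0 ZtS ZbS n.
  by exists (Y, G, G').
have {com} /dep_choice[YGG YGGP] := com.
pose Y n := (YGG n).1.1; pose G n := (YGG n).1.2; pose G' n := (YGG n).2.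
have [b bZ] : exists b : nat, forall n, (b <= n)%N ->
    [/\ zero_object (P n), zero_object (Q n), zero_object (Y n), zero_object (G n)
      & zero_object (G' n)].
  have [b1 bP] := cbnd P; have [b2 bQ] := cbnd Q.
  have [b3 bt] := elementary_bnd et; have [b4 bb] := elementary_bnd eb.
  exists (maxn b1 (maxn b2 (maxn b3 b4))) => n; rewrite !geq_max => /and4P[n1 n2 n3 n4].
  have [_ _ []] := YGGP n; first by split; [exact: bt | exact: bb].
  by split=> //; [exact: bP | exact: bQ].
have ZG n : isomorphic (bip (Zt n) (Y n)) (F (G n)) by have [] := YGGP n.
have ZG' n : isomorphic (bip (Zb n) (Y n)) (F (G' n)) by have [] := YGGP n.
have Fz (A : M) : zero_object A -> zero_object (F A) := @fmap_zero_object M N F A.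
have bH : exists b : nat, forall n, (b <= n)%N -> zero_object (bip (Q n) (G n)).
  by exists b => n /bZ[*]; exact: zero_object_bip.
have bH' : exists b : nat, forall n, (b <= n)%N -> zero_object (bip (P n) (G' n)).
  by exists b => n /bZ[*]; exact: zero_object_bip.
have bV : exists b : nat, forall n, (b <= n)%N -> zero_object (bip (F (Q n)) (Y n)).
  by exists b => n /bZ[*]; apply: zero_object_bip => //; exact: Fz.
have bV' : exists b : nat, forall n, (b <= n)%N -> zero_object (bip (F (P n)) (Y n)).
  by exists b => n /bZ[*]; apply: zero_object_bip => //; exact: Fz.
have bW : exists b : nat, forall n, (b <= n)%N ->
    zero_object (bip (F (P n)) (bip (F (Q n)) (Y n))).
  by exists b => n /bZ[*]; apply: zero_object_bip; [|apply: zero_object_bip => //]; exact: Fz.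
(* [cylinder_isom] is used with [V = F Q (+) Y] for the top and [V = F P (+) Y] for the bottom. The
   required cycles of [E] are then [F P (+) F Q (+) Y] for both, up to order, so the same [E] can be
   added to [N] diagonally. *)
pose H := disk bH; pose H' := disk bH'; pose E := disk bW.
have elH (A B : N) (R K : M) : isomorphic (bip A B) (F K) ->
    isomorphic (F (bip R K)) (bip A (bip (F R) B)).
  move=> AB; apply: (isomorphic_trans (fmap_bip F _ _)).
  apply: (isomorphic_trans (bip_congr (isomorphic_refl _) (isomorphic_sym AB))).
  exact: bip_left_comm.
have [Ut [iUt Utin]] := cylinder_isom (H := H) (E := E) bV et
  (elementary_cycles (fun n => elH _ _ _ _ (ZG n)) (elementary_fmap F (elementary_disk bH)))
  (elementary_disk bW).
have [Ub [iUb Ubin]] := cylinder_isom (H := H') (E := E) bV' eb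
  (elementary_cycles (fun n => elH _ _ _ _ (ZG' n)) (elementary_fmap F (elementary_disk bH')))
  (elementary_cycles (fun n => bip_left_comm _ _ _) (elementary_disk bW)).
pose B := bcplx_sum (BF_N X) (bdup E).
have [k kc] := elementary_contraction (elementary_disk bH).
have [k' kc'] := elementary_contraction (elementary_disk bH').
have [l lc] := elementary_contraction (elementary_disk bW).
have [Vt VtU] := chmap_inv iUt; have [Vb VbU] := chmap_inv iUb.
pose wt : chmap (map_cplx F P) (top B) := chmap_comp Ut (map_chmap F (cs_in1 P H)).
pose wb : chmap (map_cplx F Q) (bot B) := chmap_comp Ub (map_chmap F (cs_in1 Q H')).
have qt : quasi_iso wt := sdr_quasi_iso hN (sdr_isom VtU (sdr_fmap F (sdr_sum P kc))).
have qb : quasi_iso wb := sdr_quasi_iso hN (sdr_isom VbU (sdr_fmap F (sdr_sum Q kc'))).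
rewrite -(@cls_sum_bdup X E l wt wb qt qb lc Utin Ubin).
pose S : BF F := @BFOb _ _ F P Q B wt wb qt qb.
pose T : BF F := @BFOb _ _ F (cplx_sum P H) (cplx_sum Q H') B Ut Ub
  (iso_quasi_iso hN iUt) (iso_quasi_iso hN iUb).
(* [S] arises from [X] by adding [E] to [N]. Adding [H] and [H'] to [M] gives a morphism [S -> T] in
   [pB], and in [T] both structure maps are degreewise isomorphisms. *)
have <- : cls T = cls S.
  apply/esym.
  have e1 n : idm (B n) \oc BF_utop S n = BF_utop T n \oc fmap F (cs_in1 P H n).
    by rewrite comp1m.
  have e2 n : idm (B n) \oc BF_ubot S n = BF_ubot T n \oc fmap F (cs_in1 Q H' n).
    by rewrite comp1m.
  apply: (@K0Grayson_p _ _ _ _ _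
    (@BFMor _ _ F S T (cs_in1 P H) (cs_in1 Q H') (bmap_id B) e1 e2)).
  split; first exact: (sdr_quasi_iso hM (sdr_sum P kc)).
    exact: (sdr_quasi_iso hM (sdr_sum Q kc')).
  by exists (bmap_id B); split; apply: bmap_eq => n /=; rewrite comp1m.
exact: (in_image_isom hM hN PhiE (X := T)).
Qed.

Lemma Bass_to_Grayson_surjective z : in_image Phi z.
Proof.
move: z; apply: K0Grayson_ind.
- by exists 0; rewrite raddf0.
- exact: in_image_cls.
- by move=> y z [v <-] [w <-]; exists (v - w); rewrite raddfB.
Qed.

End Surjectivity.

Theorem theorem1p3 (M N : exactCategory)
    (hM : supports_long_exact_sequences M)
    (hN : supports_long_exact_sequences N)
    (F : exactFunctor M N) :
  exists Phi : {additive K0Bass F -> K0Grayson F},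
    (forall X : co F, Phi (K0Bass_cls X) = K0Grayson_cls (Psi F X)) /\
    (split_exact M -> split_exact N -> cofinal F -> bijective Phi).
Proof.
have [Phi PhiE] := Bass_to_Grayson F hM hN; exists Phi; split=> // splM splN cofF.
have [Th ThE] := Grayson_to_Bass splM splN cofF hM hN.
have ThPhi w : Th (Phi w) = w.
  move: w; apply: K0Bass_ind.
  - by rewrite !raddf0.
  - by move=> X; rewrite PhiE.
  - by move=> y z Ey Ez; rewrite !raddfB Ey Ez.
(* Surjectivity of [Phi] turns the left inverse [Th] into a two-sided one. *)
exists Th => // z.
have [w <-] := Bass_to_Grayson_surjective hM hN splN cofF PhiE z.
by rewrite ThPhi.
Qed.
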